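(* Let $f$ be a transcendental entire function and let $b\in\mathbb{C}$ be a nonzero value such that for all $z\in\mathbb{C}$, $f'(z)=b\Rightarrow f(z)=b$. If the value $a\in\mathbb{C}$ is taken by $f$ only finitely often, then $a\neq b$ and $$f(z)=Ce^{\frac{b}{b-a}z}+a$$ where $C$ is a nonzero constant. In particular, $a$ is a Picard exceptional value of $f$, all $b$-points of $f'$ are simple, and $b$ is a shared value of $f$ and $f'$. Furthermore, if $a=0$ then $f\equiv f'$.
   Context: A $b$-point of a function $h$ is a point $z_0$ with $h(z_0)=b$; it is simple if it is a simple zero of $h-b$. The value $a$ is a Picard exceptional value of $f$ if $f(z)\neq a$ for all $z\in\mathbb{C}$. The value $b$ is shared by $f$ and $f'$ if for all $z_0\in\mathbb{C}$: $f(z_0)=b\Leftrightarrow f'(z_0)=b$ (multiplicities ignored). *)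

(* Defs.v *)
From Stdlib Require Import Reals List.
From Coquelicot Require Import Coquelicot.

Open Scope C_scope.

Definition Cexp (z : C) : C :=
  ((exp (Re z) * cos (Im z))%R, (exp (Re z) * sin (Im z))%R).

Definition entire (f : C -> C) : Prop :=
  forall z : C, ex_derive (K := C_AbsRing) (V := C_NormedModule) f z.

Definition polynomial_function (f : C -> C) : Prop :=
  exists (n : nat) (c : nat -> C),
    forall z : C, f z = sum_n (G := C_Ring) (fun k : nat => c k * z ^ k) n.

Definition transcendental_entire (f : C -> C) : Prop :=
  entire f /\ ~ polynomial_function f.

Definition taken_finitely_often (f : C -> C) (a : C) : Prop :=
  exists l : list C, forall z : C, f z = a -> In z l.

Definition picard_exceptional (f : C -> C) (a : C) : Prop :=
  forall z : C, f z <> a.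

Definition b_point (h : C -> C) (b z0 : C) : Prop := h z0 = b.

(* C_derive is a total function with an arbitrary value where the complex
   derivative does not exist, so existence is asserted explicitly. *)
Definition simple_zero (h : C -> C) (z0 : C) : Prop :=
  h z0 = 0 /\
  exists l : C,
    is_derive (K := C_AbsRing) (V := C_NormedModule) h z0 l /\ l <> 0.

Definition simple_b_point (h : C -> C) (b z0 : C) : Prop :=
  simple_zero (fun z : C => h z - b) z0.

Definition shared_value (f g : C -> C) (b : C) : Prop :=
  forall z0 : C, f z0 = b <-> g z0 = b.

(* Main.v *)
(** Divide out the finitely many zeros of [f - a] to get [f = a + K P e^g] with
    [P] a polynomial and [g] entire, [g 0 = 0].  At a point with [f' = b] the
    hypothesis gives [(b - a) (P'/P + g') = b], so [g'] is not large there.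

    On the zero set of [Re g] the derivative [g'] grows at most like [|z|^(1/2)]:
    otherwise a point-picking argument in the style of Brody and Zalcman yields a
    zero [z0] of [Re g], with [A = g' z0] huge, such that [|g'| <= 4 |A|] on the
    nearby zeros of [Re g].  A Hopf-type boundary estimate and the
    Borel-Caratheodory inequality show that [g'] is almost equal to [A] on a disc
    around [z0] whose radius is large compared with [log |A| / |A|].  There [f']
    looks like a constant multiple of [e^(A z)], hence takes the value [b], at a
    point where [g'] is large: a contradiction.

    The Hopf-type estimate now bounds [Re g] by a multiple of [1 + |z|^(3/2)], so
    [g z = lam z].  Then [f' = b] has solutions tending to infinity; there
    [P'/P] tends to [0], which forces [(b - a) lam = b] and then [P'/P = 0] at
    such points, so [P] is constant.

    The function theory starts from Goursat's theorem on triangles; the maximum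
    principle is proved by a second-difference argument, and all estimates,
    including the differentiability of [f'], are drawn from it instead of
    Cauchy's integral formula. *)

Require Import Defs.
From Stdlib Require Import Reals List.
From Coquelicot Require Import Coquelicot.
From Stdlib Require Import Lra Lia Classical ClassicalEpsilon.

Open Scope C_scope.

Arguments Cmod _%_C_scope.
Arguments Re _%_C_scope.
Arguments Im _%_C_scope.

(* Inequalities between reals, whose complex subterms stay in [C_scope]. *)
Local Notation "x <= y" := (Rle x y) : C_scope.
Local Notation "x < y" := (Rlt x y) : C_scope.
Local Notation "x <= y <= z" := (Rle x y /\ Rle y z) : C_scope.

(** * Complex derivatives *)

(** On the zero set of Re g the exponential has modulus 1, so |f'| = |K P (P'/P + g')| there is
    polynomial in |z| and |g'|. Reaching the value b then takes a change of g of logarithmic size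
    only; elsewhere e^g may be too large or too small to be compensated within a disc where g is
    almost linear. The exponent 1/2 is one choice between 0 and 1: being positive, it makes |z| at
    most of order |g'|^2 wherever the bound fails, so that log |P| is of order log |g'|; being below
    1, it makes the resulting bound on Re g subquadratic.

    The function theory has a circularity to break: the second-difference proof of the maximum
    principle needs two derivatives, while the differentiability of f' is what the principle is to
    yield. A primitive, available by Goursat's theorem, helps: its difference quotients are twice
    differentiable and converge to f locally uniformly. So the estimates are proved for functions
    with two derivatives, in a form free of derivatives that survives the limit. *)

Lemma Cmod_sub_sym (x y : C) : Cmod (x - y) = Cmod (y - x).
Proof. rewrite <- Cmod_opp. f_equal. ring. Qed.

Lemma Cmod_sub_le (x y : C) : (Cmod (x - y) <= Cmod x + Cmod y).
Proof. unfold Cminus. rewrite <- (Cmod_opp y). apply Cmod_triangle. Qed.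

Lemma Cmod_sub_ge (x y : C) : (Cmod x - Cmod y <= Cmod (x - y)).
Proof.
  assert (H := Cmod_triangle (x - y) y).
  replace (x - y + y) with x in H by ring. lra.
Qed.

Lemma Cmod_sub_triangle (x y z : C) : (Cmod (x - z) <= Cmod (x - y) + Cmod (y - z)).
Proof. replace (x - z) with ((x - y) + (y - z)) by ring. apply Cmod_triangle. Qed.

Lemma Cmod_self_sub (z : C) : Cmod (z - z) = 0%R.
Proof. replace (z - z) with (RtoC 0) by ring. apply Cmod_0. Qed.

Lemma Cmod_sub_pos (x y : C) : x <> y -> (0 < Cmod (x - y)).
Proof.
  intros H. apply Cmod_gt_0. intros E. apply H.
  replace x with (x - y + y) by ring. rewrite E. ring.
Qed.

Lemma Cmod_le_re_im (z : C) : (Cmod z <= Rabs (Re z) + Rabs (Im z)).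
Proof.
  destruct z as [x y]. unfold Re, Im; simpl.
  replace (x, y) with (RtoC x + Ci * RtoC y)%C.
  2:{ unfold RtoC, Ci, Cplus, Cmult; simpl. f_equal; ring. }
  eapply Rle_trans; [apply Cmod_triangle|].
  rewrite Cmod_mult, Cmod_Ci, !Cmod_R. lra.
Qed.

Lemma im_le_Cmod (c : C) : (Rabs (Im c) <= Cmod c).
Proof. eapply Rle_trans; [apply Rmax_r | apply Rmax_Cmod]. Qed.

Lemma re_bounds (c : C) : (- Cmod c <= Re c <= Cmod c).
Proof. apply Rabs_le_between, re_le_Cmod. Qed.

Lemma Cmod_sqr_re_im (c : C) : (Cmod c * Cmod c = Re c * Re c + Im c * Im c)%R.
Proof. generalize (Cmod2_alt c). intros H. simpl in H. lra. Qed.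

Lemma Csub_neq_0 (x y : C) : x <> y -> x - y <> 0.
Proof. intros H E. apply H. replace x with (x - y + y) by ring. rewrite E. ring. Qed.

(** An epsilon-delta form of [is_derive], suited to explicit estimates. The error is compared with
    [eps * Cmod h] by a weak inequality, so [h = 0] needs no exception. *)
Definition has_cderiv (f : C -> C) (z l : C) : Prop :=
  forall eps : R, (0 < eps) -> exists d : R, (0 < d) /\
    forall h : C, (Cmod h < d) ->
      (Cmod (f (z + h) - f z - l * h) <= eps * Cmod h).

Definition ccont (f : C -> C) (z : C) : Prop :=
  forall eps : R, (0 < eps) -> exists d : R, (0 < d) /\
    forall w : C, (Cmod (w - z) < d) -> (Cmod (f w - f z) < eps).

Lemma is_derive_has_cderiv (f : C -> C) (z l : C) :
  is_derive (K := C_AbsRing) (V := C_NormedModule) f z l <-> has_cderiv f z l.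
Proof.
  split.
  - intros [_ H] eps He.
    specialize (H z (fun P HP => HP) (mkposreal eps He)).
    destruct H as [d Hd]. exists d. split; [apply cond_pos|].
    intros h Hh. specialize (Hd (z + h)).
    assert (B : @ball (AbsRing_UniformSpace C_AbsRing) z d (z + h)).
    { change (Cmod (z + h - z) < d). replace (z + h - z) with h by ring. exact Hh. }
    specialize (Hd B).
    change (Cmod (f (z + h) - f z - (z + h - z) * l) <= eps * Cmod (z + h - z)) in Hd.
    replace (z + h - z) with h in Hd by ring.
    rewrite (Cmult_comm l h). exact Hd.
  - intros H. split.
    + apply (is_linear_scal_l (K := C_AbsRing) (V := C_NormedModule) l).
    + intros x Hx. apply (is_filter_lim_locally_unique (K := C_AbsRing) (V := AbsRing_NormedModule C_AbsRing)) in Hx. subst x.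
      intros eps. destruct (H eps (cond_pos eps)) as [d [Hd H1]].
      exists (mkposreal d Hd). intros y Hy'.
      change (Cmod (y - z) < d) in Hy'.
      specialize (H1 _ Hy'). replace (z + (y - z)) with (y : C) in H1 by (change C in y; ring).
      change (Cmod (f y - f z - (y - z) * l) <= eps * Cmod (y - z)).
      rewrite (Cmult_comm _ l). exact H1.
Qed.

Lemma has_cderiv_ext (f g : C -> C) (z l : C) :
  (forall w, f w = g w) -> has_cderiv f z l -> has_cderiv g z l.
Proof.
  intros E H eps He. destruct (H eps He) as [d [Hd H1]].
  exists d; split; auto. intros h Hh. rewrite <- !E. auto.
Qed.

Lemma has_cderiv_local (f g : C -> C) (z l : C) (r : R) :
  (0 < r) -> (forall w, (Cmod (w - z) < r) -> f w = g w) ->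
  has_cderiv f z l -> has_cderiv g z l.
Proof.
  intros Hr E H eps He. destruct (H eps He) as [d [Hd H1]].
  exists (Rmin d r); split; [apply Rmin_pos; auto|]. intros h Hh.
  assert (Cmod h < d /\ Cmod h < r) as [A B].
  { split; eapply Rlt_le_trans; [exact Hh | apply Rmin_l | exact Hh | apply Rmin_r]. }
  rewrite <- !E; auto.
  - rewrite Cmod_self_sub; auto.
  - replace (z + h - z) with h by ring; auto.
Qed.

Lemma has_cderiv_const (c z : C) : has_cderiv (fun _ => c) z 0.
Proof.
  intros eps He. exists 1%R. split; [lra|]. intros h _.
  replace (c - c - 0 * h) with (RtoC 0) by ring. rewrite Cmod_0.
  apply Rmult_le_pos; [lra | apply Cmod_ge_0].
Qed.

Lemma has_cderiv_id (z : C) : has_cderiv (fun w => w) z 1.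
Proof.
  intros eps He. exists 1%R. split; [lra|]. intros h _.
  replace (z + h - z - 1 * h) with (RtoC 0) by ring. rewrite Cmod_0.
  apply Rmult_le_pos; [lra | apply Cmod_ge_0].
Qed.

Lemma has_cderiv_plus (f g : C -> C) (z l m : C) :
  has_cderiv f z l -> has_cderiv g z m -> has_cderiv (fun w => f w + g w) z (l + m).
Proof.
  intros Hf Hg eps He.
  destruct (Hf (eps / 2)%R ltac:(lra)) as [d1 [P1 H1]].
  destruct (Hg (eps / 2)%R ltac:(lra)) as [d2 [P2 H2]].
  exists (Rmin d1 d2); split; [apply Rmin_pos; auto|]. intros h Hh.
  specialize (H1 h (Rlt_le_trans _ _ _ Hh (Rmin_l _ _))).
  specialize (H2 h (Rlt_le_trans _ _ _ Hh (Rmin_r _ _))).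
  replace (f (z + h) + g (z + h) - (f z + g z) - (l + m) * h)
    with ((f (z + h) - f z - l * h) + (g (z + h) - g z - m * h)) by ring.
  eapply Rle_trans; [apply Cmod_triangle|]. lra.
Qed.

Lemma has_cderiv_lipschitz (f : C -> C) (z l : C) :
  has_cderiv f z l -> exists d, (0 < d) /\ forall h, (Cmod h < d) ->
    (Cmod (f (z + h) - f z) <= (Cmod l + 1) * Cmod h).
Proof.
  intros H. destruct (H 1%R Rlt_0_1) as [d [Hd H1]]. exists d; split; auto.
  intros h Hh. specialize (H1 h Hh).
  replace (f (z + h) - f z) with ((f (z + h) - f z - l * h) + l * h) by ring.
  eapply Rle_trans; [apply Cmod_triangle|]. rewrite Cmod_mult. lra.
Qed.

Lemma has_cderiv_ccont (f : C -> C) (z l : C) : has_cderiv f z l -> ccont f z.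
Proof.
  intros H eps He. destruct (has_cderiv_lipschitz _ _ _ H) as [d [Hd H1]].
  assert (K : (0 < Cmod l + 1)) by (generalize (Cmod_ge_0 l); lra).
  exists (Rmin d (eps / (Cmod l + 1)))%R. split.
  { apply Rmin_pos; auto. apply Rdiv_lt_0_compat; auto. }
  intros w Hw. specialize (H1 (w - z) (Rlt_le_trans _ _ _ Hw (Rmin_l _ _))).
  replace (z + (w - z)) with w in H1 by ring.
  eapply Rle_lt_trans; [exact H1|].
  assert (Hw2 := Rlt_le_trans _ _ _ Hw (Rmin_r _ _)).
  apply Rmult_lt_compat_l with (r := (Cmod l + 1)%R) in Hw2; auto.
  replace ((Cmod l + 1) * (eps / (Cmod l + 1)))%R with eps in Hw2 by (field; lra).
  exact Hw2.
Qed.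

Lemma has_cderiv_mult (f g : C -> C) (z l m : C) :
  has_cderiv f z l -> has_cderiv g z m ->
  has_cderiv (fun w => f w * g w) z (l * g z + f z * m).
Proof.
  intros Hf Hg eps He.
  set (K := (Cmod l + 1 + Cmod (g z) + Cmod (f z) + 1)%R).
  assert (HK : (1 <= K)).
  { unfold K. generalize (Cmod_ge_0 l) (Cmod_ge_0 (g z)) (Cmod_ge_0 (f z)); lra. }
  set (e := (eps / (3 * K))%R).
  assert (He' : (0 < e)) by (unfold e; apply Rdiv_lt_0_compat; lra).
  destruct (Hf e He') as [d1 [P1 H1]].
  destruct (Hg e He') as [d2 [P2 H2]].
  destruct (has_cderiv_lipschitz _ _ _ Hf) as [d3 [P3 H3]].
  destruct (has_cderiv_ccont _ _ _ Hg e He') as [d4 [P4 H4]].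
  exists (Rmin (Rmin d1 d2) (Rmin d3 d4)). split; [repeat apply Rmin_pos; auto|].
  intros h Hh.
  assert (h1 : (Cmod h < d1)) by (eapply Rlt_le_trans; [exact Hh|]; eapply Rle_trans; [apply Rmin_l|apply Rmin_l]).
  assert (h2 : (Cmod h < d2)) by (eapply Rlt_le_trans; [exact Hh|]; eapply Rle_trans; [apply Rmin_l|apply Rmin_r]).
  assert (h3 : (Cmod h < d3)) by (eapply Rlt_le_trans; [exact Hh|]; eapply Rle_trans; [apply Rmin_r|apply Rmin_l]).
  assert (h4 : (Cmod h < d4)) by (eapply Rlt_le_trans; [exact Hh|]; eapply Rle_trans; [apply Rmin_r|apply Rmin_r]).
  specialize (H1 h h1). specialize (H2 h h2). specialize (H3 h h3).
  specialize (H4 (z + h)). replace (z + h - z) with h in H4 by ring. specialize (H4 h4).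
  replace (f (z + h) * g (z + h) - f z * g z - (l * g z + f z * m) * h)
    with ((f (z + h) - f z) * (g (z + h) - g z)
          + ((f (z + h) - f z - l * h) * g z + f z * (g (z + h) - g z - m * h))) by ring.
  eapply Rle_trans; [apply Cmod_triangle|].
  eapply Rle_trans; [apply Rplus_le_compat_l, Cmod_triangle|].
  rewrite !Cmod_mult.
  assert (Hh0 := Cmod_ge_0 h).
  assert (A1 : (Cmod (f (z + h) - f z) * Cmod (g (z + h) - g z) <= K * Cmod h * e)).
  { apply Rmult_le_compat; try apply Cmod_ge_0; [|lra].
    eapply Rle_trans; [exact H3|]. apply Rmult_le_compat_r; auto.
    unfold K. generalize (Cmod_ge_0 (g z)) (Cmod_ge_0 (f z)); lra. }
  assert (A2 : (Cmod (f (z + h) - f z - l * h) * Cmod (g z) <= e * Cmod h * K)).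
  { apply Rmult_le_compat; try apply Cmod_ge_0; [exact H1|].
    unfold K. generalize (Cmod_ge_0 l) (Cmod_ge_0 (f z)); lra. }
  assert (A3 : (Cmod (f z) * Cmod (g (z + h) - g z - m * h) <= K * (e * Cmod h))).
  { apply Rmult_le_compat; try apply Cmod_ge_0; [|exact H2].
    unfold K. generalize (Cmod_ge_0 l) (Cmod_ge_0 (g z)); lra. }
  replace (eps * Cmod h)%R with (3 * (K * e * Cmod h))%R by (unfold e; field; lra).
  lra.
Qed.

Lemma has_cderiv_scal (c : C) (f : C -> C) (z l : C) :
  has_cderiv f z l -> has_cderiv (fun w => c * f w) z (c * l).
Proof.
  intros H. replace (c * l) with (0 * f z + c * l) by ring.
  apply (has_cderiv_mult (fun _ => c) f); auto. apply has_cderiv_const.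
Qed.

Lemma has_cderiv_opp (f : C -> C) (z l : C) :
  has_cderiv f z l -> has_cderiv (fun w => - f w) z (- l).
Proof.
  intros H. replace (- l) with (- (1) * l) by ring.
  apply has_cderiv_ext with (fun w => - (1) * f w); [intros; ring|].
  apply has_cderiv_scal; auto.
Qed.

Lemma has_cderiv_minus (f g : C -> C) (z l m : C) :
  has_cderiv f z l -> has_cderiv g z m -> has_cderiv (fun w => f w - g w) z (l - m).
Proof. intros. apply has_cderiv_plus; auto. apply has_cderiv_opp; auto. Qed.

Lemma has_cderiv_comp (f g : C -> C) (z l m : C) :
  has_cderiv f (g z) l -> has_cderiv g z m ->
  has_cderiv (fun w => f (g w)) z (l * m).
Proof.
  intros Hf Hg eps He.
  assert (Kl := Cmod_ge_0 l). assert (Km := Cmod_ge_0 m).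
  set (e1 := (eps / (2 * (Cmod m + 1)))%R).
  set (e2 := (eps / (2 * (Cmod l + 1)))%R).
  assert (E1 : (0 < e1)) by (apply Rdiv_lt_0_compat; lra).
  assert (E2 : (0 < e2)) by (apply Rdiv_lt_0_compat; lra).
  destruct (Hf e1 E1) as [d1 [P1 H1]].
  destruct (Hg e2 E2) as [d2 [P2 H2]].
  destruct (has_cderiv_lipschitz _ _ _ Hg) as [d3 [P3 H3]].
  destruct (has_cderiv_ccont _ _ _ Hg d1 P1) as [d4 [P4 H4]].
  exists (Rmin d2 (Rmin d3 d4)). split; [repeat apply Rmin_pos; auto|].
  intros h Hh.
  assert (h2 : (Cmod h < d2)) by (eapply Rlt_le_trans; [exact Hh|]; apply Rmin_l).
  assert (h3 : (Cmod h < d3)) by (eapply Rlt_le_trans; [exact Hh|]; eapply Rle_trans; [apply Rmin_r|apply Rmin_l]).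
  assert (h4 : (Cmod h < d4)) by (eapply Rlt_le_trans; [exact Hh|]; eapply Rle_trans; [apply Rmin_r|apply Rmin_r]).
  specialize (H2 h h2). specialize (H3 h h3).
  specialize (H4 (z + h)). replace (z + h - z) with h in H4 by ring. specialize (H4 h4).
  specialize (H1 _ H4). replace (g z + (g (z + h) - g z)) with (g (z + h)) in H1 by ring.
  replace (f (g (z + h)) - f (g z) - l * m * h)
    with ((f (g (z + h)) - f (g z) - l * (g (z + h) - g z))
          + l * (g (z + h) - g z - m * h)) by ring.
  eapply Rle_trans; [apply Cmod_triangle|]. rewrite Cmod_mult.
  assert (Hh0 := Cmod_ge_0 h).
  assert (A1 : (e1 * Cmod (g (z + h) - g z) <= eps / 2 * Cmod h)).
  { replace (eps / 2 * Cmod h)%R with (e1 * ((Cmod m + 1) * Cmod h))%R by (unfold e1; field; lra).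
    apply Rmult_le_compat_l; lra. }
  assert (A2 : (Cmod l * Cmod (g (z + h) - g z - m * h) <= eps / 2 * Cmod h)).
  { replace (eps / 2 * Cmod h)%R with ((Cmod l + 1) * (e2 * Cmod h))%R by (unfold e2; field; lra).
    apply Rmult_le_compat; try apply Cmod_ge_0; lra. }
  lra.
Qed.

Lemma has_cderiv_inv (z : C) : z <> 0 -> has_cderiv (fun w => / w) z (- / (z * z)).
Proof.
  intros Hz eps He.
  assert (Z : (0 < Cmod z)) by (apply Cmod_gt_0; auto).
  set (c := (Cmod z / 2)%R).
  exists (Rmin c (eps * (c * Cmod z * Cmod z)))%R.
  assert (Hc : (0 < c)) by (unfold c; lra).
  split.
  { apply Rmin_pos; [lra|]. apply Rmult_lt_0_compat; auto.
    apply Rmult_lt_0_compat; auto. apply Rmult_lt_0_compat; auto. }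
  intros h Hh.
  assert (h1 := Rlt_le_trans _ _ _ Hh (Rmin_l _ _)).
  assert (h2 := Rlt_le_trans _ _ _ Hh (Rmin_r _ _)).
  assert (B : (c <= Cmod (z + h))).
  { assert (T := Cmod_sub_ge z (- h)). rewrite Cmod_opp in T.
    replace (z - - h) with (z + h) in T by ring. unfold c in *. lra. }
  clearbody c.
  assert (N : z + h <> 0) by (apply Cmod_gt_0; lra).
  replace (/ (z + h) - / z - - / (z * z) * h) with (h * h / ((z + h) * z * z)) by (field; auto).
  rewrite Cmod_div by (repeat apply Cmult_neq_0; auto).
  rewrite !Cmod_mult.
  assert (Hh0 := Cmod_ge_0 h).
  apply Rle_trans with (Cmod h * Cmod h / (c * Cmod z * Cmod z))%R.
  { apply Rmult_le_compat_l; [nra|]. apply Rinv_le_contravar.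
    - repeat apply Rmult_lt_0_compat; auto.
    - apply Rmult_le_compat_r; [lra|]. apply Rmult_le_compat_r; lra. }
  set (q := (c * Cmod z * Cmod z)%R) in *.
  assert (Hq : (0 < q)) by (unfold q; repeat apply Rmult_lt_0_compat; auto).
  apply Rmult_le_reg_r with q; auto.
  replace (Cmod h * Cmod h / q * q)%R with (Cmod h * Cmod h)%R by (field; lra).
  nra.
Qed.

Lemma has_cderiv_div (f g : C -> C) (z l m : C) :
  has_cderiv f z l -> has_cderiv g z m -> g z <> 0 ->
  has_cderiv (fun w => f w / g w) z ((l * g z - f z * m) / (g z * g z)).
Proof.
  intros Hf Hg N.
  replace ((l * g z - f z * m) / (g z * g z))
    with (l * / g z + f z * (- / (g z * g z) * m)) by (field; auto).
  apply (has_cderiv_mult f (fun w => / g w)); auto.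
  apply (has_cderiv_comp Cinv g); auto. apply has_cderiv_inv; auto.
Qed.

Lemma has_cderiv_unique (f : C -> C) (z l m : C) :
  has_cderiv f z l -> has_cderiv f z m -> l = m.
Proof.
  intros H1 H2. apply is_derive_has_cderiv, is_C_derive_unique in H1.
  apply is_derive_has_cderiv, is_C_derive_unique in H2. congruence.
Qed.

(* Restriction to the segment from [a] to [b], projected on the direction [f b - f a],
   reduces this to the real mean value theorem. *)
Lemma mean_value_bound (f df : C -> C) (a b : C) (M : R) :
  (forall t : R, (0 <= t <= 1) -> has_cderiv f (a + t * (b - a)) (df (a + t * (b - a)))) ->
  (forall t : R, (0 <= t <= 1) -> (Cmod (df (a + t * (b - a))) <= M)) ->
  (Cmod (f b - f a) <= M * Cmod (b - a)).
Proof.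
  intros Hd HM.
  set (d := Cconj (f b - f a)).
  set (phi := fun t : R => Re (d * f (a + t * (b - a)))).
  set (dphi := fun t : R => Re (d * (df (a + t * (b - a)) * (b - a)))).
  assert (D : forall t, (0 <= t <= 1) -> is_derive phi t (dphi t)).
  { intros t Ht. split.
    { apply (is_linear_scal_l (K := R_AbsRing) (V := R_NormedModule)). }
    intros x Hx. apply (is_filter_lim_locally_unique (K := R_AbsRing) (V := R_NormedModule)) in Hx. subst x.
    intros eps. 
    set (K := (Cmod d * Cmod (b - a) + 1)%R).
    assert (HK : (0 < K)).
    { unfold K. assert (0 <= Cmod d * Cmod (b - a)) by (apply Rmult_le_pos; apply Cmod_ge_0). lra. }
    assert (P : (0 < eps / K)) by (apply Rdiv_lt_0_compat; [apply cond_pos|auto]).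
    destruct (Hd t Ht (eps / K)%R P) as [dl [Hdl H1]].
    set (L := (Cmod (b - a) + 1)%R).
    assert (HL : (0 < L)) by (unfold L; generalize (Cmod_ge_0 (b - a)); lra).
    assert (P2 : (0 < dl / L)) by (apply Rdiv_lt_0_compat; auto).
    exists (mkposreal _ P2). intros y Hy.
    change (Rabs (y - t) < dl / L) in Hy.
    change (Rabs (phi y - phi t - (y - t) * dphi t) <= eps * Rabs (y - t)).
    specialize (H1 (RtoC (y - t) * (b - a))).
    replace (a + t * (b - a) + RtoC (y - t) * (b - a)) with (a + y * (b - a)) in H1
      by (rewrite RtoC_minus; ring).
    assert (E : (phi y - phi t - (y - t) * dphi t)%R =
      Re (d * (f (a + y * (b - a)) - f (a + t * (b - a)) - df (a + t * (b - a)) * (RtoC (y - t) * (b - a))))).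
    { unfold phi, dphi. simpl. ring. }
    rewrite E.
    eapply Rle_trans; [apply re_le_Cmod|]. rewrite Cmod_mult.
    rewrite Cmod_mult, Cmod_R in H1.
    assert (Hlt : (Rabs (y - t) * Cmod (b - a) < dl)).
    { apply Rle_lt_trans with (Rabs (y - t) * L)%R.
      - apply Rmult_le_compat_l; [apply Rabs_pos | unfold L; lra].
      - apply Rmult_lt_reg_r with (/ L)%R; [apply Rinv_0_lt_compat; auto|].
        replace (Rabs (y - t) * L * / L)%R with (Rabs (y - t)) by (field; lra). exact Hy. }
    specialize (H1 Hlt).
    eapply Rle_trans; [apply Rmult_le_compat_l; [apply Cmod_ge_0 | exact H1]|].
    replace (Cmod d * (eps / K * (Rabs (y - t) * Cmod (b - a))))%R
      with (eps * Rabs (y - t) * (Cmod d * Cmod (b - a) / K))%R by (field; lra).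
    rewrite <- (Rmult_1_r (eps * Rabs (y - t))) at 2.
    apply Rmult_le_compat_l.
    - apply Rmult_le_pos; [left; apply cond_pos | apply Rabs_pos].
    - apply Rmult_le_reg_r with K; auto. replace (Cmod d * Cmod (b - a) / K * K)%R with (Cmod d * Cmod (b - a))%R by (field; lra). unfold K; lra. }
  destruct (MVT_gen phi 0 1 dphi) as [c [Hc Ec]].
  - intros x Hx. rewrite Rmin_left, Rmax_right in Hx by lra. apply D. lra.
  - intros x Hx. rewrite Rmin_left, Rmax_right in Hx by lra.
    apply continuity_pt_filterlim. apply (ex_derive_continuous (K := R_AbsRing) (V := R_NormedModule)). exists (dphi x). apply D. lra.
  - rewrite Rmin_left, Rmax_right in Hc by lra.
    replace (dphi c * (1 - 0))%R with (dphi c) in Ec by ring.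
    assert (E1 : (phi 1 - phi 0)%R = (Cmod (f b - f a) * Cmod (f b - f a))%R).
    { unfold phi. replace (a + 1%R * (b - a)) with b by ring. replace (a + 0%R * (b - a)) with a by ring.
      rewrite Cmod_sqr_re_im. unfold d. simpl. ring. }
    assert (E2 : (dphi c <= Cmod (f b - f a) * (M * Cmod (b - a)))).
    { unfold dphi. eapply Rle_trans; [apply re_bounds|]. rewrite !Cmod_mult. unfold d. rewrite Cmod_conj.
      apply Rmult_le_compat_l; [apply Cmod_ge_0|]. apply Rmult_le_compat_r; [apply Cmod_ge_0|]. auto. }
    rewrite E1 in Ec. rewrite <- Ec in E2.
    destruct (Cmod_ge_0 (f b - f a)) as [G|G].
    + apply Rmult_le_reg_l with (Cmod (f b - f a)); auto.
    + rewrite <- G. apply Rmult_le_pos; [|apply Cmod_ge_0].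
      eapply Rle_trans; [apply Cmod_ge_0|]. apply (HM 0%R). lra.
Qed.

Lemma Cmod_segment_dist (a b : C) (t : R) :
  (0 <= t <= 1) -> (Cmod (a + t * (b - a) - a) <= Cmod (b - a)).
Proof.
  intros Ht. replace (a + t * (b - a) - a) with (t * (b - a)) by ring.
  rewrite Cmod_mult, Cmod_R, Rabs_pos_eq by lra.
  generalize (Cmod_ge_0 (b - a)); nra.
Qed.

Lemma Cmod_segment_ball (c a b : C) (r t : R) :
  (0 <= t <= 1) -> (Cmod (a - c) <= r) -> (Cmod (b - c) <= r) ->
  (Cmod (a + t * (b - a) - c) <= r).
Proof.
  intros Ht Ha Hb.
  replace (a + t * (b - a) - c) with ((1 - t)%R * (a - c) + t * (b - c)) by (rewrite RtoC_minus; ring).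
  eapply Rle_trans; [apply Cmod_triangle|].
  rewrite !Cmod_mult, !Cmod_R, !Rabs_pos_eq by lra. nra.
Qed.

(** * The exponential *)

Lemma Cexp_0 : Cexp 0 = 1.
Proof.
  unfold Cexp; simpl. rewrite exp_0, cos_0, sin_0. unfold RtoC. f_equal; ring.
Qed.

Lemma Cexp_plus (z w : C) : Cexp (z + w) = Cexp z * Cexp w.
Proof.
  apply injective_projections; unfold Cexp, Re, Im; simpl; rewrite exp_plus, ?cos_plus, ?sin_plus; ring.
Qed.

Lemma Cexp_neq_0 (z : C) : Cexp z <> 0.
Proof.
  intros E. assert (H := Cexp_plus z (- z)). rewrite E in H.
  replace (z + - z) with (RtoC 0) in H by ring. rewrite Cexp_0 in H.
  apply C1_nz. rewrite H. ring.
Qed.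

Lemma Cmod_Cexp (z : C) : Cmod (Cexp z) = exp (Re z).
Proof.
  assert (P := exp_pos (Re z)).
  apply Rsqr_inj; [apply Cmod_ge_0 | lra |]. unfold Rsqr. rewrite Cmod_sqr_re_im.
  unfold Cexp, Re, Im; simpl.
  assert (Q := sin2_cos2 (snd z)). unfold Rsqr in Q. nra.
Qed.

Lemma has_cderiv_Cexp_0 : has_cderiv Cexp 0 1.
Proof.
  intros eps He.
  destruct (derivable_pt_lim_exp_0 (eps / 8)%R ltac:(lra)) as [[d1 P1] H1].
  destruct (derivable_pt_lim_sin_0 (eps / 8)%R ltac:(lra)) as [[d2 P2] H2].
  destruct (derivable_pt_lim_cos_0 (eps / 8)%R ltac:(lra)) as [[d3 P3] H3].
  simpl in *.
  assert (E1 : forall x, Rabs x < d1 -> Rabs (exp x - 1 - x) <= eps / 8 * Rabs x).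
  { intros x Hx. destruct (Req_dec x 0) as [->|N].
    { rewrite exp_0, Rabs_R0. replace (1 - 1 - 0)%R with 0%R by ring. rewrite Rabs_R0. lra. }
    specialize (H1 x N Hx). rewrite Rplus_0_l, exp_0 in H1.
    replace (exp x - 1 - x)%R with (((exp x - 1) / x - 1) * x)%R by (field; auto).
    rewrite Rabs_mult. apply Rmult_le_compat_r; [apply Rabs_pos|lra]. }
  assert (E2 : forall x, Rabs x < d2 -> Rabs (sin x - x) <= eps / 8 * Rabs x).
  { intros x Hx. destruct (Req_dec x 0) as [->|N].
    { rewrite sin_0, Rabs_R0. replace (0 - 0)%R with 0%R by ring. rewrite Rabs_R0. lra. }
    specialize (H2 x N Hx). rewrite Rplus_0_l, sin_0 in H2.
    replace (sin x - x)%R with (((sin x - 0) / x - 1) * x)%R by (field; auto).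
    rewrite Rabs_mult. apply Rmult_le_compat_r; [apply Rabs_pos|lra]. }
  assert (E3 : forall x, Rabs x < d3 -> Rabs (cos x - 1) <= eps / 8 * Rabs x).
  { intros x Hx. destruct (Req_dec x 0) as [->|N].
    { rewrite cos_0, Rabs_R0. replace (1 - 1)%R with 0%R by ring. rewrite Rabs_R0. lra. }
    specialize (H3 x N Hx). rewrite Rplus_0_l, cos_0 in H3.
    replace (cos x - 1)%R with (((cos x - 1) / x - 0) * x)%R by (field; auto).
    rewrite Rabs_mult. apply Rmult_le_compat_r; [apply Rabs_pos|lra]. }
  (* The bound 1/2 keeps [exp x] below 3 and serves the estimate of [exp x - 1]; the bound eps/16
     makes the quadratic term 2m^2 at most (eps/8) m. *)
  set (d4 := Rmin (/ 2) (eps / 16)).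
  assert (P4 : 0 < d4) by (unfold d4; apply Rmin_pos; lra).
  assert (P5 : d4 <= / 2) by apply Rmin_l.
  assert (P6 : d4 <= eps / 16) by apply Rmin_r.
  clearbody d4.
  exists (Rmin (Rmin d1 d2) (Rmin d3 d4)). split; [repeat apply Rmin_pos; auto|].
  intros h Hh. destruct h as [x y].
  assert (X := re_le_Cmod (x, y)). assert (Y := im_le_Cmod (x, y)).
  unfold Re, Im in X, Y; simpl in X, Y.
  set (m := Cmod (x, y)) in *.
  assert (h1 : m < d1) by (eapply Rlt_le_trans; [exact Hh|]; eapply Rle_trans; [apply Rmin_l|apply Rmin_l]).
  assert (h2 : m < d2) by (eapply Rlt_le_trans; [exact Hh|]; eapply Rle_trans; [apply Rmin_l|apply Rmin_r]).
  assert (h3 : m < d3) by (eapply Rlt_le_trans; [exact Hh|]; eapply Rle_trans; [apply Rmin_r|apply Rmin_l]).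
  assert (h4 : m < d4) by (eapply Rlt_le_trans; [exact Hh|]; eapply Rle_trans; [apply Rmin_r|apply Rmin_r]).
  assert (h5 : m < / 2) by lra.
  assert (h6 : m < eps / 16) by lra.
  specialize (E1 x ltac:(lra)). specialize (E2 y ltac:(lra)). specialize (E3 y ltac:(lra)).
  assert (M0 : 0 <= m) by apply Cmod_ge_0.
  rewrite Cplus_0_l, Cexp_0.
  assert (B : Rabs (exp x) <= 3).
  { rewrite Rabs_pos_eq by (left; apply exp_pos).
    eapply Rle_trans; [|apply exp_le_3]. destruct (Rle_lt_or_eq_dec x 1) as [L|L].
    - apply Rabs_le_between in X. lra.
    - left; apply exp_increasing; auto.
    - rewrite L; lra. }
  (* For large [eps] the derivative estimate [E1] says too little; then 1 + t <= e^t, applied to x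
     and to -x, gives the bound. *)
  assert (S : Rabs (exp x - 1) <= 2 * m).
  { destruct (Rle_dec eps 8) as [G|G].
    - replace (exp x - 1)%R with ((exp x - 1 - x) + x)%R by ring.
      eapply Rle_trans; [apply Rabs_triang|]. assert (eps / 8 * Rabs x <= 1 * Rabs x).
      { apply Rmult_le_compat_r; [apply Rabs_pos|lra]. } lra.
    - assert (0 <= exp x) by (left; apply exp_pos).
      apply Rabs_le. split.
      + assert (T := exp_ineq1_le x). apply Rabs_le_between in X. lra.
      + assert (T := exp_ineq1_le (- x)). rewrite exp_Ropp in T.
        assert (G1 : exp x * (1 - x) <= 1).
        { replace 1%R with (exp x * / exp x)%R at 2 by (field; apply Rgt_not_eq, exp_pos).
          apply Rmult_le_compat_l; lra. }
        apply Rabs_le_between in X. nra. }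
  eapply Rle_trans; [apply Cmod_le_re_im|].
  unfold Cexp, Re, Im; simpl.
  replace (exp x * cos y + - (1) + - (1 * x - 0 * y))%R with (exp x * (cos y - 1) + (exp x - 1 - x))%R by ring.
  replace (exp x * sin y + - 0 + - (1 * y + 0 * x))%R with (exp x * (sin y - y) + (exp x - 1) * y)%R by ring.
  assert (A1 := Rabs_triang (exp x * (cos y - 1)) (exp x - 1 - x)).
  assert (A2 := Rabs_triang (exp x * (sin y - y)) ((exp x - 1) * y)).
  rewrite !Rabs_mult in A1. rewrite !Rabs_mult in A2.
  assert (C1 : Rabs (exp x) * Rabs (cos y - 1) <= 3 * (eps / 8 * m)).
  { apply Rmult_le_compat; try apply Rabs_pos; auto. eapply Rle_trans; [exact E3|]. apply Rmult_le_compat_l; lra. }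
  assert (C2 : Rabs (exp x) * Rabs (sin y - y) <= 3 * (eps / 8 * m)).
  { apply Rmult_le_compat; try apply Rabs_pos; auto. eapply Rle_trans; [exact E2|]. apply Rmult_le_compat_l; lra. }
  assert (C3 : Rabs (exp x - 1) * Rabs y <= 2 * m * m).
  { apply Rmult_le_compat; try apply Rabs_pos; auto. }
  assert (C4 : eps / 8 * Rabs x <= eps / 8 * m) by (apply Rmult_le_compat_l; lra).
  assert (C5 : 2 * m * m <= eps / 8 * m) by nra.
  lra.
Qed.

Lemma has_cderiv_Cexp (z : C) : has_cderiv Cexp z (Cexp z).
Proof.
  apply has_cderiv_ext with (fun w => Cexp z * Cexp (w - z)).
  { intros w. rewrite <- Cexp_plus. f_equal. ring. }
  assert (H : has_cderiv (fun w => Cexp z * Cexp (w - z)) z (Cexp z * (1 * (1 - 0)))).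
  { apply has_cderiv_scal, (has_cderiv_comp Cexp (fun w => w - z)).
    - replace (z - z) with (RtoC 0) by ring. apply has_cderiv_Cexp_0.
    - apply has_cderiv_minus; [apply has_cderiv_id | apply has_cderiv_const]. }
  replace (Cexp z * (1 * (1 - 0))) with (Cexp z) in H by ring. exact H.
Qed.

Lemma Cmod_Cexp_le (w : C) : Cmod w <= 1 -> Cmod (Cexp w) <= 3.
Proof.
  intros H. rewrite Cmod_Cexp. assert (B := re_bounds w).
  eapply Rle_trans; [|apply exp_le_3].
  destruct (Rle_lt_or_eq_dec (Re w) 1) as [L|L]; [lra| |rewrite L; lra].
  left; apply exp_increasing; auto.
Qed.

Lemma Cexp_sub_1_bound (w : C) : Cmod w <= 1 -> Cmod (Cexp w - 1) <= 3 * Cmod w.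
Proof.
  intros H. rewrite <- Cexp_0. replace (Cmod w) with (Cmod (w - 0)) by (f_equal; ring).
  apply mean_value_bound with (df := Cexp); intros t Ht; [apply has_cderiv_Cexp|].
  apply Cmod_Cexp_le. replace (0 + t * (w - 0)) with (t * w) by ring.
  rewrite Cmod_mult, Cmod_R, Rabs_pos_eq by lra. generalize (Cmod_ge_0 w); nra.
Qed.

Lemma Cexp_sub_1_sub_bound (w : C) : Cmod w <= 1 -> Cmod (Cexp w - 1 - w) <= 3 * Cmod w * Cmod w.
Proof.
  intros H.
  replace (Cexp w - 1 - w) with ((Cexp w - w) - (Cexp 0 - 0)) by (rewrite Cexp_0; ring).
  replace (3 * Cmod w * Cmod w)%R with (3 * Cmod w * Cmod (w - 0))%R
    by (f_equal; f_equal; ring).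
  apply (mean_value_bound (fun z => Cexp z - z) (fun z => Cexp z - 1)); intros t Ht.
  - apply has_cderiv_minus; [apply has_cderiv_Cexp | apply has_cderiv_id].
  - replace (0 + t * (w - 0)) with (t * w) by ring.
    assert (B : Cmod (t * w) <= Cmod w).
    { rewrite Cmod_mult, Cmod_R, Rabs_pos_eq by lra. generalize (Cmod_ge_0 w); nra. }
    eapply Rle_trans; [apply Cexp_sub_1_bound; lra|]. lra.
Qed.

(** The bound on the logarithm decides how large the disc in [local_solution] has to be. The
    argument is taken in [-pi, pi], and pi is at most 4. *)
Lemma Cexp_log (v : C) : v <> 0 -> exists w, Cexp w = v /\ Cmod w <= Rabs (ln (Cmod v)) + 4.
Proof.
  intros Hv. assert (P : 0 < Cmod v) by (apply Cmod_gt_0; auto).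
  set (m := Cmod v) in *.
  assert (S := Cmod_sqr_re_im v). fold m in S.
  set (x := (Re v / m)%R). set (y := (Im v / m)%R).
  assert (U : (x * x + y * y = 1)%R).
  { unfold x, y. apply Rmult_eq_reg_r with (m * m)%R; [|nra]. field_simplify; lra. }
  assert (X : -1 <= x <= 1) by (split; nra).
  assert (K : exists t, cos t = x /\ sin t = y /\ Rabs t <= 4).
  { assert (B := acos_bound x). assert (Pi := PI_4).
    assert (Q : sqrt (1 - x * x) = Rabs y).
    { replace (1 - x * x)%R with (Rsqr y) by (unfold Rsqr; lra). apply sqrt_Rsqr_abs. }
    assert (Sn := sin_acos x X). unfold Rsqr in Sn. rewrite Q in Sn.
    destruct (Rle_dec 0 y) as [Y|Y].
    - exists (acos x). rewrite cos_acos by auto. rewrite Sn, !Rabs_pos_eq by lra.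
      repeat split; lra.
    - exists (- acos x)%R. rewrite cos_neg, sin_neg, cos_acos by auto.
      rewrite Sn, Rabs_Ropp, Rabs_left, Rabs_pos_eq by lra. repeat split; lra. }
  destruct K as [t [K1 [K2 K3]]].
  exists (ln m, t). split.
  - apply injective_projections; unfold Cexp, Re, Im; simpl;
      rewrite exp_ln, ?K1, ?K2 by auto; unfold x, y, Re, Im; field; lra.
  - eapply Rle_trans; [apply Cmod_le_re_im|]. simpl. lra.
Qed.

(** * Integrals along segments *)

Definition entire_with (f df : C -> C) : Prop := forall z, has_cderiv f z (df z).
(** Holomorphic on the whole plane: segments, triangles and discs then never have to be checked
    against a domain. *)
Definition holo (f : C -> C) : Prop := exists df, entire_with f df.

Lemma C_complete (u : nat -> C) :
  (forall eps, 0 < eps -> exists N, forall m n, (N <= m)%nat -> (N <= n)%nat ->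
     Cmod (u m - u n) < eps) ->
  exists l, forall eps, 0 < eps -> exists N, forall n, (N <= n)%nat -> Cmod (u n - l) < eps.
Proof.
  intros H.
  destruct (Rcomplete.R_complete (fun n => Re (u n))) as [x Hx].
  { intros eps He. destruct (H eps He) as [N HN]. exists N. intros n m Hn Hm.
    eapply Rle_lt_trans; [|apply (HN n m Hn Hm)]. unfold Rdist.
    apply (re_le_Cmod (u n - u m)). }
  destruct (Rcomplete.R_complete (fun n => Im (u n))) as [y Hy].
  { intros eps He. destruct (H eps He) as [N HN]. exists N. intros n m Hn Hm.
    eapply Rle_lt_trans; [|apply (HN n m Hn Hm)]. unfold Rdist.
    apply (im_le_Cmod (u n - u m)). }
  exists (x, y). intros eps He.
  destruct (Hx (eps / 2)%R ltac:(lra)) as [N1 H1].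
  destruct (Hy (eps / 2)%R ltac:(lra)) as [N2 H2].
  exists (Nat.max N1 N2). intros n Hn.
  specialize (H1 n ltac:(lia)). specialize (H2 n ltac:(lia)). unfold Rdist in *.
  eapply Rle_lt_trans; [apply Cmod_le_re_im|]. 
  change (Re (u n - (x, y))) with (Re (u n) - x)%R.
  change (Im (u n - (x, y))) with (Im (u n) - y)%R. lra.
Qed.

Lemma C_complete_geometric (u : nat -> C) (K : R) :
  0 <= K ->
  (forall n, Cmod (u (S n) - u n) <= K * (/ 2) ^ n) ->
  exists l, forall n, Cmod (u n - l) <= 2 * K * (/ 2) ^ n.
Proof.
  intros HK H.
  assert (P : forall n, 0 < (/ 2) ^ n) by (intros; apply pow_lt; lra).
  (* The subtracted term makes the bound on the telescoping sum inductive. *)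
  assert (D : forall n k, Cmod (u (n + k)%nat - u n) <= 2 * K * (/ 2) ^ n - 2 * K * (/ 2) ^ (n + k)).
  { intros n k. induction k.
    - rewrite Nat.add_0_r, Cmod_self_sub. lra.
    - rewrite Nat.add_succ_r. eapply Rle_trans; [apply (Cmod_sub_triangle _ (u (n + k)%nat))|].
      specialize (H (n + k)%nat). simpl. lra. }
  assert (B : forall n m, (n <= m)%nat -> Cmod (u m - u n) <= 2 * K * (/ 2) ^ n).
  { intros n m Hm. replace m with (n + (m - n))%nat by lia.
    specialize (D n (m - n)%nat). specialize (P (n + (m - n))%nat). nra. }
  assert (Z : forall eps, 0 < eps -> exists N, 2 * K * (/ 2) ^ N < eps).
  { intros eps He. assert (Pe : 0 < eps / (2 * K + 1)) by (apply Rdiv_lt_0_compat; lra).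
    destruct (pow_lt_1_zero (/ 2) ltac:(rewrite Rabs_pos_eq; lra) _ Pe) as [N HN].
    exists N. specialize (HN N (le_n N)). rewrite Rabs_pos_eq in HN by (left; auto).
    apply Rmult_lt_compat_l with (r := (2 * K + 1)%R) in HN; [|lra].
    replace ((2 * K + 1) * (eps / (2 * K + 1)))%R with eps in HN by (field; lra).
    specialize (P N). lra. }
  destruct (C_complete u) as [l Hl].
  { intros eps He. destruct (Z (eps / 2)%R ltac:(lra)) as [N HN]. exists N. intros m n Hm Hn.
    eapply Rle_lt_trans; [apply (Cmod_sub_triangle _ (u N))|]. rewrite (Cmod_sub_sym (u N)).
    generalize (B N m Hm) (B N n Hn). lra. }
  exists l. intros n. apply le_epsilon. intros eps He.
  destruct (Hl eps He) as [N HN]. specialize (HN (Nat.max N n) ltac:(lia)).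
  eapply Rle_trans; [apply (Cmod_sub_triangle _ (u (Nat.max N n)))|].
  rewrite (Cmod_sub_sym (u n)). specialize (B n (Nat.max N n) ltac:(lia)). lra.
Qed.

Local Notation CV := C_R_CompleteNormedModule.

(** Without the factor b - a the integral is symmetric in the end points. This yields both the sign
    change of [seg_int] under reversal and the integral of an affine function. *)
Definition seg_mean (f : C -> C) (a b : C) : C :=
  RInt (V := CV) (fun t : R => f (a + t * (b - a))) 0 1.

Definition seg_int (f : C -> C) (a b : C) : C := (b - a) * seg_mean f a b.

Lemma RtoC_half : RtoC (/ 2) = / 2.
Proof. apply RtoC_inv. lra. Qed.

Lemma scal_RtoC (t : R) (z : C) : scal (V := CV) t z = RtoC t * z.
Proof. apply injective_projections; simpl; unfold scal; simpl; unfold mult; simpl; ring. Qed.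

Lemma norm_Cmod (z : C) : norm (V := CV) z = Cmod z.
Proof.
  unfold norm; simpl. unfold prod_norm, Cmod, norm; simpl. unfold abs; simpl.
  assert (A := pow2_abs (fst z)). assert (B := pow2_abs (snd z)). simpl in A, B.
  f_equal. lra.
Qed.

Lemma seg_continuous (f : C -> C) (a b : C) (t : R) :
  (forall z, ccont f z) -> continuous (U := CV) (fun t : R => f (a + t * (b - a))) t.
Proof.
  intros H. apply filterlim_locally. intros eps.
  destruct (H (a + t * (b - a)) eps (cond_pos eps)) as [d [Hd H1]].
  set (L := (Cmod (b - a) + 1)%R).
  assert (HL : 0 < L) by (unfold L; generalize (Cmod_ge_0 (b - a)); lra).
  assert (P2 : 0 < d / L) by (apply Rdiv_lt_0_compat; auto).
  exists (mkposreal _ P2). intros y Hy. change (Rabs (y - t) < d / L) in Hy.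
  apply C_NormedModule_mixin_compat1.
  apply (H1 (a + y * (b - a))).
  replace (a + y * (b - a) - (a + t * (b - a))) with (RtoC (y - t) * (b - a)) by (rewrite RtoC_minus; ring).
  rewrite Cmod_mult, Cmod_R.
  apply Rle_lt_trans with (Rabs (y - t) * L)%R.
  - apply Rmult_le_compat_l; [apply Rabs_pos | unfold L; lra].
  - apply Rmult_lt_reg_r with (/ L)%R; [apply Rinv_0_lt_compat; auto|].
    replace (Rabs (y - t) * L * / L)%R with (Rabs (y - t)) by (field; lra). exact Hy.
Qed.

Lemma seg_ex (f : C -> C) (a b : C) (s t : R) :
  (forall z, ccont f z) -> ex_RInt (V := CV) (fun t : R => f (a + t * (b - a))) s t.
Proof. intros H. apply ex_RInt_continuous. intros. apply seg_continuous; auto. Qed.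

Lemma seg_mean_rev (f : C -> C) (a b : C) :
  (forall z, ccont f z) -> seg_mean f b a = seg_mean f a b.
Proof.
  intros H. unfold seg_mean.
  assert (E := RInt_comp_lin (V := CV) (fun t : R => f (a + t * (b - a))) (-1) 1 0 1).
  replace (-1 * 0 + 1)%R with 1%R in E by ring. replace (-1 * 1 + 1)%R with 0%R in E by ring.
  specialize (E (seg_ex f a b 1 0 H)).
  rewrite <- (opp_RInt_swap (V := CV) (fun t : R => f (a + t * (b - a))) 0 1 (seg_ex f a b 0 1 H)) in E.
  rewrite RInt_scal in E.
  2:{ apply ex_RInt_ext with (fun t : R => f (b + t * (a - b))); [|apply seg_ex; auto].
      intros t _. f_equal. rewrite RtoC_plus, RtoC_mult. ring. }
  rewrite scal_RtoC in E.
  rewrite <- (RInt_ext (V := CV) (fun t : R => f (b + t * (a - b)))) in E.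
  2:{ intros t _. f_equal. rewrite RtoC_plus, RtoC_mult. ring. }
  change (RtoC (-1) * RInt (V := CV) (fun t : R => f (b + t * (a - b))) 0 1
          = - RInt (V := CV) (fun t : R => f (a + t * (b - a))) 0 1) in E.
  match goal with |- ?x = ?y => replace x with (- (RtoC (-1) * x)) by ring; rewrite E; ring end.
Qed.

Lemma seg_int_rev (f : C -> C) (a b : C) :
  (forall z, ccont f z) -> seg_int f b a = - seg_int f a b.
Proof. intros H. unfold seg_int. rewrite seg_mean_rev by auto. ring. Qed.

Definition mid (a b : C) : C := (a + b) / 2.

Lemma seg_int_mid (f : C -> C) (a b : C) :
  (forall z, ccont f z) -> seg_int f a b = seg_int f a (mid a b) + seg_int f (mid a b) b.
Proof.
  intros H. unfold seg_int, seg_mean.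
  rewrite <- (RInt_Chasles (V := CV) _ 0 (/ 2) 1) by (apply seg_ex; auto).
  assert (E1 := RInt_comp_lin (V := CV) (fun t : R => f (a + t * (b - a))) (/ 2) 0 0 1).
  replace (/ 2 * 0 + 0)%R with 0%R in E1 by ring. replace (/ 2 * 1 + 0)%R with (/ 2)%R in E1 by ring.
  specialize (E1 (seg_ex f a b _ _ H)).
  assert (E2 := RInt_comp_lin (V := CV) (fun t : R => f (a + t * (b - a))) (/ 2) (/ 2) 0 1).
  replace (/ 2 * 0 + / 2)%R with (/ 2)%R in E2 by ring. replace (/ 2 * 1 + / 2)%R with 1%R in E2 by field.
  specialize (E2 (seg_ex f a b _ _ H)).
  assert (A1 : forall t : R, f (a + RtoC (/ 2 * t + 0) * (b - a)) = f (a + t * (mid a b - a))).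
  { intros t. f_equal. unfold mid. rewrite RtoC_plus, RtoC_mult, RtoC_half. field. }
  assert (A2 : forall t : R, f (a + RtoC (/ 2 * t + / 2) * (b - a)) = f (mid a b + t * (b - mid a b))).
  { intros t. f_equal. unfold mid. rewrite RtoC_plus, RtoC_mult, RtoC_half. field. }
  rewrite RInt_scal in E1.
  2:{ apply ex_RInt_ext with (fun t : R => f (a + t * (mid a b - a))); [|apply seg_ex; auto].
      intros t _. rewrite A1. reflexivity. }
  rewrite RInt_scal in E2.
  2:{ apply ex_RInt_ext with (fun t : R => f (mid a b + t * (b - mid a b))); [|apply seg_ex; auto].
      intros t _. rewrite A2. reflexivity. }
  rewrite scal_RtoC in E1, E2.
  rewrite (RInt_ext (V := CV) _ (fun t : R => f (a + t * (mid a b - a)))) in E1 by (intros; apply A1).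
  rewrite (RInt_ext (V := CV) _ (fun t : R => f (mid a b + t * (b - mid a b)))) in E2 by (intros; apply A2).
  rewrite <- E1, <- E2.
  match goal with |- _ * plus (_ * ?x) (_ * ?y) = _ => generalize x y end.
  intros x y. change ((b - a) * (RtoC (/ 2) * x + RtoC (/ 2) * y) = (mid a b - a) * x + (b - mid a b) * y).
  unfold mid. rewrite RtoC_half. field.
Qed.

Lemma seg_int_minus (f g : C -> C) (a b : C) :
  (forall z, ccont f z) -> (forall z, ccont g z) ->
  seg_int (fun z => f z - g z) a b = seg_int f a b - seg_int g a b.
Proof.
  intros Hf Hg. unfold seg_int, seg_mean.
  rewrite (RInt_minus (V := CV) (fun t : R => f (a + t * (b - a))) (fun t : R => g (a + t * (b - a))))
    by (apply seg_ex; auto).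
  match goal with |- _ * minus ?x ?y = _ => generalize x y end.
  intros x y. change ((b - a) * (x - y) = (b - a) * x - (b - a) * y). ring.
Qed.

(* The mean of an affine function is its value at the midpoint, by symmetry. *)
Lemma seg_int_affine (p q a b : C) :
  seg_int (fun z => p + q * z) a b = (b - a) * (p + q * (a + b) / 2).
Proof.
  set (f := fun z => p + q * z).
  assert (H : forall z, ccont f z).
  { intros z. apply has_cderiv_ccont with (l := 0 + q * 1).
    apply has_cderiv_plus; [apply has_cderiv_const | apply has_cderiv_scal, has_cderiv_id]. }
  unfold seg_int. f_equal.
  assert (E : seg_mean f a b + seg_mean f b a = 2 * (p + q * (a + b) / 2)).
  { unfold seg_mean.
    assert (E := RInt_plus (V := CV) (fun t : R => f (a + t * (b - a))) (fun t : R => f (b + t * (a - b))) 0 1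
      (seg_ex f a b 0 1 H) (seg_ex f b a 0 1 H)).
    rewrite (RInt_ext (V := CV) _ (fun _ => 2 * (p + q * (a + b) / 2))) in E.
    2:{ intros t _. unfold f.
        change ((p + q * (a + t * (b - a))) + (p + q * (b + t * (a - b))) = 2 * (p + q * (a + b) / 2)). field. }
    rewrite RInt_const, scal_RtoC in E. replace (RtoC (1 - 0)) with (RtoC 1) in E by (f_equal; ring).
    rewrite Cmult_1_l in E. symmetry. exact E. }
  rewrite (seg_mean_rev f a b H) in E.
  replace (seg_mean f a b) with ((seg_mean f a b + seg_mean f a b) / 2) by field.
  rewrite E. field.
Qed.

Lemma seg_int_bound (f : C -> C) (a b : C) (M : R) :
  (forall z, ccont f z) ->
  (forall t : R, 0 <= t <= 1 -> Cmod (f (a + t * (b - a))) <= M) ->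
  Cmod (seg_int f a b) <= Cmod (b - a) * M.
Proof.
  intros H HM. unfold seg_int. rewrite Cmod_mult. apply Rmult_le_compat_l; [apply Cmod_ge_0|].
  assert (N := norm_RInt_le_const (V := CV) (fun t : R => f (a + t * (b - a))) 0 1 (seg_mean f a b) M Rle_0_1).
  rewrite norm_Cmod in N. replace M with ((1 - 0) * M)%R by ring.
  apply N.
  - intros t Ht. rewrite norm_Cmod. apply HM; auto.
  - apply (RInt_correct (V := CV)), seg_ex; auto.
Qed.

(** * Goursat's theorem and primitives *)

Definition triangle : Type := (C * C * C)%type.

Definition tri_int (f : C -> C) (T : triangle) : C :=
  let '(a, b, c) := T in seg_int f a b + seg_int f b c + seg_int f c a.

Definition perim (T : triangle) : R :=
  let '(a, b, c) := T in (Cmod (b - a) + Cmod (c - b) + Cmod (a - c))%R.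

(** The point followed through the subdivision: each step moves it by at most the perimeter, so the
    apices converge by completeness, without filled triangles or their intersection. *)
Definition apex (T : triangle) : C := fst (fst T).

Definition sub1 (T : triangle) : triangle := let '(a, b, c) := T in (a, mid a b, mid c a).
Definition sub2 (T : triangle) : triangle := let '(a, b, c) := T in (mid a b, b, mid b c).
Definition sub3 (T : triangle) : triangle := let '(a, b, c) := T in (mid c a, mid b c, c).
Definition sub4 (T : triangle) : triangle := let '(a, b, c) := T in (mid a b, mid b c, mid c a).

Lemma tri_int_split (f : C -> C) (T : triangle) :
  (forall z, ccont f z) ->
  tri_int f T = tri_int f (sub1 T) + tri_int f (sub2 T) + tri_int f (sub3 T) + tri_int f (sub4 T).
Proof.
  intros H. destruct T as [[a b] c]. simpl.
  rewrite (seg_int_mid f a b), (seg_int_mid f b c), (seg_int_mid f c a) by auto.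
  rewrite (seg_int_rev f (mid a b) (mid b c)), (seg_int_rev f (mid b c) (mid c a)),
    (seg_int_rev f (mid c a) (mid a b)) by auto. ring.
Qed.

Lemma Cmod_half (z w : C) : z = w / 2 -> Cmod z = (Cmod w / 2)%R.
Proof.
  intros ->. rewrite Cmod_div by (intros E; apply RtoC_inj in E; lra).
  rewrite Cmod_R, Rabs_pos_eq by lra. reflexivity.
Qed.

Lemma perim_sub (T : triangle) :
  perim (sub1 T) = (perim T / 2)%R /\ perim (sub2 T) = (perim T / 2)%R /\
  perim (sub3 T) = (perim T / 2)%R /\ perim (sub4 T) = (perim T / 2)%R.
Proof.
  destruct T as [[a b] c]. unfold perim, sub1, sub2, sub3, sub4, mid.
  repeat split.
  - rewrite (Cmod_half ((a + b) / 2 - a) (b - a)), (Cmod_half ((c + a) / 2 - (a + b) / 2) (c - b)),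
      (Cmod_half (a - (c + a) / 2) (a - c)) by field. field.
  - rewrite (Cmod_half (b - (a + b) / 2) (b - a)), (Cmod_half ((b + c) / 2 - b) (c - b)),
      (Cmod_half ((a + b) / 2 - (b + c) / 2) (a - c)) by field. field.
  - rewrite (Cmod_half ((b + c) / 2 - (c + a) / 2) (b - a)), (Cmod_half (c - (b + c) / 2) (c - b)),
      (Cmod_half ((c + a) / 2 - c) (a - c)) by field. field.
  - rewrite (Cmod_half ((b + c) / 2 - (a + b) / 2) (c - a)), (Cmod_half ((c + a) / 2 - (b + c) / 2) (a - b)),
      (Cmod_half ((a + b) / 2 - (c + a) / 2) (b - c)) by field.
    rewrite (Cmod_sub_sym c a), (Cmod_sub_sym a b), (Cmod_sub_sym b c). field.
Qed.

Lemma perim_ge_0 (T : triangle) : 0 <= perim T.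
Proof.
  destruct T as [[a b] c]. simpl.
  generalize (Cmod_ge_0 (b - a)) (Cmod_ge_0 (c - b)) (Cmod_ge_0 (a - c)). lra.
Qed.

Lemma apex_sub (T : triangle) :
  Cmod (apex (sub1 T) - apex T) <= perim T /\ Cmod (apex (sub2 T) - apex T) <= perim T /\
  Cmod (apex (sub3 T) - apex T) <= perim T /\ Cmod (apex (sub4 T) - apex T) <= perim T.
Proof.
  destruct T as [[a b] c]. unfold perim, sub1, sub2, sub3, sub4, mid, apex, fst.
  assert (A := Cmod_ge_0 (b - a)). assert (B := Cmod_ge_0 (c - b)). assert (D := Cmod_ge_0 (a - c)).
  rewrite Cmod_self_sub, (Cmod_half ((a + b) / 2 - a) (b - a)), (Cmod_half ((c + a) / 2 - a) (c - a)) by field.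
  rewrite (Cmod_sub_sym c a). lra.
Qed.

Definition goursat_step (f : C -> C) (eps : R) (T : triangle) : triangle :=
  let big S := Rlt_dec (eps * perim S * perim S) (Cmod (tri_int f S)) in
  if big (sub1 T) then sub1 T else if big (sub2 T) then sub2 T
  else if big (sub3 T) then sub3 T else sub4 T.

(** The threshold [eps * perim^2] falls to a quarter when the perimeter is halved. If three of the
    four parts stay below it, the triangle inequality forces the fourth above. *)
Lemma goursat_step_spec (f : C -> C) (eps : R) (T : triangle) :
  (forall z, ccont f z) ->
  eps * perim T * perim T < Cmod (tri_int f T) ->
  let S := goursat_step f eps T in
  eps * perim S * perim S < Cmod (tri_int f S) /\
  perim S = (perim T / 2)%R /\ Cmod (apex S - apex T) <= perim T.
Proof.
  intros Hc H. destruct (perim_sub T) as [P1 [P2 [P3 P4]]].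
  destruct (apex_sub T) as [A1 [A2 [A3 A4]]].
  unfold goursat_step.
  destruct (Rlt_dec (eps * perim (sub1 T) * perim (sub1 T)) (Cmod (tri_int f (sub1 T)))) as [L1|L1]; [auto|].
  destruct (Rlt_dec (eps * perim (sub2 T) * perim (sub2 T)) (Cmod (tri_int f (sub2 T)))) as [L2|L2]; [auto|].
  destruct (Rlt_dec (eps * perim (sub3 T) * perim (sub3 T)) (Cmod (tri_int f (sub3 T)))) as [L3|L3]; [auto|].
  simpl. split; [|auto].
  rewrite (tri_int_split f T Hc) in H.
  rewrite P1 in L1. rewrite P2 in L2. rewrite P3 in L3. rewrite P4.
  assert (U1 := Cmod_triangle (tri_int f (sub1 T) + tri_int f (sub2 T) + tri_int f (sub3 T)) (tri_int f (sub4 T))).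
  assert (U2 := Cmod_triangle (tri_int f (sub1 T) + tri_int f (sub2 T)) (tri_int f (sub3 T))).
  assert (U3 := Cmod_triangle (tri_int f (sub1 T)) (tri_int f (sub2 T))).
  lra.
Qed.

Lemma tri_int_affine (p q : C) (T : triangle) : tri_int (fun z => p + q * z) T = 0.
Proof. destruct T as [[a b] c]. simpl. rewrite !seg_int_affine. field. Qed.

Lemma tri_int_minus (f g : C -> C) (T : triangle) :
  (forall z, ccont f z) -> (forall z, ccont g z) ->
  tri_int (fun z => f z - g z) T = tri_int f T - tri_int g T.
Proof. intros. destruct T as [[a b] c]. simpl. rewrite !seg_int_minus by auto. ring. Qed.

Lemma tri_int_bound (f : C -> C) (T : triangle) (w : C) (r M : R) :
  (forall z, ccont f z) -> Cmod (apex T - w) + perim T <= r ->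
  (forall z, Cmod (z - w) <= r -> Cmod (f z) <= M) ->
  Cmod (tri_int f T) <= perim T * M.
Proof.
  destruct T as [[a b] c]. unfold perim, apex, tri_int, fst. intros H Hr HM.
  assert (A := Cmod_ge_0 (b - a)). assert (B := Cmod_ge_0 (c - b)). assert (D := Cmod_ge_0 (a - c)).
  assert (Wb := Cmod_sub_triangle b a w). assert (Wc := Cmod_sub_triangle c a w).
  rewrite (Cmod_sub_sym c a) in Wc.
  assert (S : forall x y, Cmod (x - w) <= r -> Cmod (y - w) <= r -> Cmod (seg_int f x y) <= Cmod (y - x) * M).
  { intros x y Hx Hy. apply seg_int_bound; auto. intros t Ht. apply HM.
    apply Cmod_segment_ball; auto. }
  assert (S1 := S a b ltac:(lra) ltac:(lra)). assert (S2 := S b c ltac:(lra) ltac:(lra)).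
  assert (S3 := S c a ltac:(lra) ltac:(lra)).
  eapply Rle_trans; [apply Cmod_triangle|].
  assert (U := Cmod_triangle (seg_int f a b) (seg_int f b c)). lra.
Qed.

Lemma holo_ccont (f : C -> C) : holo f -> forall z, ccont f z.
Proof. intros [df H] z. eapply has_cderiv_ccont. apply H. Qed.

Lemma goursat (f : C -> C) (T : triangle) : holo f -> tri_int f T = 0.
Proof.
  intros Hf. assert (Hc := holo_ccont f Hf). destruct Hf as [df Hd].
  apply Cmod_eq_0, Rle_antisym; [|apply Cmod_ge_0].
  apply le_epsilon. intros e0 He0. rewrite Rplus_0_l.
  assert (PT := perim_ge_0 T).
  set (L := perim T) in *.
  assert (G : forall eps, 0 < eps -> Cmod (tri_int f T) <= eps * L * L).
  { intros eps He. apply Rnot_lt_le. intros Hbig.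
    set (u := fun n => Nat.iter n (goursat_step f eps) T).
    assert (I : forall n, eps * perim (u n) * perim (u n) < Cmod (tri_int f (u n)) /\
                          perim (u n) = (L * (/ 2) ^ n)%R).
    { induction n as [|n [I1 I2]].
      - simpl. split; auto. unfold L. ring.
      - destruct (goursat_step_spec f eps (u n) Hc I1) as [J1 [J2 _]].
        change (u (S n)) with (goursat_step f eps (u n)). split; auto.
        rewrite J2, I2. simpl. field. }
    destruct (C_complete_geometric (fun n => apex (u n)) L PT) as [w Hw].
    { intros n. destruct (I n) as [I1 I2].
      destruct (goursat_step_spec f eps (u n) Hc I1) as [_ [_ J3]].
      rewrite I2 in J3. exact J3. }
    (* The n-th triangle, of perimeter p, lies in the disc of radius 3p around the limit [w]: its
       apex is within 2p of [w]. Replacing f by its error against the tangent at [w] bounds the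
       integral by p * (eps/4) * 3p, less than the eps p^2 it must exceed. *)
    destruct (Hd w (eps / 4)%R ltac:(lra)) as [d [Hdp H1]].
    assert (Z : exists n, 3 * L * (/ 2) ^ n < d).
    { assert (Pe : 0 < d / (3 * L + 1)) by (apply Rdiv_lt_0_compat; lra).
      destruct (pow_lt_1_zero (/ 2) ltac:(rewrite Rabs_pos_eq; lra) _ Pe) as [N HN].
      exists N. specialize (HN N (le_n N)).
      assert (Pn : 0 < (/ 2) ^ N) by (apply pow_lt; lra).
      rewrite Rabs_pos_eq in HN by lra.
      apply Rmult_lt_compat_l with (r := (3 * L + 1)%R) in HN; [|lra].
      replace ((3 * L + 1) * (d / (3 * L + 1)))%R with d in HN by (field; lra). lra. }
    destruct Z as [n Hn]. specialize (Hw n). destruct (I n) as [I1 I2].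
    set (p := (L * (/ 2) ^ n)%R) in *.
    set (aff := fun z => (f w - df w * w) + df w * z).
    assert (Ha : forall z, ccont aff z).
    { intros z. apply has_cderiv_ccont with (l := 0 + df w * 1).
      apply has_cderiv_plus; [apply has_cderiv_const | apply has_cderiv_scal, has_cderiv_id]. }
    assert (E : tri_int (fun z => f z - aff z) (u n) = tri_int f (u n)).
    { rewrite tri_int_minus by auto. unfold aff. rewrite tri_int_affine. ring. }
    assert (Hp : 0 <= p) by (rewrite <- I2; apply perim_ge_0).
    assert (B : Cmod (tri_int (fun z => f z - aff z) (u n)) <= perim (u n) * (eps / 4 * (3 * p))).
    { apply tri_int_bound with (w := w) (r := (3 * p)%R).
      - intros z. apply has_cderiv_ccont with (l := df z - (0 + df w * 1)).
        apply has_cderiv_minus; [apply Hd|].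
        apply has_cderiv_plus; [apply has_cderiv_const | apply has_cderiv_scal, has_cderiv_id].
      - rewrite I2. unfold p in *. lra.
      - intros z Hz. specialize (H1 (z - w)).
        replace (w + (z - w)) with z in H1 by ring.
        unfold aff. replace (f z - (f w - df w * w + df w * z)) with (f z - f w - df w * (z - w)) by ring.
        eapply Rle_trans; [apply H1|]; [unfold p in *; lra|].
        apply Rmult_le_compat_l; lra. }
    rewrite E in B. rewrite I2 in *. nra. }
  destruct (Rle_lt_or_eq_dec 0 L PT) as [P|P].
  - specialize (G (e0 / (L * L))%R).
    replace (e0 / (L * L) * L * L)%R with e0 in G by (field; lra).
    apply G. apply Rdiv_lt_0_compat; nra.
  - specialize (G 1%R Rlt_0_1). rewrite <- P in G. lra.
Qed.

Lemma holo_primitive (f : C -> C) : holo f -> exists F, entire_with F f.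
Proof.
  intros Hf. assert (Hc := holo_ccont f Hf).
  exists (fun z => seg_int f 0 z). intros z eps He.
  destruct (Hc z eps He) as [d [Hd H1]]. exists d; split; auto. intros h Hh.
  assert (G := goursat f (RtoC 0, z, z + h) Hf). simpl in G.
  rewrite (seg_int_rev f 0 (z + h)) in G by auto.
  assert (Hcc : forall w, ccont (fun _ => f z) w).
  { intros w. eapply has_cderiv_ccont. apply has_cderiv_const. }
  assert (E : seg_int (fun w => f w - f z) z (z + h) = seg_int f 0 (z + h) - seg_int f 0 z - f z * h).
  { rewrite seg_int_minus by auto.
    assert (A := seg_int_affine (f z) 0 z (z + h)).
    assert (X : seg_int (fun w => f z + 0 * w) z (z + h) = seg_int (fun _ => f z) z (z + h)).
    { unfold seg_int, seg_mean. f_equal. apply (RInt_ext (V := CV)). intros t _. match goal with |- ?x = ?y => change (@eq C x y) end. ring. }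
    rewrite X in A. rewrite A.
    replace (seg_int f 0 (z + h)) with (seg_int f 0 z + seg_int f z (z + h)
      - (seg_int f 0 z + seg_int f z (z + h) + - seg_int f 0 (z + h))) by ring.
    rewrite G. field. }
  rewrite <- E.
  eapply Rle_trans.
  - apply seg_int_bound with (M := eps).
    + intros w. destruct Hf as [df Hdf]. apply has_cderiv_ccont with (l := df w - 0).
      apply has_cderiv_minus; [apply Hdf | apply has_cderiv_const].
    + intros t Ht. left. apply H1. eapply Rle_lt_trans; [apply Cmod_segment_dist; auto|].
      replace (z + h - z) with h by ring. auto.
  - replace (z + h - z) with h by ring. lra.
Qed.

(** * The maximum modulus principle *)

(** A Lebesgue-number form of compactness: the radii in use have a common lower bound. It comes from
    [compactness_value_2d] on the square of half-side r; halving the radii pays for the passage from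
    coordinates to the modulus. *)
Lemma disc_gauge (P : C -> R -> Prop) (r : R) :
  (forall z, exists d, 0 < d /\ P z d) ->
  exists d, 0 < d /\ forall x, Cmod x <= r ->
    exists z e, P z e /\ d <= e /\ Cmod (x - z) < e.
Proof.
  intros H.
  set (D := fun z => constructive_indefinite_description _ (H z)).
  assert (Q : forall z, 0 < proj1_sig (D z) / 2).
  { intros z. destruct (proj2_sig (D z)) as [A _]. lra. }
  destruct (compactness_value_2d (- r) r (- r) r (fun u v => mkposreal _ (Q (u, v)))) as [d Hd].
  exists d. split; [apply cond_pos|]. intros x Hx.
  assert (X := re_le_Cmod x). assert (Y := im_le_Cmod x).
  apply Rabs_le_between in X. apply Rabs_le_between in Y.
  specialize (Hd (Re x) (Im x) ltac:(lra) ltac:(lra)). apply NNPP in Hd.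
  destruct Hd as [u [v [_ [_ [H1 [H2 H3]]]]]]. simpl in *.
  exists (u, v), (proj1_sig (D (u, v))). destruct (proj2_sig (D (u, v))) as [A B].
  split; [exact B|]. split; [lra|].
  eapply Rle_lt_trans; [apply Cmod_le_re_im|].
  change (Re (x - (u, v))) with (Re x - u)%R.
  change (Im (x - (u, v))) with (Im x - v)%R. lra.
Qed.

(** In both compactness arguments the gauge radius doubles as the estimate: with phi <= 1/d, a
    common lower bound on d bounds phi on K; with phi <= S - d, it lowers the supremum S unless S is
    attained. Off the closed set K both conditions hold vacuously on a small disc. *)
Lemma max_attained (K : C -> Prop) (phi : C -> R) (r : R) (x0 : C) :
  K x0 ->
  (forall z, K z -> Cmod z <= r) ->
  (forall z, ~ K z -> exists d, 0 < d /\ forall w, Cmod (w - z) < d -> ~ K w) ->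
  (forall z, K z -> forall eps, 0 < eps -> exists d, 0 < d /\
     forall w, K w -> Cmod (w - z) < d -> phi w <= phi z + eps) ->
  exists m, K m /\ forall z, K z -> phi z <= phi m.
Proof.
  intros H0 Hr Hcl Hc.
  destruct (disc_gauge (fun z d => forall w, K w -> Cmod (w - z) < d -> phi w <= / d) r) as [d [Pd Hd]].
  { intros z. destruct (classic (K z)) as [Kz|Kz].
    - destruct (Hc z Kz 1%R Rlt_0_1) as [d [Pd Hd]].
      set (q := (Rabs (phi z) + 1)%R).
      assert (Hq : 0 < q) by (unfold q; generalize (Rabs_pos (phi z)); lra).
      exists (Rmin d (/ q)). split.
      { apply Rmin_pos; auto. apply Rinv_0_lt_compat; auto. }
      intros w Kw Hw. eapply Rle_trans; [apply Hd; auto|].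
      { eapply Rlt_le_trans; [exact Hw|apply Rmin_l]. }
      apply Rle_trans with q; [unfold q; generalize (Rle_abs (phi z)); lra|].
      rewrite <- (Rinv_inv q) at 1. apply Rinv_le_contravar; [|apply Rmin_r].
      apply Rmin_pos; auto. apply Rinv_0_lt_compat; auto.
    - destruct (Hcl z Kz) as [d [Pd Hd]]. exists d; split; auto.
      intros w Kw Hw. elim (Hd w Hw Kw). }
  set (E := fun y => exists z, K z /\ y = phi z).
  destruct (completeness E) as [S [S1 S2]].
  { exists (/ d)%R. intros y [z [Kz ->]].
    destruct (Hd z (Hr z Kz)) as [c [e [H1 [H2 H3]]]].
    eapply Rle_trans; [apply (H1 z Kz H3)|]. apply Rinv_le_contravar; auto. }
  { exists (phi x0), x0; auto. }
  apply NNPP. intros N.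
  assert (L : forall z, K z -> phi z < S).
  { intros z Kz. apply Rnot_le_lt. intros G. apply N. exists z. split; auto.
    intros w Kw. apply Rle_trans with S; auto. apply S1. exists w; auto. }
  destruct (disc_gauge (fun z d => forall w, K w -> Cmod (w - z) < d -> phi w <= S - d) r) as [d' [Pd' Hd']].
  { intros z. destruct (classic (K z)) as [Kz|Kz].
    - specialize (L z Kz). set (e := ((S - phi z) / 2)%R).
      assert (He : 0 < e) by (unfold e; lra).
      destruct (Hc z Kz e He) as [d' [Pd' Hd']].
      exists (Rmin d' e). split; [apply Rmin_pos; auto|].
      intros w Kw Hw. eapply Rle_trans; [apply Hd'; auto|].
      { eapply Rlt_le_trans; [exact Hw|apply Rmin_l]. }
      generalize (Rmin_r d' e). unfold e. lra.
    - destruct (Hcl z Kz) as [d' [Pd' Hd']]. exists d'; split; auto.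
      intros w Kw Hw. elim (Hd' w Hw Kw). }
  assert (B : S <= S - d').
  { apply S2. intros y [z [Kz ->]].
    destruct (Hd' z (Hr z Kz)) as [c [e [H1 [H2 H3]]]].
    eapply Rle_trans; [apply (H1 z Kz H3)|]. lra. }
  lra.
Qed.

(** The mean value bound is applied to the remainder, whose derivative [k1 z - k1 m - l * (z - m)]
    is small because [k1] is differentiable at [m]. *)
Lemma taylor2 (k k1 : C -> C) (m l : C) (r : R) :
  0 < r -> (forall z, Cmod (z - m) < r -> has_cderiv k z (k1 z)) -> has_cderiv k1 m l ->
  forall eps, 0 < eps -> exists d, 0 < d /\ forall h, Cmod h < d ->
    Cmod (k (m + h) - (k m + k1 m * h + l / 2 * (h * h))) <= eps * (Cmod h * Cmod h).
Proof.
  intros Hr Hk Hl eps He. destruct (Hl eps He) as [d [Hd H1]].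
  exists (Rmin d r). split; [apply Rmin_pos; auto|]. intros h Hh.
  assert (h1 := Rlt_le_trans _ _ _ Hh (Rmin_l _ _)).
  assert (h2 := Rlt_le_trans _ _ _ Hh (Rmin_r _ _)).
  set (F := fun z => k z - (k1 m * (z - m) + l / 2 * ((z - m) * (z - m)))).
  assert (B : Cmod (F (m + h) - F m) <= eps * Cmod h * Cmod (m + h - m)).
  { assert (T : forall t : R, 0 <= t <= 1 -> Cmod (m + t * (m + h - m) - m) <= Cmod h).
    { intros t Ht. eapply Rle_trans; [apply Cmod_segment_dist; auto|].
      replace (m + h - m) with h by ring. lra. }
    apply mean_value_bound with (df := fun z => k1 z - k1 m - l * (z - m)); intros t Ht; specialize (T t Ht).
    - unfold F. set (z := m + t * (m + h - m)) in *.
      assert (D1 : has_cderiv (fun w => w - m) z (1 - 0)).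
      { apply has_cderiv_minus; [apply has_cderiv_id|apply has_cderiv_const]. }
      replace (k1 z - k1 m - l * (z - m)) with
        (k1 z - (k1 m * (1 - 0) + l / 2 * ((1 - 0) * (z - m) + (z - m) * (1 - 0)))) by field.
      apply has_cderiv_minus; [apply Hk; lra|].
      apply has_cderiv_plus; apply has_cderiv_scal; auto.
      apply (has_cderiv_mult (fun w => w - m) (fun w => w - m)); auto.
    - set (z := m + t * (m + h - m)) in *. 
      specialize (H1 (z - m) ltac:(lra)). replace (m + (z - m)) with z in H1 by ring.
      eapply Rle_trans; [exact H1|]. apply Rmult_le_compat_l; lra. }
  replace (m + h - m) with h in B by ring.
  rewrite <- Rmult_assoc. eapply Rle_trans; [|exact B]. right. f_equal. unfold F. ring.
Qed.

Lemma Cmod_sqr_perturb (q e : C) : Cmod q * Cmod q - 2 * Cmod q * Cmod e <= Cmod (q + e) * Cmod (q + e).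
Proof.
  assert (H := Cmod_sub_ge q (- e)). rewrite Cmod_opp in H.
  replace (q - - e) with (q + e) in H by ring.
  generalize (Cmod_ge_0 q) (Cmod_ge_0 e) (Cmod_ge_0 (q + e)). intros.
  destruct (Rle_dec (Cmod e) (Cmod q)); nra.
Qed.

(** Over t, -t, it, -it both h and h^2 sum to zero, so all mixed terms cancel and the right side is
    4|c0|^2 + 4|c1|^2 t^2 + 4|c2|^2 t^4: a discrete form of the subharmonicity of |q|^2. *)
Lemma four_point_sum (c0 c1 c2 : C) (t : R) :
  let q h := c0 + c1 * h + c2 * (h * h) in
  let s h := (Cmod (q h) * Cmod (q h))%R in
  4 * (Cmod c0 * Cmod c0) <= s (RtoC t) + s (RtoC (- t)) + s (Ci * t) + s (Ci * RtoC (- t)).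
Proof.
  intros q s. unfold s. rewrite !Cmod_sqr_re_im. unfold q.
  destruct c0 as [a0 b0], c1 as [a1 b1], c2 as [a2 b2]. unfold Re, Im; simpl.
  nra.
Qed.

Lemma four_point_dist (c : C) (t : R) :
  let s h := (Cmod (c + h) * Cmod (c + h))%R in
  (s (RtoC t) + s (RtoC (- t)) + s (Ci * t)%C + s (Ci * RtoC (- t))%C
    = 4 * (Cmod c * Cmod c) + 4 * t * t)%R.
Proof.
  intros s. unfold s. rewrite !Cmod_sqr_re_im.
  destruct c as [a0 b0]. unfold Re, Im; simpl. ring.
Qed.

(* At a maximum of |k|^2 + eps |z - c|^2, the sum of its values at m ± t, m ± i t
   would be at least four times the maximum plus 4 eps t^2 + o(t^2). *)
Lemma max_modulus (k k1 : C -> C) (c : C) (r M : R) :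
  0 < r ->
  (forall z, Cmod (z - c) < r -> has_cderiv k z (k1 z)) ->
  (forall z, Cmod (z - c) < r -> exists l, has_cderiv k1 z l) ->
  (forall z, Cmod (z - c) <= r -> ccont k z) ->
  (forall z, Cmod (z - c) = r -> Cmod (k z) <= M) ->
  forall z, Cmod (z - c) <= r -> Cmod (k z) <= M.
Proof.
  intros Hr D1 D2 Hc HM z0 Hz0. apply Rnot_lt_le. intros Hbig.
  assert (M0 : 0 <= M).
  { eapply Rle_trans; [apply Cmod_ge_0|]. apply (HM (c + RtoC r)).
    replace (c + RtoC r - c) with (RtoC r) by ring. rewrite Cmod_R, Rabs_pos_eq; lra. }
  (* With this [e] the perturbation adds only half of |k z0|^2 - M^2 on the boundary circle, so the
     maximum of [phi] is interior. *)
  set (e := ((Cmod (k z0) * Cmod (k z0) - M * M) / (2 * r * r))%R).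
  assert (He : 0 < e).
  { unfold e. apply Rdiv_lt_0_compat; nra. }
  assert (Er : (e * r * r = (Cmod (k z0) * Cmod (k z0) - M * M) / 2)%R).
  { unfold e. field. lra. }
  clearbody e.
  set (phi := fun z => (Cmod (k z) * Cmod (k z) + e * (Cmod (z - c) * Cmod (z - c)))%R).
  destruct (max_attained (fun z => Cmod (z - c) <= r) phi (r + Cmod c) z0 Hz0) as [m [Km Hm]].
  { intros z Hz. assert (T := Cmod_triangle (z - c) c). replace (z - c + c) with z in T by ring. lra. }
  { intros z Hz. exists (Cmod (z - c) - r)%R. split; [lra|]. intros w Hw.
    assert (T := Cmod_sub_triangle z w c). rewrite (Cmod_sub_sym z w) in T. lra. }
  { intros z Hz eps Heps.
    set (B := (2 * Cmod (k z) + 1)%R).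
    assert (HB : 0 < B) by (unfold B; generalize (Cmod_ge_0 (k z)); lra).
    destruct (Hc z Hz (Rmin 1 (eps / 2 / B))%R) as [d [Pd Hd]].
    { apply Rmin_pos; [lra|]. apply Rdiv_lt_0_compat; lra. }
    assert (P2 : 0 < eps / (4 * e * r)).
    { apply Rdiv_lt_0_compat; [lra|]. repeat apply Rmult_lt_0_compat; lra. }
    exists (Rmin d (eps / (4 * e * r)))%R. split; [apply Rmin_pos; auto|].
    intros w Kw Hw.
    assert (w1 := Rlt_le_trans _ _ _ Hw (Rmin_l _ _)).
    assert (w2 := Rlt_le_trans _ _ _ Hw (Rmin_r _ _)).
    specialize (Hd w w1).
    assert (k1' := Rlt_le_trans _ _ _ Hd (Rmin_l _ _)).
    assert (k2' := Rlt_le_trans _ _ _ Hd (Rmin_r _ _)).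
    assert (T := Cmod_triangle (k w - k z) (k z)). replace (k w - k z + k z) with (k w) in T by ring.
    assert (A1 : Cmod (k w) * Cmod (k w) <= Cmod (k z) * Cmod (k z) + eps / 2).
    { set (x := Cmod (k w - k z)) in *. assert (0 <= x) by apply Cmod_ge_0.
      assert (0 <= Cmod (k w)) by apply Cmod_ge_0. assert (0 <= Cmod (k z)) by apply Cmod_ge_0.
      assert (X : x * B <= eps / 2).
      { apply Rmult_lt_compat_r with (r := B) in k2'; auto.
        replace (eps / 2 / B * B)%R with (eps / 2)%R in k2' by (field; lra). lra. }
      unfold B in X. nra. }
    assert (A2 : e * (Cmod (w - c) * Cmod (w - c)) <= e * (Cmod (z - c) * Cmod (z - c)) + eps / 2).
    { assert (T2 := Cmod_sub_triangle w z c).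
      set (x := Cmod (w - z)) in *. set (y := Cmod (w - c)) in *. set (u := Cmod (z - c)) in *.
      assert (0 <= x) by apply Cmod_ge_0. assert (0 <= y) by apply Cmod_ge_0. assert (0 <= u) by apply Cmod_ge_0.
      assert (X : x * (4 * e * r) <= eps).
      { apply Rmult_lt_compat_r with (r := (4 * e * r)%R) in w2; [|repeat apply Rmult_lt_0_compat; lra].
        replace (eps / (4 * e * r) * (4 * e * r))%R with eps in w2 by (field; lra). lra. }
      assert (Y : y * y - u * u <= x * (2 * r)).
      { replace (y * y - u * u)%R with ((y - u) * (y + u))%R by ring.
        destruct (Rle_dec y u); [|apply Rmult_le_compat; lra].
        apply Rle_trans with 0%R; [|apply Rmult_le_pos; lra]. nra. }
      nra. }
    unfold phi. lra. }
  assert (Hin : Cmod (m - c) < r).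
  { destruct Km as [Km|Km]; auto. exfalso.
    specialize (Hm z0 Hz0). unfold phi in Hm. rewrite Km in Hm.
    specialize (HM m Km). assert (0 <= Cmod (k m)) by apply Cmod_ge_0.
    assert (0 <= e * (Cmod (z0 - c) * Cmod (z0 - c))).
    { apply Rmult_le_pos; [lra|]. apply Rmult_le_pos; apply Cmod_ge_0. }
    nra. }
  destruct (D2 m Hin) as [l Hl].
  set (c1 := k1 m). set (c2 := l / 2).
  set (B := (Cmod (k m) + Cmod c1 + Cmod c2)%R).
  assert (HB : 0 <= B).
  { unfold B. generalize (Cmod_ge_0 (k m)) (Cmod_ge_0 c1) (Cmod_ge_0 c2). lra. }
  (* The Taylor error then costs at most e t^2 / 2 at each of the four points, less than the average
     e t^2 gained from |z - c|^2. *)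
  set (eta := (e / (4 * (B + 1)))%R).
  assert (Heta : 0 < eta) by (unfold eta; apply Rdiv_lt_0_compat; lra).
  assert (Hs : 0 < r - Cmod (m - c)) by lra.
  destruct (taylor2 k k1 m l (r - Cmod (m - c)) Hs) with (eps := eta) as [d [Pd Hd]]; auto.
  { intros z Hz. apply D1. assert (T := Cmod_sub_triangle z m c). lra. }
  set (q := fun h => k m + c1 * h + c2 * (h * h)).
  set (t := (Rmin (Rmin d (r - Cmod (m - c))) 1 / 2)%R).
  assert (t0 : 0 < t /\ t < d /\ t < r - Cmod (m - c) /\ t <= 1).
  { unfold t. assert (0 < Rmin (Rmin d (r - Cmod (m - c))) 1) by (repeat apply Rmin_pos; lra).
    assert (A1 := Rmin_l (Rmin d (r - Cmod (m - c))) 1). assert (A2 := Rmin_r (Rmin d (r - Cmod (m - c))) 1).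
    assert (A3 := Rmin_l d (r - Cmod (m - c))). assert (A4 := Rmin_r d (r - Cmod (m - c))). lra. }
  clearbody t. destruct t0 as [t0 [t1 [t2 t3]]].
  assert (Step : forall h, Cmod h = t ->
    Cmod (q h) * Cmod (q h) - 2 * B * eta * (t * t) + e * (Cmod (m - c + h) * Cmod (m - c + h)) <= phi m).
  { intros h Hh. assert (Kh : Cmod (m + h - c) <= r).
    { assert (T := Cmod_triangle (m - c) h). replace (m - c + h) with (m + h - c) in T by ring. lra. }
    specialize (Hm _ Kh). unfold phi at 1 in Hm.
    replace (m + h - c) with (m - c + h) in Hm by ring.
    specialize (Hd h ltac:(lra)). fold c1 c2 in Hd. change (k m + c1 * h + c2 * (h * h)) with (q h) in Hd.
    assert (P := Cmod_sqr_perturb (q h) (k (m + h) - q h)).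
    replace (q h + (k (m + h) - q h)) with (k (m + h)) in P by ring.
    rewrite Hh in Hd.
    assert (Qb : Cmod (q h) <= B).
    { unfold q, B. eapply Rle_trans; [apply Cmod_triangle|]. 
      assert (T := Cmod_triangle (k m) (c1 * h)). rewrite !Cmod_mult, Hh. rewrite Cmod_mult, Hh in T.
      assert (X1 : Cmod c1 * t <= Cmod c1 * 1) by (apply Rmult_le_compat_l; [apply Cmod_ge_0|lra]).
      assert (X2 : Cmod c2 * (t * t) <= Cmod c2 * 1) by (apply Rmult_le_compat_l; [apply Cmod_ge_0|nra]).
      lra. }
    assert (X : 2 * Cmod (q h) * Cmod (k (m + h) - q h) <= 2 * B * (eta * (t * t))).
    { apply Rmult_le_compat; try apply Cmod_ge_0; auto; [generalize (Cmod_ge_0 (q h)); lra|lra]. }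
    lra. }
  assert (F1 := four_point_sum (k m) c1 c2 t). cbv zeta in F1.
  assert (F2 := four_point_dist (m - c) t). cbv zeta in F2.
  assert (N1 : Cmod (RtoC t) = t) by (rewrite Cmod_R, Rabs_pos_eq; lra).
  assert (N2 : Cmod (RtoC (- t)) = t) by (rewrite Cmod_R, Rabs_Ropp, Rabs_pos_eq; lra).
  assert (N3 : Cmod (Ci * t) = t) by (rewrite Cmod_mult, Cmod_Ci, N1; lra).
  assert (N4 : Cmod (Ci * RtoC (- t)) = t) by (rewrite Cmod_mult, Cmod_Ci, N2; lra).
  assert (S1 := Step _ N1). assert (S2 := Step _ N2). assert (S3 := Step _ N3). assert (S4 := Step _ N4).
  unfold q in S1, S2, S3, S4. unfold phi in S1, S2, S3, S4.
  assert (Tt : 0 < t * t) by (apply Rmult_lt_0_compat; auto).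
  assert (Be : 2 * B * eta <= e / 2).
  { unfold eta. apply Rmult_le_reg_r with (4 * (B + 1))%R; [lra|].
    replace (2 * B * (e / (4 * (B + 1))) * (4 * (B + 1)))%R with (2 * B * e)%R by (field; lra). nra. }
  assert (Be2 : 2 * B * eta * (t * t) <= e / 2 * (t * t)) by (apply Rmult_le_compat_r; lra).
  apply (f_equal (Rmult e)) in F2.
  nra.
Qed.

(** * Regularity of entire functions *)

Lemma holo_pointwise (f : C -> C) : (forall z, exists l, has_cderiv f z l) -> holo f.
Proof.
  intros H. exists (C_derive f). intros z. destruct (H z) as [l Hl].
  assert (E := proj2 (is_derive_has_cderiv f z l) Hl).
  rewrite (is_C_derive_unique _ _ _ E). exact Hl.
Qed.

Lemma ccont_bounded (f : C -> C) (r : R) :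
  (forall z, ccont f z) -> exists B, 0 <= B /\ forall z, Cmod z <= r -> Cmod (f z) <= B.
Proof.
  intros H. destruct (Rle_lt_dec 0 r) as [Hr|Hr].
  - destruct (max_attained (fun z => Cmod z <= r) (fun z => Cmod (f z)) r 0) as [m [_ Hm]].
    + rewrite Cmod_0. exact Hr.
    + auto.
    + intros z Hz. exists (Cmod z - r)%R. split; [lra|]. intros w Hw.
      assert (T := Cmod_sub_ge z w). rewrite (Cmod_sub_sym z w) in T. lra.
    + intros z _ eps He. destruct (H z eps He) as [d [Pd Hd]]. exists d; split; auto.
      intros w _ Hw. specialize (Hd w Hw). generalize (Cmod_sub_ge (f w) (f z)). lra.
    + exists (Cmod (f m)). split; [apply Cmod_ge_0|exact Hm].
  - exists 0%R. split; [lra|]. intros z Hz. generalize (Cmod_ge_0 z). lra.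
Qed.

Lemma ccont_uniform (f : C -> C) (r eps : R) :
  (forall z, ccont f z) -> 0 < eps ->
  exists d, 0 < d /\ forall x y, Cmod x <= r -> Cmod (y - x) < d -> Cmod (f y - f x) < eps.
Proof.
  intros H He.
  destruct (disc_gauge (fun z d => forall w, Cmod (w - z) < 2 * d -> Cmod (f w - f z) < eps / 2) r)
    as [d [Pd Hd]].
  { intros z. destruct (H z (eps / 2)%R ltac:(lra)) as [d [Pd Hd]].
    exists (d / 2)%R. split; [lra|]. intros w Hw. apply Hd. lra. }
  exists d. split; auto. intros x y Hx Hy.
  destruct (Hd x Hx) as [z [e [H1 [H2 H3]]]].
  assert (A := H1 x ltac:(lra)).
  assert (T := Cmod_sub_triangle y x z). assert (B := H1 y ltac:(lra)).
  eapply Rle_lt_trans; [apply (Cmod_sub_triangle _ (f z))|]. rewrite (Cmod_sub_sym (f z)). lra.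
Qed.

Lemma has_cderiv_shift (f : C -> C) (h z l : C) :
  has_cderiv f (z + h) l -> has_cderiv (fun w => f (w + h)) z l.
Proof.
  intros H. replace l with (l * (1 + 0)) by ring.
  apply (has_cderiv_comp f (fun w => w + h)); auto.
  apply has_cderiv_plus; [apply has_cderiv_id|apply has_cderiv_const].
Qed.

Lemma has_cderiv_diff_quot (f df : C -> C) (h z : C) :
  h <> 0 -> entire_with f df ->
  has_cderiv (fun w => (f (w + h) - f w) / h) z ((df (z + h) - df z) / h).
Proof.
  intros Hh H.
  replace ((df (z + h) - df z) / h) with (/ h * (df (z + h) - df z)) by (field; auto).
  apply has_cderiv_ext with (fun w => / h * (f (w + h) - f w)); [intros; field; auto|].
  apply has_cderiv_scal. apply has_cderiv_minus; [|apply H].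
  apply has_cderiv_shift, H.
Qed.

(* Difference quotients of a primitive approximate [f] and are once more differentiable than [f]. *)
Lemma holo_approx (f : C -> C) (r eps : R) :
  holo f -> 0 < eps ->
  exists u u1, entire_with u u1 /\ holo u1 /\ forall z, Cmod z <= r -> Cmod (u z - f z) <= eps.
Proof.
  intros Hf He. destruct (holo_primitive f Hf) as [F HF].
  destruct (ccont_uniform f r eps (holo_ccont f Hf) He) as [d [Pd Hd]].
  set (h := RtoC (d / 2)).
  assert (Mh : Cmod h = (d / 2)%R) by (unfold h; rewrite Cmod_R, Rabs_pos_eq; lra).
  assert (Nh : h <> 0) by (apply Cmod_gt_0; lra).
  exists (fun z => (F (z + h) - F z) / h), (fun z => (f (z + h) - f z) / h). repeat split.
  - intros z. apply has_cderiv_diff_quot; auto.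
  - destruct Hf as [df Hdf]. exists (fun z => (df (z + h) - df z) / h). intros z.
    apply has_cderiv_diff_quot; auto.
  - intros z Hz.
    assert (B : Cmod ((F (z + h) - f z * (z + h)) - (F z - f z * z)) <= eps * Cmod (z + h - z)).
    { apply (mean_value_bound (fun w => F w - f z * w) (fun w => f w - f z)); intros t Ht.
      - replace (f (z + t * (z + h - z)) - f z) with (f (z + t * (z + h - z)) - f z * 1) by ring.
        apply has_cderiv_minus; [apply HF|]. apply has_cderiv_scal, has_cderiv_id.
      - left. apply Hd; auto. eapply Rle_lt_trans; [apply Cmod_segment_dist; auto|].
        replace (z + h - z) with h by ring. lra. }
    replace (z + h - z) with h in B by ring.
    replace ((F (z + h) - F z) / h - f z) with
      (((F (z + h) - f z * (z + h)) - (F z - f z * z)) / h) by (field; auto).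
    rewrite Cmod_div by auto. apply Rmult_le_reg_r with (Cmod h); [lra|].
    unfold Rdiv. rewrite Rmult_assoc, Rinv_l by lra. lra.
Qed.

Lemma disc_norm_bound (z c : C) (r : R) : Cmod (z - c) <= r -> Cmod z <= Cmod c + r.
Proof. intros H. generalize (Cmod_sub_ge z c). lra. Qed.

(** [max_modulus] asks for a second derivative, which [f] is not yet known to have. The approximants
    have one, and the bound survives the limit. *)
Lemma holo_max_modulus (f : C -> C) (c : C) (r M : R) :
  holo f -> 0 < r -> (forall z, Cmod (z - c) = r -> Cmod (f z) <= M) ->
  forall z, Cmod (z - c) <= r -> Cmod (f z) <= M.
Proof.
  intros Hf Hr HM z Hz. apply le_epsilon. intros eps He.
  destruct (holo_approx f (Cmod c + r) (eps / 2)%R Hf ltac:(lra)) as [u [u1 [Hu [[u2 Hu1] Ha]]]].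
  assert (B : Cmod (u z) <= M + eps / 2).
  { apply (max_modulus u u1 c r); auto.
    - intros w _. exists (u2 w). apply Hu1.
    - intros w _. eapply has_cderiv_ccont. apply Hu.
    - intros w Hw. specialize (HM w Hw). specialize (Ha w (disc_norm_bound _ _ _ (Req_le _ _ Hw))).
      generalize (Cmod_sub_ge (u w) (f w)). lra. }
  specialize (Ha z (disc_norm_bound _ _ _ Hz)). rewrite Cmod_sub_sym in Ha.
  generalize (Cmod_sub_ge (f z) (u z)). lra.
Qed.

(** Away from [c] this is the quotient rule; at [c] the second-order Taylor formula shows that the
    divided difference has derivative [v2 c / 2]. *)
Lemma holo_divide (v v1 : C -> C) (c : C) :
  entire_with v v1 -> holo v1 ->
  exists k, holo k /\ k c = v1 c /\ forall z, v z = v c + (z - c) * k z.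
Proof.
  intros Hv [v2 Hv1].
  set (k := fun z => if excluded_middle_informative (z = c) then v1 c else (v z - v c) / (z - c)).
  assert (Kc : k c = v1 c).
  { unfold k. destruct (excluded_middle_informative (c = c)); congruence. }
  assert (Kz : forall z, z <> c -> k z = (v z - v c) / (z - c)).
  { intros z Hz. unfold k. destruct (excluded_middle_informative (z = c)); congruence. }
  exists k. split; [|split; auto].
  - apply holo_pointwise. intros z. destruct (classic (z = c)) as [->|N].
    + exists (v2 c / 2). intros eps He.
      destruct (taylor2 v v1 c (v2 c) 1 Rlt_0_1) with (eps := eps) as [d [Pd Hd]]; auto.
      exists d; split; auto. intros h Hh. specialize (Hd h Hh).
      destruct (classic (h = 0)) as [->|Nh].
      { rewrite Cplus_0_r. replace (k c - k c - v2 c / 2 * 0) with (RtoC 0) by ring. rewrite Cmod_0. lra. }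
      assert (N : c + h <> c).
      { intros E. apply Nh. replace h with (c + h - c) by ring. rewrite E. ring. }
      rewrite Kc, (Kz _ N). assert (P := proj1 (Cmod_gt_0 h) Nh).
      replace ((v (c + h) - v c) / (c + h - c) - v1 c - v2 c / 2 * h) with
        ((v (c + h) - (v c + v1 c * h + v2 c / 2 * (h * h))) / h).
      2:{ replace (c + h - c) with h by ring. field; auto. }
      rewrite Cmod_div by auto. apply Rmult_le_reg_r with (Cmod h); auto.
      unfold Rdiv. rewrite Rmult_assoc, Rinv_l by lra. lra.
    + assert (Nc := Csub_neq_0 _ _ N).
      eexists. apply has_cderiv_local with (f := fun w => (v w - v c) / (w - c)) (r := Cmod (z - c)).
      * apply Cmod_gt_0; auto.
      * intros w Hw. symmetry. apply Kz. intros ->. rewrite Cmod_sub_sym in Hw. lra.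
      * apply (has_cderiv_div (fun w => v w - v c) (fun w => w - c)); auto.
        -- apply has_cderiv_minus; [apply Hv|apply has_cderiv_const].
        -- apply has_cderiv_minus; [apply has_cderiv_id|apply has_cderiv_const].
  - intros z. destruct (classic (z = c)) as [->|N].
    + ring.
    + rewrite (Kz z N). field. apply Csub_neq_0; auto.
Qed.

(** The maximum principle for the divided difference. The conclusion mentions no derivative, so that
    [schwarz] can take it to the limit of the approximants. *)
Lemma schwarz_twice (v v1 : C -> C) (c : C) (r M : R) :
  entire_with v v1 -> holo v1 -> 0 < r ->
  (forall z, Cmod (z - c) = r -> Cmod (v z - v c) <= M) ->
  forall z, Cmod (z - c) <= r -> Cmod (v z - v c) * r <= M * Cmod (z - c).
Proof.
  intros Hv Hv1 Hr HM z Hz. destruct (holo_divide v v1 c Hv Hv1) as [k [Hk [_ E]]].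
  assert (E' : forall w, v w - v c = (w - c) * k w) by (intros w; rewrite (E w); ring).
  assert (B : Cmod (k z) <= M / r).
  { apply (holo_max_modulus k c r); auto. intros w Hw. specialize (HM w Hw).
    rewrite E', Cmod_mult, Hw in HM. apply Rmult_le_reg_l with r; auto.
    replace (r * (M / r))%R with M by (field; lra). exact HM. }
  rewrite E', Cmod_mult.
  apply Rmult_le_compat_l with (r := (Cmod (z - c) * r)%R) in B.
  - replace (Cmod (z - c) * r * (M / r))%R with (M * Cmod (z - c))%R in B by (field; lra). lra.
  - apply Rmult_le_pos; [apply Cmod_ge_0|lra].
Qed.

Lemma schwarz (f : C -> C) (c : C) (r M : R) :
  holo f -> 0 < r ->
  (forall z, Cmod (z - c) = r -> Cmod (f z - f c) <= M) ->
  forall z, Cmod (z - c) <= r -> Cmod (f z - f c) * r <= M * Cmod (z - c).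
Proof.
  intros Hf Hr HM z Hz. apply le_epsilon. intros eps He.
  set (e := (eps / (4 * r))%R).
  assert (Pe : 0 < e) by (unfold e; apply Rdiv_lt_0_compat; lra).
  assert (Ee : (4 * r * e = eps)%R) by (unfold e; field; lra). clearbody e.
  destruct (holo_approx f (Cmod c + r) e Hf Pe) as [u [u1 [Hu [Hu1 Ha]]]].
  assert (D : forall w, Cmod (w - c) <= r -> Cmod ((u w - u c) - (f w - f c)) <= 2 * e).
  { intros w Hw. assert (A1 := Ha w (disc_norm_bound _ _ _ Hw)).
    assert (A2 : Cmod (u c - f c) <= e) by (apply Ha; lra).
    replace (u w - u c - (f w - f c)) with ((u w - f w) - (u c - f c)) by ring.
    eapply Rle_trans; [apply Cmod_sub_le|]. lra. }
  assert (B : Cmod (u z - u c) * r <= (M + 2 * e) * Cmod (z - c)).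
  { apply (schwarz_twice u u1); auto. intros w Hw.
    specialize (D w (Req_le _ _ Hw)). specialize (HM w Hw).
    generalize (Cmod_sub_ge (u w - u c) (f w - f c)). lra. }
  specialize (D z Hz). rewrite Cmod_sub_sym in D.
  assert (T := Cmod_sub_ge (f z - f c) (u z - u c)).
  nra.
Qed.

(* Cross-multiplied Lipschitz bound for [(v z - v c) / (z - c)]: in this form it
   passes to pointwise limits of [v]. *)
Lemma quotient_lipschitz_twice (v v1 : C -> C) (c : C) (r M : R) :
  entire_with v v1 -> holo v1 -> 0 < r ->
  (forall z, Cmod (z - c) = r -> Cmod (v z - v c) <= M) ->
  forall z w, Cmod (z - c) <= r -> Cmod (w - c) <= r ->
  Cmod ((v z - v c) * (w - c) - (v w - v c) * (z - c)) * (r * r)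
    <= 2 * M * (Cmod (z - c) + Cmod (w - c)) * (Cmod (z - c) * Cmod (w - c)).
Proof.
  intros Hv Hv1 Hr HM z w Hz Hw. destruct (holo_divide v v1 c Hv Hv1) as [k [Hk [_ E]]].
  assert (E' : forall w, v w - v c = (w - c) * k w) by (intros x; rewrite (E x); ring).
  assert (B : forall x, Cmod (x - c) <= r -> Cmod (k x) <= M / r).
  { apply (holo_max_modulus k c r); auto. intros x Hx. specialize (HM x Hx).
    rewrite E', Cmod_mult, Hx in HM. apply Rmult_le_reg_l with r; auto.
    replace (r * (M / r))%R with M by (field; lra). exact HM. }
  assert (L : forall x, Cmod (x - c) <= r -> Cmod (k x - k c) * r <= 2 * (M / r) * Cmod (x - c)).
  { apply schwarz; auto. intros x Hx. eapply Rle_trans; [apply Cmod_sub_le|].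
    assert (B1 := B x (Req_le _ _ Hx)). assert (B2 := B c). rewrite Cmod_self_sub in B2.
    specialize (B2 ltac:(lra)). lra. }
  rewrite !E'.
  replace ((z - c) * k z * (w - c) - (w - c) * k w * (z - c))
    with ((z - c) * (w - c) * ((k z - k c) - (k w - k c))) by ring.
  rewrite !Cmod_mult.
  assert (T := Cmod_sub_le (k z - k c) (k w - k c)).
  assert (L1 := L z Hz). assert (L2 := L w Hw).
  set (p := (Cmod (z - c) * Cmod (w - c))%R).
  assert (Hp : 0 <= p) by (apply Rmult_le_pos; apply Cmod_ge_0).
  assert (X : Cmod (k z - k c - (k w - k c)) * (r * r) <= 2 * M * (Cmod (z - c) + Cmod (w - c))).
  { apply Rle_trans with ((Cmod (k z - k c) * r + Cmod (k w - k c) * r) * r)%R.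
    - assert (0 <= r * r) by nra. nra.
    - apply Rle_trans with ((2 * (M / r) * Cmod (z - c) + 2 * (M / r) * Cmod (w - c)) * r)%R.
      + apply Rmult_le_compat_r; lra.
      + right. field. lra. }
  replace (p * Cmod (k z - k c - (k w - k c)) * (r * r))%R
    with (p * (Cmod (k z - k c - (k w - k c)) * (r * r)))%R by ring.
  rewrite (Rmult_comm _ p). apply Rmult_le_compat_l; auto.
Qed.

Lemma le_limit (a b K : R) : 0 <= K -> (forall e, 0 < e -> a <= b + K * e) -> a <= b.
Proof.
  intros HK H. apply le_epsilon. intros eps He.
  assert (P : 0 < eps / (K + 1)) by (apply Rdiv_lt_0_compat; lra).
  specialize (H _ P). eapply Rle_trans; [exact H|]. apply Rplus_le_compat_l.
  apply Rmult_le_reg_r with (K + 1)%R; [lra|].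
  replace (K * (eps / (K + 1)) * (K + 1))%R with (K * eps)%R by (field; lra). nra.
Qed.

Lemma Cmod_det_perturb (a b x y a' b' : C) (e : R) :
  Cmod (a' - a) <= e -> Cmod (b' - b) <= e ->
  Cmod (a * y - b * x) <= Cmod (a' * y - b' * x) + (Cmod x + Cmod y) * e.
Proof.
  intros Ha Hb.
  replace (a * y - b * x) with ((a' * y - b' * x) + ((b' - b) * x - (a' - a) * y)) by ring.
  eapply Rle_trans; [apply Cmod_triangle|]. apply Rplus_le_compat_l.
  eapply Rle_trans; [apply Cmod_sub_le|]. rewrite !Cmod_mult.
  generalize (Cmod_ge_0 x) (Cmod_ge_0 y). nra.
Qed.

Lemma quotient_lipschitz (f : C -> C) (c : C) (r M : R) :
  holo f -> 0 < r ->
  (forall z, Cmod (z - c) = r -> Cmod (f z - f c) <= M) ->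
  forall z w, Cmod (z - c) <= r -> Cmod (w - c) <= r ->
  Cmod ((f z - f c) * (w - c) - (f w - f c) * (z - c)) * (r * r)
    <= 2 * M * (Cmod (z - c) + Cmod (w - c)) * (Cmod (z - c) * Cmod (w - c)).
Proof.
  intros Hf Hr HM z w Hz Hw.
  set (x := Cmod (z - c)). set (y := Cmod (w - c)).
  assert (Hx : 0 <= x) by apply Cmod_ge_0. assert (Hy : 0 <= y) by apply Cmod_ge_0.
  apply le_limit with (K := (2 * (x + y) * (r * r) + 4 * (x + y) * (x * y))%R).
  { assert (0 <= x * y) by nra. assert (0 <= (x + y) * (r * r)) by nra.
    assert (0 <= (x + y) * (x * y)) by nra. lra. }
  intros e Pe.
  destruct (holo_approx f (Cmod c + r) e Hf Pe) as [u [u1 [Hu [Hu1 Ha]]]].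
  assert (D : forall w, Cmod (w - c) <= r -> Cmod ((u w - u c) - (f w - f c)) <= 2 * e).
  { intros q Hq. assert (A1 := Ha q (disc_norm_bound _ _ _ Hq)).
    assert (A2 : Cmod (u c - f c) <= e) by (apply Ha; lra).
    replace (u q - u c - (f q - f c)) with ((u q - f q) - (u c - f c)) by ring.
    eapply Rle_trans; [apply Cmod_sub_le|]. lra. }
  assert (B := quotient_lipschitz_twice u u1 c r (M + 2 * e) Hu Hu1 Hr).
  assert (HB : forall q, Cmod (q - c) = r -> Cmod (u q - u c) <= M + 2 * e).
  { intros q Hq. specialize (D q (Req_le _ _ Hq)). specialize (HM q Hq).
    generalize (Cmod_sub_ge (u q - u c) (f q - f c)). lra. }
  specialize (B HB z w Hz Hw). fold x y in B.
  assert (P := Cmod_det_perturb (f z - f c) (f w - f c) (z - c) (w - c) (u z - u c) (u w - u c) (2 * e)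
    (D z Hz) (D w Hw)). fold x y in P.
  assert (R2 : 0 <= r * r) by nra.
  apply Rmult_le_compat_r with (r := (r * r)%R) in P; auto.
  nra.
Qed.

(** The difference quotients (f(z + h) - f z)/h are entire and, by Schwarz's lemma, bounded near [c]
    uniformly in h. Hence [quotient_lipschitz] holds for them with one constant and passes to their
    pointwise limit [df]. It says that the quotients (df z - df c)/(z - c) at z and w differ by at
    most 2M(|z - c| + |w - c|), so they converge as z tends to c. *)
Lemma holo_deriv (f df : C -> C) : entire_with f df -> holo df.
Proof.
  intros Hf. assert (Hh : holo f) by (exists df; exact Hf).
  apply holo_pointwise. intros c.
  destruct (ccont_bounded f (Cmod c + 2) (holo_ccont f Hh)) as [B [B0 HB]].
  assert (Lip : forall z h, Cmod (z - c) <= 1 -> Cmod h <= 1 -> Cmod (f (z + h) - f z) <= 2 * B * Cmod h).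
  { intros z h Hz Hh1. 
    assert (Cz := disc_norm_bound z c 1 Hz).
    assert (S := schwarz f z 1 (2 * B) Hh Rlt_0_1).
    assert (E : z + h - z = h) by ring.
    assert (HS : forall w, Cmod (w - z) = 1%R -> Cmod (f w - f z) <= 2 * B).
    { intros w Hw. eapply Rle_trans; [apply Cmod_sub_le|].
      assert (Cw := disc_norm_bound w z 1 (Req_le _ _ Hw)).
      assert (b1 := HB w ltac:(lra)). assert (b2 := HB z ltac:(lra)). lra. }
    specialize (S HS (z + h)). rewrite E in S. specialize (S Hh1). lra. }
  set (M := (4 * B)%R).
  assert (Q : forall z w, Cmod (z - c) <= 1 -> Cmod (w - c) <= 1 ->
    Cmod ((df z - df c) * (w - c) - (df w - df c) * (z - c))
    <= 2 * M * (Cmod (z - c) + Cmod (w - c)) * (Cmod (z - c) * Cmod (w - c))).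
  { intros z w Hz Hw. apply le_limit with (K := (2 * (Cmod (z - c) + Cmod (w - c)))%R).
    { generalize (Cmod_ge_0 (z - c)) (Cmod_ge_0 (w - c)). lra. }
    intros e Pe.
    destruct (Hf z e Pe) as [d1 [P1 H1]]. destruct (Hf w e Pe) as [d2 [P2 H2]].
    destruct (Hf c e Pe) as [d3 [P3 H3]].
    set (s := (Rmin (Rmin d1 d2) (Rmin d3 1) / 2)%R).
    assert (Hs : 0 < s /\ s < d1 /\ s < d2 /\ s < d3 /\ s < 1).
    { assert (0 < Rmin (Rmin d1 d2) (Rmin d3 1)) by (repeat apply Rmin_pos; lra).
      assert (A1 := Rmin_l (Rmin d1 d2) (Rmin d3 1)). assert (A2 := Rmin_r (Rmin d1 d2) (Rmin d3 1)).
      assert (A3 := Rmin_l d1 d2). assert (A4 := Rmin_r d1 d2).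
      assert (A5 := Rmin_l d3 1). assert (A6 := Rmin_r d3 1). unfold s. lra. }
    clearbody s. destruct Hs as [s0 [s1 [s2 [s3 s4]]]].
    set (h := RtoC s). assert (Mh : Cmod h = s) by (unfold h; rewrite Cmod_R, Rabs_pos_eq; lra).
    assert (Nh : h <> 0) by (apply Cmod_gt_0; lra). clearbody h.
    set (v := fun z => (f (z + h) - f z) / h).
    assert (App : forall q, (Cmod (f (q + h) - f q - df q * h) <= e * Cmod h) -> Cmod (v q - df q) <= e).
    { intros q Hq. unfold v.
      replace ((f (q + h) - f q) / h - df q) with ((f (q + h) - f q - df q * h) / h) by (field; auto).
      rewrite Cmod_div by auto. apply Rmult_le_reg_r with (Cmod h); [lra|].
      unfold Rdiv. rewrite Rmult_assoc, Rinv_l by lra. lra. }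
    assert (Az := App z (H1 h ltac:(lra))). assert (Aw := App w (H2 h ltac:(lra))).
    assert (Ac := App c (H3 h ltac:(lra))).
    assert (Vh : holo v).
    { exists (fun z => (df (z + h) - df z) / h). intros q. apply has_cderiv_diff_quot; auto. }
    assert (Vb : forall q, Cmod (q - c) <= 1 -> Cmod (v q) <= 2 * B).
    { intros q Hq. unfold v. rewrite Cmod_div by auto. apply Rmult_le_reg_r with (Cmod h); [lra|].
      unfold Rdiv. rewrite Rmult_assoc, Rinv_l by lra. rewrite Rmult_1_r. apply Lip; lra. }
    assert (V := quotient_lipschitz v c 1 M Vh Rlt_0_1).
    assert (HV : forall q, Cmod (q - c) = 1%R -> Cmod (v q - v c) <= M).
    { intros q Hq. eapply Rle_trans; [apply Cmod_sub_le|].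
      assert (V1 := Vb q (Req_le _ _ Hq)). assert (V2 := Vb c). rewrite Cmod_self_sub in V2.
      specialize (V2 ltac:(lra)). unfold M. lra. }
    specialize (V HV z w Hz Hw).
    assert (Dz : forall q, Cmod (v q - df q) <= e -> Cmod ((v q - v c) - (df q - df c)) <= 2 * e).
    { intros q Hq. replace (v q - v c - (df q - df c)) with ((v q - df q) - (v c - df c)) by ring.
      eapply Rle_trans; [apply Cmod_sub_le|]. lra. }
    assert (P := Cmod_det_perturb (df z - df c) (df w - df c) (z - c) (w - c) (v z - v c) (v w - v c) (2 * e)
      (Dz z Az) (Dz w Aw)). lra. }
  set (q := fun z => (df z - df c) / (z - c)).
  assert (M0 : 0 <= M) by (unfold M; lra).
  assert (Q' : forall z w, z <> c -> w <> c -> Cmod (z - c) <= 1 -> Cmod (w - c) <= 1 ->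
    Cmod (q z - q w) <= 2 * M * (Cmod (z - c) + Cmod (w - c))).
  { intros z w Nz Nw Hz Hw. specialize (Q z w Hz Hw).
    assert (Dz := Csub_neq_0 _ _ Nz). assert (Dw := Csub_neq_0 _ _ Nw).
    assert (Pz := proj1 (Cmod_gt_0 _) Dz). assert (Pw := proj1 (Cmod_gt_0 _) Dw).
    assert (Pzw : 0 < Cmod (z - c) * Cmod (w - c)) by (apply Rmult_lt_0_compat; auto).
    replace ((df z - df c) * (w - c) - (df w - df c) * (z - c))
      with ((q z - q w) * ((z - c) * (w - c))) in Q by (unfold q; field; auto).
    rewrite !Cmod_mult in Q. apply Rmult_le_reg_r with (Cmod (z - c) * Cmod (w - c))%R; auto. }
  (* Completeness is available for sequences: the limit is found along one sequence tending to [c],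
     and [Q'] extends it to all nearby z. *)
  set (u := fun n : nat => c + RtoC (/ INR (S n))).
  assert (Un : forall n, u n <> c /\ Cmod (u n - c) = (/ INR (S n))%R).
  { intros n. assert (P : 0 < / INR (S n)) by (apply Rinv_0_lt_compat, lt_0_INR; lia).
    assert (E : Cmod (u n - c) = (/ INR (S n))%R).
    { unfold u. replace (c + RtoC (/ INR (S n)) - c) with (RtoC (/ INR (S n))) by ring.
      rewrite Cmod_R, Rabs_pos_eq; lra. }
    split; auto. intros Ec. rewrite Ec, Cmod_self_sub in E. lra. }
  assert (U1 : forall n, Cmod (u n - c) <= 1).
  { intros n. rewrite (proj2 (Un n)). rewrite <- Rinv_1. apply Rinv_le_contravar; [lra|].
    rewrite S_INR. generalize (pos_INR n). lra. }
  assert (Small : forall eps, 0 < eps -> exists N, forall n, (N <= n)%nat -> Cmod (u n - c) < eps).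
  { intros eps He. destruct (archimed_cor1 eps He) as [N [HN1 HN2]]. exists N. intros n Hn.
    rewrite (proj2 (Un n)). eapply Rle_lt_trans; [|exact HN1].
    apply Rinv_le_contravar; [apply lt_0_INR; lia|]. apply le_INR. lia. }
  destruct (C_complete (fun n => q (u n))) as [l Hl].
  { intros eps He. assert (P : 0 < eps / (4 * M + 1)) by (apply Rdiv_lt_0_compat; lra).
    destruct (Small _ P) as [N HN]. exists N. intros m n Hm Hn.
    eapply Rle_lt_trans; [apply Q'; [apply Un|apply Un|apply U1|apply U1]|].
    assert (A := HN m Hm). assert (A' := HN n Hn).
    set (x := (eps / (4 * M + 1))%R) in *.
    assert (Ex : ((4 * M + 1) * x = eps)%R) by (unfold x; field; lra). nra. }
  assert (Lq : forall z, z <> c -> Cmod (z - c) <= 1 -> Cmod (q z - l) <= 2 * M * Cmod (z - c)).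
  { intros z Nz Hz. apply le_limit with (K := (2 * M + 1)%R); [lra|]. intros e Pe.
    destruct (Hl e Pe) as [N1 HN1]. destruct (Small e Pe) as [N2 HN2].
    set (n := Nat.max N1 N2). specialize (HN1 n ltac:(lia)). specialize (HN2 n ltac:(lia)).
    eapply Rle_trans; [apply (Cmod_sub_triangle _ (q (u n)))|].
    assert (A := Q' z (u n) Nz (proj1 (Un n)) Hz (U1 n)). nra. }
  exists l. intros eps He. assert (P : 0 < eps / (2 * M + 1)) by (apply Rdiv_lt_0_compat; lra).
  exists (Rmin 1 (eps / (2 * M + 1)))%R. split; [apply Rmin_pos; lra|].
  intros h Hsm. assert (h1 := Rlt_le_trans _ _ _ Hsm (Rmin_l _ _)). assert (h2 := Rlt_le_trans _ _ _ Hsm (Rmin_r _ _)).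
  destruct (classic (h = 0)) as [->|Nh].
  { rewrite Cplus_0_r. replace (df c - df c - l * 0) with (RtoC 0) by ring. rewrite Cmod_0. lra. }
  assert (Nz : c + h <> c).
  { intros E. apply Nh. replace h with (c + h - c) by ring. rewrite E. ring. }
  assert (Ez : c + h - c = h) by ring.
  specialize (Lq (c + h) Nz). rewrite Ez in Lq. specialize (Lq ltac:(lra)).
  replace (df (c + h) - df c - l * h) with ((q (c + h) - l) * h).
  2:{ unfold q. rewrite Ez. field. auto. }
  rewrite Cmod_mult. apply Rmult_le_compat_r; [apply Cmod_ge_0|].
  eapply Rle_trans; [exact Lq|].
  set (x := (eps / (2 * M + 1))%R) in *.
  assert (Ex : ((2 * M + 1) * x = eps)%R) by (unfold x; field; lra).
  generalize (Cmod_ge_0 h). nra.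
Qed.

(** * Factoring out finitely many zeros *)

Lemma holo_factor_point (f : C -> C) (c : C) :
  holo f -> exists k, holo k /\ forall z, f z = f c + (z - c) * k z.
Proof.
  intros [df Hf]. destruct (holo_divide f df c Hf (holo_deriv f df Hf)) as [k [Hk [_ E]]].
  exists k. auto.
Qed.

(* If all divisions by [z - c] went through, the maximum principle on a large circle
   would bound [|f z0|] by [B / 2^n] for every [n]. *)
Lemma zero_finite_order (f : C -> C) (c z0 : C) :
  holo f -> f z0 <> 0 ->
  exists n k, holo k /\ k c <> 0 /\ forall z, f z = (z - c) ^ n * k z.
Proof.
  intros Hf Nz. apply NNPP. intros N. apply Nz. clear Nz.
  assert (A : forall n, exists k, holo k /\ forall z, f z = (z - c) ^ n * k z).
  { induction n as [|n [k [Hk E]]].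
    - exists f. split; auto. intros z. simpl. ring.
    - assert (Kc : k c = 0).
      { apply NNPP. intros Nk. apply N. exists n, k. auto. }
      destruct (holo_factor_point k c Hk) as [k' [Hk' E']]. exists k'. split; auto.
      intros z. rewrite E, E', Kc. simpl. ring. }
  assert (Hc := holo_ccont f Hf).
  set (s := Cmod (z0 - c)). assert (Hs : 0 <= s) by apply Cmod_ge_0.
  (* Since s < r/2, each factor z - c gains at least 1/2 at z0 against the circle of radius r. *)
  set (r := (2 * s + 1)%R). assert (Hr : 0 < r) by (unfold r; lra).
  destruct (ccont_bounded f (Cmod c + r) Hc) as [B [B0 HB]].
  assert (L : forall n, Cmod (f z0) <= B * (/ 2) ^ n).
  { intros n. destruct (A n) as [k [Hk E]].
    assert (P : 0 < r ^ n) by (apply pow_lt; auto).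
    assert (Kb : Cmod (k z0) <= B / r ^ n).
    { apply (holo_max_modulus k c r); auto; [|fold s; unfold r; lra].
      intros z Hz. assert (F := HB z (disc_norm_bound _ _ _ (Req_le _ _ Hz))).
      rewrite E, Cmod_mult, Cmod_pow, Hz in F.
      apply Rmult_le_reg_l with (r ^ n)%R; auto.
      replace (r ^ n * (B / r ^ n))%R with B by (field; lra). exact F. }
    rewrite E, Cmod_mult, Cmod_pow. fold s.
    apply Rle_trans with ((r / 2) ^ n * (B / r ^ n))%R.
    - apply Rmult_le_compat; auto; [apply pow_le; auto|apply Cmod_ge_0|].
      apply pow_incr. split; auto. unfold r. lra.
    - right. unfold Rdiv at 1. rewrite Rpow_mult_distr. field. lra. }
  apply Cmod_eq_0, Rle_antisym; [|apply Cmod_ge_0].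
  apply le_epsilon. intros eps He. rewrite Rplus_0_l.
  assert (P : 0 < eps / (B + 1)) by (apply Rdiv_lt_0_compat; lra).
  destruct (pow_lt_1_zero (/ 2) ltac:(rewrite Rabs_pos_eq; lra) _ P) as [n Hn].
  specialize (Hn n (le_n n)). rewrite Rabs_pos_eq in Hn by (left; apply pow_lt; lra).
  eapply Rle_trans; [apply (L n)|].
  set (x := (eps / (B + 1))%R) in *.
  assert (Ex : ((B + 1) * x = eps)%R) by (unfold x; field; lra). nra.
Qed.

(** * Polynomials given by their roots, and their logarithmic derivatives *)

Definition root_prod (l : list C) (z : C) : C := fold_right (fun c p => (z - c) * p) 1 l.

(** For P = [root_prod l] this is P'/P, with repeated entries for multiple roots. It is meaningful
    only off the roots, hence the condition [~ In z l] in later statements. *)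
Definition log_deriv (l : list C) (z : C) : C := fold_right (fun c s => / (z - c) + s) 0 l.

Lemma root_prod_repeat (c : C) (n : nat) (l : list C) (z : C) :
  root_prod (repeat c n ++ l) z = (z - c) ^ n * root_prod l z.
Proof.
  induction n; simpl; [ring|]. unfold root_prod in *. rewrite IHn. ring.
Qed.

(** [L] only has to contain the zeros. Dividing out the full order at its head, which may be 0,
    leaves a function that is nonzero there and has all its zeros in the tail; this is why the
    induction ranges over all functions. *)
Lemma finite_zeros_factor (L : list C) : forall f : C -> C,
  holo f -> (exists z, f z <> 0) -> (forall z, f z = 0 -> In z L) ->
  exists l h, holo h /\ (forall z, h z <> 0) /\ forall z, f z = root_prod l z * h z.
Proof.
  induction L as [|c L IH]; intros f Hf [z0 Hz0] HL.
  - exists nil, f. split; [exact Hf|]. split; [exact HL|]. intros z. unfold root_prod; simpl. ring.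
  - destruct (zero_finite_order f c z0 Hf Hz0) as [n [k [Hk [Kc E]]]].
    destruct (IH k Hk) as [l [h [Hh [Nh E']]]].
    + exists c. auto.
    + intros z Hz. destruct (HL z) as [->|I]; auto.
      * rewrite E, Hz. ring.
      * contradiction.
    + exists (repeat c n ++ l), h. split; auto. split; auto.
      intros z. rewrite root_prod_repeat, E, E'. ring.
Qed.

Lemma deriv_zero_const (f : C -> C) : entire_with f (fun _ => 0) -> forall z w, f z = f w.
Proof.
  intros H z w. assert (B : Cmod (f z - f w) <= 0 * Cmod (z - w)).
  { apply mean_value_bound with (df := fun _ => RtoC 0); intros t _; [apply H|].
    rewrite Cmod_0. lra. }
  assert (E : f z - f w = 0) by (apply Cmod_eq_0; generalize (Cmod_ge_0 (f z - f w)); lra).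
  replace (f z) with (f z - f w + f w) by ring. rewrite E. ring.
Qed.

(** A primitive of h'/h, which is entire because h' is. The normalisation [g 0 = 0] puts 0 into the
    zero set of Re g, so that this set is not empty, and removes the constant term once g is shown
    to be linear. *)
Lemma zero_free_log (h : C -> C) :
  holo h -> (forall z, h z <> 0) ->
  exists g, holo g /\ g 0 = 0 /\ forall z, h z = h 0 * Cexp (g z).
Proof.
  intros [dh Hh] Nh. destruct (holo_deriv h dh Hh) as [ddh Hdh].
  destruct (holo_primitive (fun z => dh z / h z)) as [G HG].
  { eexists. intros z. apply has_cderiv_div; auto. }
  set (g := fun z => G z - G 0).
  assert (Hg : entire_with g (fun z => dh z / h z)).
  { intros z. replace (dh z / h z) with (dh z / h z - 0) by ring.
    apply has_cderiv_minus; [apply HG|apply has_cderiv_const]. }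
  assert (g0 : g 0 = 0) by (unfold g; ring).
  exists g. split; [eexists; exact Hg|]. split; [exact g0|]. intros z.
  assert (E := deriv_zero_const (fun w => h w * Cexp (- g w))).
  assert (D : entire_with (fun w => h w * Cexp (- g w)) (fun _ => 0)).
  { intros w. replace (RtoC 0) with (dh w * Cexp (- g w) + h w * (Cexp (- g w) * - (dh w / h w))) by (field; auto).
    apply (has_cderiv_mult h (fun w => Cexp (- g w))); [apply Hh|].
    apply (has_cderiv_comp Cexp (fun w => - g w)); [apply has_cderiv_Cexp|].
    apply has_cderiv_opp, Hg. }
  specialize (E D z 0). simpl in E. rewrite g0 in E.
  replace (- 0) with (RtoC 0) in E by ring. rewrite Cexp_0, Cmult_1_r in E.
  rewrite <- E, <- Cmult_assoc, <- Cexp_plus.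
  replace (- g z + g z) with (RtoC 0) by ring. rewrite Cexp_0. ring.
Qed.

Lemma has_cderiv_root_prod (l : list C) (z : C) :
  ~ In z l -> has_cderiv (root_prod l) z (root_prod l z * log_deriv l z).
Proof.
  induction l as [|c l IH]; intros H.
  - unfold root_prod, log_deriv; simpl. replace (1 * 0) with (RtoC 0) by ring. apply has_cderiv_const.
  - assert (Nc : z - c <> 0) by (apply Csub_neq_0; intros ->; apply H; simpl; auto).
    simpl. replace ((z - c) * root_prod l z * (/ (z - c) + log_deriv l z))
      with ((1 - 0) * root_prod l z + (z - c) * (root_prod l z * log_deriv l z)) by (field; auto).
    apply (has_cderiv_mult (fun w => w - c) (root_prod l)).
    + apply has_cderiv_minus; [apply has_cderiv_id|apply has_cderiv_const].
    + apply IH. intros I. apply H. simpl; auto.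
Qed.

Lemma list_norm_bound (l : list C) : exists rho, 0 <= rho /\ forall c, In c l -> Cmod c <= rho.
Proof.
  induction l as [|c l [rho [P H]]].
  - exists 0%R. split; [lra|]. intros c [].
  - exists (Rmax (Cmod c) rho). split.
    + eapply Rle_trans; [exact P|apply Rmax_r].
    + intros x [<-|I]; [apply Rmax_l|]. eapply Rle_trans; [apply H; auto|apply Rmax_r].
Qed.

(** The threshold 3 rho + 3 serves throughout as the meaning of far from all roots. It leaves |z -
    c| >= 2 rho + 3, which also makes |c / (z - c)| at most 1/2. *)
Lemma far_root_dist (l : list C) (rho : R) (z : C) :
  0 <= rho -> (forall c, In c l -> Cmod c <= rho) -> 3 * rho + 3 <= Cmod z ->
  forall c, In c l -> Cmod z / 2 <= Cmod (z - c) /\ 1 <= Cmod (z - c).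
Proof.
  intros Hr Hl Hz c I. assert (B := Hl c I). assert (T := Cmod_sub_ge z c). lra.
Qed.

Lemma far_not_root (l : list C) (rho : R) (z : C) :
  0 <= rho -> (forall c, In c l -> Cmod c <= rho) -> 3 * rho + 3 <= Cmod z -> ~ In z l.
Proof.
  intros Hr Hl Hz I. destruct (far_root_dist l rho z Hr Hl Hz z I) as [_ H].
  rewrite Cmod_self_sub in H. lra.
Qed.

Lemma root_prod_far_ge_1 (l : list C) (rho : R) (z : C) :
  0 <= rho -> (forall c, In c l -> Cmod c <= rho) -> 3 * rho + 3 <= Cmod z ->
  1 <= Cmod (root_prod l z).
Proof.
  intros Hr. induction l as [|c l IH]; intros Hl Hz.
  - simpl. rewrite Cmod_1. lra.
  - simpl. rewrite Cmod_mult.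
    destruct (far_root_dist (c :: l) rho z Hr Hl Hz c (or_introl eq_refl)) as [_ H].
    specialize (IH (fun x I => Hl x (or_intror I)) Hz). fold (root_prod l z).
    replace 1%R with (1 * 1)%R by ring. apply Rmult_le_compat; lra.
Qed.

Lemma root_prod_far_le (l : list C) (rho : R) (z : C) :
  0 <= rho -> (forall c, In c l -> Cmod c <= rho) -> 3 * rho + 3 <= Cmod z ->
  Cmod (root_prod l z) <= (2 * Cmod z) ^ length l.
Proof.
  intros Hr. induction l as [|c l IH]; intros Hl Hz.
  - simpl. rewrite Cmod_1. lra.
  - simpl. rewrite Cmod_mult.
    assert (B := Hl c (or_introl eq_refl)). assert (T := Cmod_sub_le z c).
    specialize (IH (fun x I => Hl x (or_intror I)) Hz). fold (root_prod l z).
    apply Rmult_le_compat; try apply Cmod_ge_0; lra.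
Qed.

Lemma log_deriv_far (l : list C) (rho : R) (z : C) :
  0 <= rho -> (forall c, In c l -> Cmod c <= rho) -> 3 * rho + 3 <= Cmod z ->
  Cmod (log_deriv l z) <= 2 * INR (length l) / Cmod z.
Proof.
  intros Hr. induction l as [|c l IH]; intros Hl Hz.
  - simpl. rewrite Cmod_0. right. field. lra.
  - destruct (far_root_dist (c :: l) rho z Hr Hl Hz c (or_introl eq_refl)) as [H _].
    specialize (IH (fun x I => Hl x (or_intror I)) Hz).
    change (log_deriv (c :: l) z) with (/ (z - c) + log_deriv l z).
    change (length (c :: l)) with (S (length l)). rewrite S_INR.
    eapply Rle_trans; [apply Cmod_triangle|].
    assert (N : z - c <> 0) by (apply Cmod_gt_0; lra).
    rewrite Cmod_inv by auto.
    assert (Q : / Cmod (z - c) <= / (Cmod z / 2)) by (apply Rinv_le_contravar; lra).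
    replace (/ (Cmod z / 2))%R with (2 * 1 / Cmod z)%R in Q by (field; lra).
    replace (2 * (INR (length l) + 1) / Cmod z)%R
      with (2 * 1 / Cmod z + 2 * INR (length l) / Cmod z)%R by (field; lra). lra.
Qed.

(* [z * log_deriv l z] tends to [length l] at infinity. *)
Lemma log_deriv_far_neq_0 (l : list C) (rho : R) (z : C) :
  0 <= rho -> (forall c, In c l -> Cmod c <= rho) -> 3 * rho + 3 <= Cmod z ->
  log_deriv l z = 0 -> l = nil.
Proof.
  intros Hr Hl Hz H0.
  (* Each summand z/(z - c) = 1 + c/(z - c) has real part at least 1/2. *)
  assert (A : forall l, (forall c, In c l -> Cmod c <= rho) ->
    INR (length l) <= 2 * Re (z * log_deriv l z)).
  { clear l Hl H0. induction l as [|c l IH]; intros Hl.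
    - simpl. lra.
    - destruct (far_root_dist (c :: l) rho z Hr Hl Hz c (or_introl eq_refl)) as [H _].
      specialize (IH (fun x I => Hl x (or_intror I))).
      change (log_deriv (c :: l) z) with (/ (z - c) + log_deriv l z).
      change (length (c :: l)) with (S (length l)). rewrite S_INR.
      assert (N : z - c <> 0) by (apply Cmod_gt_0; lra).
      replace (z * (/ (z - c) + log_deriv l z)) with (1 + c / (z - c) + z * log_deriv l z) by (field; auto).
      rewrite !re_plus. change (Re 1) with 1%R.
      assert (X : Cmod (c / (z - c)) <= / 2).
      { rewrite Cmod_div by auto. assert (B := Hl c (or_introl eq_refl)).
        assert (T := Cmod_sub_ge z c).
        apply Rmult_le_reg_r with (Cmod (z - c)); [lra|].
        unfold Rdiv. rewrite Rmult_assoc, Rinv_l by lra. lra. }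
      assert (Y := re_bounds (c / (z - c))). lra. }
  specialize (A l Hl). rewrite H0 in A. replace (z * 0) with (RtoC 0) in A by ring.
  change (Re (RtoC 0)) with 0%R in A.
  destruct l as [|c l]; auto. change (length (c :: l)) with (S (length l)) in A.
  rewrite S_INR in A. generalize (pos_INR (length l)). lra.
Qed.

(** * Estimates for the real part of an entire function *)

(** The quotient need not be entire, so the principle for a single disc is used. Its second
    derivative exists because p' and q' are differentiable. The product form of the bound suits the
    Möbius quotients used below. *)
Lemma max_modulus_quotient (p q : C -> C) (c : C) (r M : R) :
  holo p -> holo q -> 0 < r ->
  (forall z, Cmod (z - c) <= r -> q z <> 0) ->
  (forall z, Cmod (z - c) = r -> Cmod (p z) <= M * Cmod (q z)) ->
  forall z, Cmod (z - c) <= r -> Cmod (p z) <= M * Cmod (q z).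
Proof.
  intros [dp Hp] [dq Hq] Hr Nq HM z Hz.
  destruct (holo_deriv p dp Hp) as [ddp Hdp]. destruct (holo_deriv q dq Hq) as [ddq Hdq].
  set (k1 := fun z => (dp z * q z - p z * dq z) / (q z * q z)).
  assert (D : forall w, Cmod (w - c) <= r -> has_cderiv (fun z => p z / q z) w (k1 w)).
  { intros w Hw. apply has_cderiv_div; auto. }
  assert (B : Cmod (p z / q z) <= M).
  { apply (max_modulus (fun z => p z / q z) k1 c r); auto.
    - intros w Hw. apply D. lra.
    - intros w Hw. assert (N : q w <> 0) by (apply Nq; lra). eexists.
      apply (has_cderiv_div (fun z => dp z * q z - p z * dq z) (fun z => q z * q z)).
      + apply has_cderiv_minus; apply has_cderiv_mult; auto.
      + apply has_cderiv_mult; auto.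
      + apply Cmult_neq_0; auto.
    - intros w Hw. eapply has_cderiv_ccont. apply D; auto.
    - intros w Hw. assert (N : q w <> 0) by (apply Nq; lra). specialize (HM w Hw).
      assert (P := proj1 (Cmod_gt_0 _) N). rewrite Cmod_div by auto.
      apply Rmult_le_reg_r with (Cmod (q w)); auto.
      unfold Rdiv. rewrite Rmult_assoc, Rinv_l by lra. lra. }
  assert (N : q z <> 0) by (apply Nq; lra). assert (P := proj1 (Cmod_gt_0 _) N).
  rewrite Cmod_div in B by auto. apply Rmult_le_compat_r with (r := Cmod (q z)) in B; [|lra].
  unfold Rdiv in B. rewrite Rmult_assoc, Rinv_l in B by lra. lra.
Qed.

Lemma sqr_le_reg (x y : R) : 0 <= y -> x * x <= y * y -> x <= y.
Proof. intros. nra. Qed.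

Lemma Re_pos_neq_0 (z : C) : 0 < Re z -> z <> 0.
Proof. intros H ->. simpl in H. lra. Qed.

(* Schwarz's lemma for [(g - g z1) / (g + conj (g z1))], which maps the disc into the unit disc. *)
Lemma hopf (g dg : C -> C) (z1 w : C) (rho : R) :
  entire_with g dg -> 0 < rho -> Cmod (w - z1) = rho -> Re (g w) = 0%R -> 0 < Re (g z1) ->
  (forall z, Cmod (z - z1) <= rho -> 0 <= Re (g z)) ->
  Re (g z1) <= 4 * rho * Cmod (dg w).
Proof.
  intros Hg Hrho Hw Zw Hu Hpos.
  assert (Hh : holo g) by (exists dg; auto).
  destruct (holo_factor_point g z1 Hh) as [k [Hk E]].
  set (u := Re (g z1)) in *.
  set (den := fun z => g z + Cconj (g z1)).
  assert (Id : forall z, (Cmod (den z) * Cmod (den z) - Cmod (g z - g z1) * Cmod (g z - g z1) = 4 * Re (g z) * u)%R).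
  { intros z. rewrite !Cmod_sqr_re_im. unfold den, u, Re, Im. simpl. ring. }
  assert (Dre : forall z, Re (den z) = (Re (g z) + u)%R) by reflexivity.
  assert (KB : forall z, Cmod (z - z1) <= rho -> Cmod (k z) <= / rho * Cmod (den z)).
  { apply max_modulus_quotient; auto.
    - exists (fun z => dg z + 0). intros z. apply has_cderiv_plus; [apply Hg|apply has_cderiv_const].
    - intros z Hz. apply Re_pos_neq_0. rewrite Dre. specialize (Hpos z Hz). lra.
    - intros z Hz. specialize (Hpos z (Req_le _ _ Hz)). specialize (Id z).
      replace (g z - g z1) with ((z - z1) * k z) in Id by (rewrite (E z); ring).
      rewrite Cmod_mult, Hz in Id.
      apply Rmult_le_reg_l with rho; auto. rewrite <- Rmult_assoc, Rinv_r, Rmult_1_l by lra.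
      apply sqr_le_reg; [apply Cmod_ge_0|]. nra. }
  apply le_limit with (K := (4 * rho)%R); [lra|]. intros e Pe.
  destruct (Hg w e Pe) as [d [Pd Hd]].
  set (t := Rmin 1 (d / (2 * rho))).
  assert (Pt : 0 < t) by (apply Rmin_pos; [lra|]; apply Rdiv_lt_0_compat; lra).
  assert (t1 : t <= 1) by apply Rmin_l.
  assert (t2 : t * rho < d).
  { apply Rle_lt_trans with (d / (2 * rho) * rho)%R.
    - apply Rmult_le_compat_r; [lra|apply Rmin_r].
    - replace (d / (2 * rho) * rho)%R with (d / 2)%R by (field; lra). lra. }
  clearbody t.
  (* A step from [w] towards the centre by the fraction t. There Schwarz's lemma has the factor 1 -
     t, which forces Re (g z) >= t u / 4, while differentiability at [w] gives Re (g z) <= (|dg w| +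
     e) t rho. Dividing by t compares the two. *)
  set (h := RtoC t * (z1 - w)).
  assert (Mh : Cmod h = (t * rho)%R).
  { unfold h. rewrite Cmod_mult, Cmod_R, Rabs_pos_eq, Cmod_sub_sym, Hw by lra. reflexivity. }
  set (z := w + h).
  assert (Mz : Cmod (z - z1) = ((1 - t) * rho)%R).
  { unfold z, h. replace (w + t * (z1 - w) - z1) with (RtoC (1 - t) * (w - z1)) by (rewrite RtoC_minus; ring).
    rewrite Cmod_mult, Cmod_R, Rabs_pos_eq, Hw by lra. reflexivity. }
  assert (Zd : Cmod (z - z1) <= rho) by (rewrite Mz; nra).
  assert (Pz := Hpos z Zd).
  assert (B1 : Cmod (g z - g z1) <= (1 - t) * Cmod (den z)).
  { replace (g z - g z1) with ((z - z1) * k z) by (rewrite (E z); ring).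
    rewrite Cmod_mult, Mz. specialize (KB z Zd).
    apply Rle_trans with ((1 - t) * rho * (/ rho * Cmod (den z)))%R.
    - apply Rmult_le_compat_l; auto. nra.
    - right. field. lra. }
  assert (B2 : Re (g z) <= (Cmod (dg w) + e) * (t * rho)).
  { specialize (Hd h ltac:(lra)). fold z in Hd. rewrite Mh in Hd.
    assert (T := Cmod_sub_ge (g z - g w) (dg w * h)). rewrite Cmod_mult, Mh in T.
    assert (X := re_bounds (g z - g w)). change (Re (g z - g w)) with (Re (g z) - Re (g w))%R in X.
    rewrite Zw in X. lra. }
  assert (N : u <= Cmod (den z)).
  { assert (X := re_bounds (den z)). rewrite Dre in X. lra. }
  specialize (Id z).
  set (n := Cmod (den z)) in *. set (x := Cmod (g z - g z1)) in *.
  assert (X0 : 0 <= x) by apply Cmod_ge_0.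
  assert (Q1 : x * x <= (1 - t) * n * ((1 - t) * n)).
  { apply Rmult_le_compat; auto. }
  assert (Q2 : u * u * t <= n * n * t) by (apply Rmult_le_compat_r; nra).
  assert (Q3 : n * n * t <= n * n - x * x).
  { assert (0 <= n * n) by nra. assert (0 <= t * (1 - t)) by nra. nra. }
  assert (Q4 : u * t * u <= u * t * (4 * rho * Cmod (dg w) + 4 * rho * e)).
  { assert (u * Re (g z) <= u * ((Cmod (dg w) + e) * (t * rho))) by (apply Rmult_le_compat_l; lra). nra. }
  apply Rmult_le_reg_l in Q4; [lra|]. apply Rmult_lt_0_compat; lra.
Qed.

Lemma re_segment_continuous (g : C -> C) (a b : C) :
  (forall z, ccont g z) -> continuity (fun t : R => Re (g (a + t * (b - a)))).
Proof.
  intros H t eps He. destruct (H (a + t * (b - a)) eps He) as [d [Pd Hd]].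
  set (L := (Cmod (b - a) + 1)%R).
  assert (HL : 0 < L) by (unfold L; generalize (Cmod_ge_0 (b - a)); lra).
  exists (d / L)%R. split; [apply Rdiv_lt_0_compat; auto|].
  intros s [_ Hs]. simpl in Hs. unfold Rdist in Hs. simpl. unfold Rdist.
  eapply Rle_lt_trans; [|apply (Hd (a + s * (b - a)))].
  - apply (re_le_Cmod (g (a + s * (b - a)) - g (a + t * (b - a)))).
  - replace (a + s * (b - a) - (a + t * (b - a))) with (RtoC (s - t) * (b - a)) by (rewrite RtoC_minus; ring).
    rewrite Cmod_mult, Cmod_R. apply Rle_lt_trans with (Rabs (s - t) * L)%R.
    + apply Rmult_le_compat_l; [apply Rabs_pos|unfold L; lra].
    + apply Rmult_lt_compat_r with (r := L) in Hs; auto.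
      replace (d / L * L)%R with d in Hs by (field; lra). exact Hs.
Qed.

Lemma zero_set_open (g : C -> C) (z : C) :
  ccont g z -> Re (g z) <> 0%R ->
  exists d, 0 < d /\ forall w, Cmod (w - z) < d -> Re (g w) <> 0%R.
Proof.
  intros H N. destruct (H (Rabs (Re (g z))) (Rabs_pos_lt _ N)) as [d [Pd Hd]].
  exists d; split; auto. intros w Hw E. specialize (Hd w Hw).
  assert (X := re_le_Cmod (g w - g z)). change (Re (g w - g z)) with (Re (g w) - Re (g z))%R in X.
  rewrite E in X. rewrite Rminus_0_l, Rabs_Ropp in X. lra.
Qed.

(** [w] is the zero of Re g nearest to [z]; [w0] ensures that one exists. On the disc around [z]
    through [w] the real part is nonnegative, since a negative value would produce a nearer zero on
    a segment from [z]. So [hopf] applies at [w]. *)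
Lemma re_growth (g dg : C -> C) (z w0 : C) :
  entire_with g dg -> Re (g w0) = 0%R -> 0 < Re (g z) ->
  exists w, Re (g w) = 0%R /\ Cmod (w - z) <= Cmod (w0 - z) /\
    Re (g z) <= 4 * Cmod (w - z) * Cmod (dg w).
Proof.
  intros Hg Z0 Hz.
  assert (Hc : forall z, ccont g z) by (intros x; eapply has_cderiv_ccont; apply Hg).
  set (D := Cmod (w0 - z)).
  destruct (max_attained (fun w => Re (g w) = 0%R /\ Cmod (w - z) <= D) (fun w => (- Cmod (w - z))%R) (Cmod z + D) w0)
    as [w [[Zw Dw] Hmin]].
  - split; auto. unfold D. lra.
  - intros w [_ Hw]. apply disc_norm_bound; auto.
  - intros w Nw. destruct (Req_dec (Re (g w)) 0) as [E|N].
    + assert (F : D < Cmod (w - z)) by (apply Rnot_le_lt; intros F; apply Nw; auto).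
      exists (Cmod (w - z) - D)%R. split; [lra|]. intros v Hv [_ F'].
      assert (T := Cmod_sub_triangle w v z). rewrite (Cmod_sub_sym w v) in T. lra.
    + destruct (zero_set_open g w (Hc w) N) as [d [Pd Hd]]. exists d; split; auto.
      intros v Hv [F _]. apply (Hd v Hv F).
  - intros w _ eps He. exists eps. split; auto. intros v _ Hv.
    assert (T := Cmod_sub_triangle w v z). rewrite (Cmod_sub_sym w v) in T. lra.
  - exists w. split; [exact Zw|]. split; [exact Dw|].
    assert (Nwz : w <> z) by (intros ->; lra).
    apply hopf with (g := g); auto.
    + apply Cmod_sub_pos; auto.
    + intros z' Hz'. apply Rnot_lt_le. intros Neg.
      set (phi := fun t : R => Ropp (Re (g (z + t * (z' - z))))).
      destruct (IVT phi 0 1) as [t [Ht Et]].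
      * intros t. apply continuity_pt_opp. apply re_segment_continuous; auto.
      * lra.
      * unfold phi. replace (z + 0%R * (z' - z)) with z by ring. lra.
      * unfold phi. replace (z + 1%R * (z' - z)) with z' by ring. lra.
      * unfold phi in Et.
        assert (Lt1 : t < 1).
        { destruct (proj2 Ht) as [L|L]; auto. exfalso. rewrite L in Et.
          replace (z + 1%R * (z' - z)) with z' in Et by ring. lra. }
        assert (Dd : Cmod (z + t * (z' - z) - z) = (t * Cmod (z' - z))%R).
        { replace (z + t * (z' - z) - z) with (t * (z' - z)) by ring.
          rewrite Cmod_mult, Cmod_R, Rabs_pos_eq by lra. reflexivity. }
        assert (Pz' : 0 < Cmod (z' - z)) by (apply Cmod_sub_pos; intros ->; lra).
        assert (S : Cmod (z + t * (z' - z) - z) < Cmod (w - z)) by (rewrite Dd; nra).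
        specialize (Hmin (z + t * (z' - z))). cbv beta in Hmin.
        assert (C1 : Re (g (z + t * (z' - z))) = 0%R) by lra.
        assert (C2 : Cmod (z + t * (z' - z) - z) <= D) by lra.
        specialize (Hmin (conj C1 C2)). lra.
Qed.

(** Schwarz's lemma for (g - g c) / (2M - (g - g c)), which has modulus at most 1 because Re (g - g
    c) <= M. On the half disc x = |g z - g c| satisfies x <= (2M + x)/2, hence x <= 2M. *)
Lemma borel_caratheodory (g : C -> C) (c : C) (r M : R) :
  holo g -> 0 < r -> 0 < M ->
  (forall z, Cmod (z - c) <= r -> Re (g z - g c) <= M) ->
  forall z, Cmod (z - c) <= r / 2 -> Cmod (g z - g c) <= 2 * M.
Proof.
  intros Hh Hr HM HB z Hz.
  destruct (holo_factor_point g c Hh) as [k [Hk E]].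
  set (den := fun z => RtoC (2 * M) - (g z - g c)).
  assert (Id : forall z, (Cmod (den z) * Cmod (den z) - Cmod (g z - g c) * Cmod (g z - g c) = 4 * M * (M - Re (g z - g c)))%R).
  { intros w. rewrite !Cmod_sqr_re_im. unfold den, Re, Im. simpl. ring. }
  assert (KB : forall z, Cmod (z - c) <= r -> Cmod (k z) <= / r * Cmod (den z)).
  { apply max_modulus_quotient; auto.
    - destruct Hh as [dg Hg]. exists (fun z => 0 - (dg z - 0)). intros w.
      apply has_cderiv_minus; [apply has_cderiv_const|].
      apply has_cderiv_minus; [apply Hg|apply has_cderiv_const].
    - intros w Hw. apply Re_pos_neq_0. specialize (HB w Hw).
      change (Re (den w)) with (2 * M - Re (g w - g c))%R. lra.
    - intros w Hw. specialize (HB w (Req_le _ _ Hw)). specialize (Id w).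
      replace (g w - g c) with ((w - c) * k w) in Id by (rewrite (E w); ring).
      replace (g w - g c) with ((w - c) * k w) in HB by (rewrite (E w); ring).
      rewrite Cmod_mult, Hw in Id.
      apply Rmult_le_reg_l with r; auto. rewrite <- Rmult_assoc, Rinv_r, Rmult_1_l by lra.
      apply sqr_le_reg; [apply Cmod_ge_0|]. nra. }
  specialize (KB z ltac:(lra)).
  assert (T := Cmod_sub_le (RtoC (2 * M)) (g z - g c)). fold (den z) in T.
  rewrite Cmod_R, Rabs_pos_eq in T by lra.
  assert (X : Cmod (g z - g c) <= / 2 * Cmod (den z)).
  { replace (g z - g c) with ((z - c) * k z) by (rewrite (E z); ring). rewrite Cmod_mult.
    apply Rle_trans with (r / 2 * (/ r * Cmod (den z)))%R.
    - apply Rmult_le_compat; auto; apply Cmod_ge_0.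
    - right. field. lra. }
  lra.
Qed.

(** Cauchy's estimate, by the maximum principle: [df c] is the value at [c] of the divided
    difference. *)
Lemma deriv_circle_bound (f df : C -> C) (c : C) (r M : R) :
  entire_with f df -> 0 < r -> (forall z, Cmod (z - c) = r -> Cmod (f z - f c) <= M) ->
  Cmod (df c) * r <= M.
Proof.
  intros Hf Hr HM. destruct (holo_divide f df c Hf (holo_deriv f df Hf)) as [k [Hk [Kc E]]].
  rewrite <- Kc.
  assert (B : Cmod (k c) <= M / r).
  { apply (holo_max_modulus k c r); auto.
    - intros z Hz. specialize (HM z Hz).
      replace (f z - f c) with ((z - c) * k z) in HM by (rewrite (E z); ring).
      rewrite Cmod_mult, Hz in HM. apply Rmult_le_reg_l with r; auto.
      replace (r * (M / r))%R with M by (field; lra). exact HM.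
    - rewrite Cmod_self_sub. lra. }
  apply Rmult_le_compat_r with (r := r) in B; [|lra].
  replace (M / r * r)%R with M in B by (field; lra). exact B.
Qed.

(* The bound is [K |z|^(3/2)], stated without roots by way of [m = |z|^(1/2)]. *)
Lemma subquadratic_re_linear (g : C -> C) (K : R) :
  holo g -> g 0 = 0 -> 0 < K ->
  (forall m z, 1 <= m -> Cmod z <= m * m -> Re (g z) <= K * (m * m * m)) ->
  exists lam, forall z, g z = lam * z.
Proof.
  intros Hh g0 HK HB.
  destruct (holo_factor_point g 0 Hh) as [k1 [Hk1 E1]].
  destruct (holo_factor_point k1 0 Hk1) as [k2 [Hk2 E2]].
  exists (k1 0).
  (* Here g z = z (k1 0 + z k2 z). On the circle of radius m^2 / 2, Borel-Caratheodory gives |k2| =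
     O(1/m), and [m] may be taken as large as desired. *)
  assert (Z : forall z, k2 z = 0).
  { intros z. apply Cmod_eq_0, Rle_antisym; [|apply Cmod_ge_0].
    set (L := Cmod (k1 0)). assert (HL : 0 <= L) by apply Cmod_ge_0.
    apply le_limit with (K := (8 * K + 2 * L)%R); [lra|]. intros e Pe. rewrite Rplus_0_l.
    set (m := (1 + / e + 2 * Cmod z)%R).
    assert (Pie : 0 < / e) by (apply Rinv_0_lt_compat; auto).
    assert (Cz := Cmod_ge_0 z).
    assert (m1 : 1 <= m) by (unfold m; lra).
    assert (me : / m <= e).
    { rewrite <- (Rinv_inv e). apply Rinv_le_contravar; auto. unfold m; lra. }
    assert (mz : Cmod z <= m * m / 2).
    { assert (m <= m * m) by nra. unfold m in *. lra. }
    clearbody m.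
    apply Rle_trans with ((8 * K + 2 * L) * / m)%R; [|apply Rmult_le_compat_l; lra].
    apply (holo_max_modulus k2 0 (m * m / 2)); auto; [nra| |].
    2:{ replace (z - 0) with z by ring. exact mz. }
    intros w Hw. replace (w - 0) with w in Hw by ring.
    assert (G : Cmod (g w - g 0) <= 2 * (K * (m * m * m))).
    { apply borel_caratheodory with (r := (m * m)%R); auto; [nra| | |].
      - repeat apply Rmult_lt_0_compat; lra.
      - intros x Hx. rewrite g0. replace (g x - 0) with (g x) by ring. replace (x - 0) with x in Hx by ring.
        apply HB; auto.
      - replace (w - 0) with w by ring. lra. }
    replace (g w - g 0) with (w * (k1 0 + w * k2 w)) in G.
    2:{ rewrite (E1 w), (E2 w). ring. }
    rewrite Cmod_mult, Hw in G.
    assert (T := Cmod_sub_ge (w * k2 w) (- k1 0)). rewrite Cmod_opp in T. fold L in T.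
    replace (w * k2 w - - k1 0) with (k1 0 + w * k2 w) in T by ring.
    rewrite Cmod_mult, Hw in T.
    set (y := Cmod (k2 w)) in *. assert (Hy : 0 <= y) by apply Cmod_ge_0.
    assert (mm : 0 < m * m / 2) by nra.
    assert (G2 : m * m / 2 * (m * m / 2 * y - L) <= 2 * (K * (m * m * m))).
    { eapply Rle_trans; [|exact G]. apply Rmult_le_compat_l; lra. }
    apply Rmult_le_reg_l with (m * m * m * m / 4)%R; [assert (0 < m * m) by nra; nra|].
    replace (m * m * m * m / 4 * ((8 * K + 2 * L) * / m))%R with (m * m * m * (2 * K + L / 2))%R by (field; lra).
    assert (0 <= m * m * L) by (repeat apply Rmult_le_pos; lra).
    assert (m * m * L <= m * m * m * L) by nra.
    nra. }
  intros z. rewrite (E1 z), (E2 z), (Z z), g0. ring.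
Qed.

(** * Solving an equation close to an exponential one *)

(* Minimum modulus: [F / b - 1] is tiny at [z1] but not on the circle, so it vanishes inside. *)
Lemma approx_exp_solve (F : C -> C) (b A z1 : C) :
  holo F -> b <> 0 -> A <> 0 ->
  (forall z, Cmod (z - z1) * Cmod A <= / 6 ->
     Cmod (F z / b - Cexp (A * (z - z1))) <= / 100 * Cmod (Cexp (A * (z - z1)))) ->
  exists z, Cmod (z - z1) * Cmod A <= / 6 /\ F z = b.
Proof.
  intros HF Hb HA H. apply NNPP. intros N.
  assert (PA := proj1 (Cmod_gt_0 _) HA).
  set (r := (/ (6 * Cmod A))%R).
  assert (Hr : 0 < r) by (apply Rinv_0_lt_compat; lra).
  assert (Er : (r * Cmod A = / 6)%R) by (unfold r; field; lra).
  (* With w = A (z - z1) on the circle |w| = 1/6: |e^w - 1| >= 1/6 - 3/36 = 1/12 and |e^w| <= 3/2,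
     so |F/b - 1| >= 1/12 - 3/200 > 1/20. Without a zero of F/b - 1 this bound would carry over to
     the centre, where |F/b - 1| <= 1/100. *)
  assert (Q : Cmod 1 <= 20 * Cmod (F z1 / b - 1)).
  { apply (max_modulus_quotient (fun _ => RtoC 1) (fun z => F z / b - 1) z1 r).
    - exists (fun _ => RtoC 0). intros z. apply has_cderiv_const.
    - destruct HF as [dF HF]. exists (fun z => / b * dF z - 0). intros z.
      apply has_cderiv_minus; [|apply has_cderiv_const].
      apply has_cderiv_ext with (fun z => / b * F z); [intros; field; auto|].
      apply has_cderiv_scal, HF.
    - exact Hr.
    - intros z Hz E. apply N. exists z. split; [rewrite <- Er; apply Rmult_le_compat_r; lra|].
      replace (F z) with ((F z / b - 1 + 1) * b) by (field; auto). rewrite E. ring.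
    - intros z Hz. assert (Hz' : Cmod (z - z1) * Cmod A <= / 6) by (rewrite Hz; lra).
      specialize (H z Hz'). set (w := A * (z - z1)) in *.
      assert (Mw : Cmod w = (/ 6)%R) by (unfold w; rewrite Cmod_mult, Hz; lra).
      assert (B1 := Cexp_sub_1_bound w ltac:(lra)). assert (B2 := Cexp_sub_1_sub_bound w ltac:(lra)).
      rewrite Mw in B1, B2.
      assert (T1 := Cmod_sub_ge w (- (Cexp w - 1 - w))). rewrite Cmod_opp, Mw in T1.
      replace (w - - (Cexp w - 1 - w)) with (Cexp w - 1) in T1 by ring.
      assert (T2 := Cmod_triangle (Cexp w - 1) 1). replace (Cexp w - 1 + 1) with (Cexp w) in T2 by ring.
      rewrite Cmod_1 in T2 |- *.
      assert (T3 := Cmod_sub_ge (Cexp w - 1) (- (F z / b - Cexp w))). rewrite Cmod_opp in T3.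
      replace (Cexp w - 1 - - (F z / b - Cexp w)) with (F z / b - 1) in T3 by ring.
      lra.
    - rewrite Cmod_self_sub. lra. }
  specialize (H z1). rewrite Cmod_self_sub in H. specialize (H ltac:(lra)).
  replace (A * (z1 - z1)) with (RtoC 0) in H by ring. rewrite Cexp_0, Cmod_1 in H.
  rewrite Cmod_1 in Q. lra.
Qed.

Lemma product_near_1 (p q s : C) (d : R) :
  0 <= d <= / 1000 ->
  Cmod (p - 1) <= d -> Cmod (q - 1) <= 2 * d -> Cmod (s - 1) <= 3 * d ->
  Cmod (p * q * s - 1) <= / 100.
Proof.
  intros Hd Hp Hq Hs.
  assert (P1 := Cmod_ge_0 (p - 1)). assert (P2 := Cmod_ge_0 (q - 1)). assert (P3 := Cmod_ge_0 (s - 1)).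
  replace (p * q * s - 1) with ((p - 1) * (q * s) + ((q - 1) * s + (s - 1))) by ring.
  eapply Rle_trans; [apply Cmod_triangle|].
  eapply Rle_trans; [apply Rplus_le_compat_l, Cmod_triangle|].
  rewrite !Cmod_mult.
  assert (Q : Cmod q <= 11 / 10).
  { replace q with (q - 1 + 1) by ring. eapply Rle_trans; [apply Cmod_triangle|]. rewrite Cmod_1. lra. }
  assert (S : Cmod s <= 11 / 10).
  { replace s with (s - 1 + 1) by ring. eapply Rle_trans; [apply Cmod_triangle|]. rewrite Cmod_1. lra. }
  assert (Q0 := Cmod_ge_0 q). assert (S0 := Cmod_ge_0 s).
  assert (X1 : Cmod q * Cmod s <= 2) by nra.
  assert (X2 : Cmod (p - 1) * (Cmod q * Cmod s) <= / 1000 * 2) by (apply Rmult_le_compat; nra).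
  assert (X3 : Cmod (q - 1) * Cmod s <= / 500 * (11 / 10)) by (apply Rmult_le_compat; lra).
  lra.
Qed.

(** Near [z0] the hypotheses make F/b equal to B e^(A (z - z0)) up to a factor close to 1. If e^w =
    1/B, the recentring z1 = z0 + w/A turns this into e^(A (z - z1)). The shift costs |w| <= |ln
    |B|| + 4 in units of 1/|A|, and the disc of [approx_exp_solve] another 1/6; hence the summand
    5. *)
Lemma local_solution (F g dg : C -> C) (l : list C) (K b A z0 : C) (sigma : R) :
  holo F -> b <> 0 -> K <> 0 -> A <> 0 -> root_prod l z0 <> 0 ->
  (forall z, Cmod (z - z0) <= sigma ->
     F z = K * root_prod l z * (log_deriv l z + dg z) * Cexp (g z)) ->
  (forall z, Cmod (z - z0) <= sigma -> Cmod (g z - g z0 - A * (z - z0)) <= / 1000) ->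
  (forall z, Cmod (z - z0) <= sigma -> Cmod (dg z - A) <= / 1000 * Cmod A) ->
  (forall z, Cmod (z - z0) <= sigma -> Cmod (log_deriv l z) <= / 1000 * Cmod A) ->
  (forall z, Cmod (z - z0) <= sigma ->
     Cmod (root_prod l z - root_prod l z0) <= / 1000 * Cmod (root_prod l z0)) ->
  Rabs (ln (Cmod (K * root_prod l z0 * A * Cexp (g z0) / b))) + 5 <= sigma * Cmod A ->
  exists z, Cmod (z - z0) <= sigma /\ F z = b.
Proof.
  intros HF Hb HK HA HP HFz H1 H2 H3 H4 Hs.
  set (B := K * root_prod l z0 * A * Cexp (g z0) / b) in *.
  assert (NB : B <> 0).
  { unfold B, Cdiv. assert (Ne := Cexp_neq_0 (g z0)).
    repeat apply Cmult_neq_0; auto. intros E. apply C1_nz. rewrite <- (Cinv_r b Hb), E. ring. }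
  assert (PB := proj1 (Cmod_gt_0 _) NB). assert (PA := proj1 (Cmod_gt_0 _) HA).
  assert (NB' : / B <> 0).
  { intros E. apply C1_nz. rewrite <- (Cinv_r B NB), E. ring. }
  destruct (Cexp_log (/ B) NB') as [w [Ew Mw]].
  rewrite Cmod_inv in Mw by auto. rewrite ln_Rinv, Rabs_Ropp in Mw by auto.
  set (z1 := z0 + w / A).
  assert (Near : forall z, Cmod (z - z1) * Cmod A <= / 6 -> Cmod (z - z0) <= sigma).
  { intros z Hz. apply Rmult_le_reg_r with (Cmod A); auto.
    eapply Rle_trans; [|exact Hs]. rewrite <- Cmod_mult.
    replace ((z - z0) * A) with ((z - z1) * A + w) by (unfold z1; field; auto).
    eapply Rle_trans; [apply Cmod_triangle|]. rewrite Cmod_mult. lra. }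
  destruct (approx_exp_solve F b A z1 HF Hb HA) as [z [Hz Ez]].
  2:{ exists z. split; auto. }
  intros z Hz. assert (Nz := Near z Hz).
  specialize (HFz z Nz). specialize (H1 z Nz). specialize (H2 z Nz). specialize (H3 z Nz). specialize (H4 z Nz).
  set (e := Cexp (A * (z - z1))).
  set (p := root_prod l z / root_prod l z0). set (q := (log_deriv l z + dg z) / A).
  set (s := Cexp (g z - g z0 - A * (z - z0))).
  assert (E1 : F z / b = e * (p * q * s)).
  { assert (Eg : Cexp (g z) = Cexp (g z0) * s * (Cexp (A * (z - z1)) * Cexp w)).
    { unfold s. rewrite <- !Cexp_plus. f_equal. unfold z1. field. auto. }
    rewrite Ew in Eg. fold e in Eg. rewrite HFz, Eg. unfold p, q.
    replace (/ B) with (b / (K * root_prod l z0 * A * Cexp (g z0))).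
    2:{ unfold B. field. repeat split; auto. apply Cexp_neq_0. }
    field. repeat split; auto. apply Cexp_neq_0. }
  rewrite E1. replace (e * (p * q * s) - e) with ((p * q * s - 1) * e) by ring.
  rewrite Cmod_mult. apply Rmult_le_compat_r; [apply Cmod_ge_0|].
  assert (PP := proj1 (Cmod_gt_0 _) HP).
  apply product_near_1 with (d := (/ 1000)%R); [lra| | |].
  - unfold p. replace (root_prod l z / root_prod l z0 - 1) with ((root_prod l z - root_prod l z0) / root_prod l z0) by (field; auto).
    rewrite Cmod_div by auto. apply Rmult_le_reg_r with (Cmod (root_prod l z0)); auto.
    unfold Rdiv. rewrite Rmult_assoc, Rinv_l by lra. lra.
  - unfold q. replace ((log_deriv l z + dg z) / A - 1) with ((log_deriv l z + (dg z - A)) / A) by (field; auto).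
    rewrite Cmod_div by auto. apply Rmult_le_reg_r with (Cmod A); auto.
    unfold Rdiv. rewrite Rmult_assoc, Rinv_l by lra.
    assert (T := Cmod_triangle (log_deriv l z) (dg z - A)). lra.
  - unfold s. eapply Rle_trans; [apply Cexp_sub_1_bound; lra|]. lra.
Qed.

(** Each factor changes by a relative amount of at most [x]; the condition 2nx <= 1 absorbs the
    second-order terms in the induction. *)
Lemma root_prod_near (l : list C) (z z0 : C) (x : R) :
  0 <= x -> (forall c, In c l -> Cmod (z - z0) <= x * Cmod (z0 - c)) ->
  2 * INR (length l) * x <= 1 ->
  Cmod (root_prod l z - root_prod l z0) <= 2 * INR (length l) * x * Cmod (root_prod l z0).
Proof.
  intros Hx. induction l as [|c l IH]; intros H Hn.
  - simpl. rewrite Cmod_self_sub. lra.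
  - change (root_prod (c :: l) z) with ((z - c) * root_prod l z).
    change (root_prod (c :: l) z0) with ((z0 - c) * root_prod l z0).
    change (length (c :: l)) with (S (length l)) in *. rewrite S_INR in *.
    set (n := INR (length l)) in *. assert (Hn0 : 0 <= n) by apply pos_INR.
    assert (Hnx : 2 * n * x <= 1) by lra.
    specialize (IH (fun c I => H c (or_intror I)) Hnx).
    specialize (H c (or_introl eq_refl)).
    replace ((z - c) * root_prod l z - (z0 - c) * root_prod l z0)
      with ((z0 - c) * (root_prod l z - root_prod l z0)
            + ((z - z0) * root_prod l z0 + (z - z0) * (root_prod l z - root_prod l z0))) by ring.
    eapply Rle_trans; [apply Cmod_triangle|].
    eapply Rle_trans; [apply Rplus_le_compat_l, Cmod_triangle|].
    rewrite !Cmod_mult.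
    set (D := Cmod (root_prod l z - root_prod l z0)) in *. set (P := Cmod (root_prod l z0)) in *.
    set (u := Cmod (z - z0)) in *. set (v := Cmod (z0 - c)) in *.
    assert (D0 : 0 <= D) by apply Cmod_ge_0. assert (P0 : 0 <= P) by apply Cmod_ge_0.
    assert (u0 : 0 <= u) by apply Cmod_ge_0. assert (v0 : 0 <= v) by apply Cmod_ge_0.
    assert (X1 : v * D <= v * (2 * n * x * P)) by (apply Rmult_le_compat_l; auto).
    assert (X2 : u * P <= x * v * P) by (apply Rmult_le_compat_r; auto).
    assert (X3 : u * D <= x * v * (2 * n * x * P)) by (apply Rmult_le_compat; auto).
    assert (X4 : x * v * (2 * n * x * P) <= x * v * P).
    { apply Rmult_le_compat_l; [nra|]. nra. }
    nra.
Qed.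

(** Writing |g'| as y^8 turns the comparison of log |g'| with fractional powers of |g'| into one of
    integer powers of y. *)
Lemma eighth_root (a : R) : 1 <= a -> exists y, 1 <= y /\ (y ^ 8 = a)%R.
Proof.
  intros Ha. exists (exp (ln a / 8)). split.
  - assert (L : 0 <= ln a) by (rewrite <- ln_1; destruct Ha as [H|<-]; [left; apply ln_increasing; lra|lra]).
    generalize (exp_ineq1_le (ln a / 8)). lra.
  - simpl. rewrite Rmult_1_r, <- !exp_plus.
    match goal with |- exp ?s = _ => replace s with (ln a) by field end.
    apply exp_ln. lra.
Qed.

Lemma ln_le_self (y : R) : 0 < y -> ln y <= y.
Proof. intros H. generalize (exp_ineq1_le (ln y)). rewrite exp_ln by auto. lra. Qed.

(** [X] stands for |P(z0) g'(z0)| with |g'(z0)| = y^8 and |2 z0| <= 4 y^16. The crude ln y <= y is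
    affordable, since the square of the result is only compared with y^4. *)
Lemma log_size_bound (kappa : R) (n : nat) :
  0 < kappa -> exists c, 1 <= c /\ forall y X, 1 <= y -> 1 <= X -> X <= (4 * y ^ 16) ^ n * y ^ 8 ->
    Rabs (ln (kappa * X)) + 5 <= c * y.
Proof.
  intros Hk. exists (Rabs (ln kappa) + 19 * INR n + 13)%R.
  assert (N0 := pos_INR n). assert (A0 := Rabs_pos (ln kappa)).
  split; [lra|]. intros y X Hy HX1 HX2.
  assert (L0 : 0 <= ln X) by (rewrite <- ln_1; destruct HX1 as [H|<-]; [left; apply ln_increasing; lra|lra]).
  assert (P16 : 0 < y ^ 16) by (apply pow_lt; lra). assert (P8 : 0 < y ^ 8) by (apply pow_lt; lra).
  assert (PP : 0 < (4 * y ^ 16) ^ n) by (apply pow_lt; lra).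
  assert (LX : ln X <= ln ((4 * y ^ 16) ^ n * y ^ 8)).
  { destruct HX2 as [H|<-]; [left; apply ln_increasing; lra|lra]. }
  rewrite ln_mult, !ln_pow, ln_mult, ln_pow in LX by lra.
  assert (Ly := ln_le_self y ltac:(lra)).
  assert (L4 : ln 4 <= 3).
  { generalize (exp_ineq1_le (ln 4)). rewrite exp_ln by lra. lra. }
  replace (INR 16) with 16%R in LX by (simpl; ring). replace (INR 8) with 8%R in LX by (simpl; ring).
  assert (Q : INR n * (ln 4 + 16 * ln y) <= INR n * (19 * y)) by (apply Rmult_le_compat_l; lra).
  rewrite ln_mult by lra.
  assert (T := Rabs_triang (ln kappa) (ln X)). rewrite (Rabs_pos_eq (ln X)) in T by auto.
  assert (Rabs (ln kappa) * 1 <= Rabs (ln kappa) * y) by (apply Rmult_le_compat_l; auto).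
  lra.
Qed.

(** * The exponent grows subquadratically *)

(** The radius shrinks from s/2 to s/16. On the disc of radius s/4, [re_growth] gives Re g <= 4as;
    on s/8, Borel-Caratheodory gives |g - g z0| <= 8as; on s/16, Cauchy's estimate gives |g'| <=
    256a. Schwarz's lemma for g' then has the constant 512 * 16 = 8192. *)
Lemma deriv_nearly_constant (g dg : C -> C) (z0 : C) (a s : R) :
  entire_with g dg -> 0 < a -> 0 < s -> Re (g z0) = 0%R ->
  (forall w, Re (g w) = 0%R -> Cmod (w - z0) <= s / 2 -> Cmod (dg w) <= 4 * a) ->
  forall z, Cmod (z - z0) <= s / 16 -> Cmod (dg z - dg z0) * s <= 8192 * a * Cmod (z - z0).
Proof.
  intros Hg Ha Hs H0 HZ.
  assert (Hh : holo g) by (exists dg; auto).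
  assert (U : forall z, Cmod (z - z0) <= s / 4 -> Re (g z - g z0) <= 4 * a * s).
  { intros z Hz. change (Re (g z - g z0)) with (Re (g z) - Re (g z0))%R. rewrite H0, Rminus_0_r.
    destruct (Rle_lt_dec (Re (g z)) 0) as [N|P]; [assert (0 < a * s) by (apply Rmult_lt_0_compat; auto); nra|].
    destruct (re_growth g dg z z0 Hg H0 P) as [w [Zw [Dw Gw]]].
    rewrite (Cmod_sub_sym z0 z) in Dw.
    assert (T := Cmod_sub_triangle w z z0). specialize (HZ w Zw ltac:(lra)).
    eapply Rle_trans; [exact Gw|].
    apply Rle_trans with (4 * (s / 4) * (4 * a))%R; [|lra].
    apply Rmult_le_compat; try apply Cmod_ge_0; [|lra|lra].
    generalize (Cmod_ge_0 (w - z)). lra. }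
  assert (As : 0 < 4 * a * s) by (repeat apply Rmult_lt_0_compat; lra).
  assert (B : forall z, Cmod (z - z0) <= s / 8 -> Cmod (g z - g z0) <= 8 * a * s).
  { intros z Hz. replace (8 * a * s)%R with (2 * (4 * a * s))%R by ring.
    apply borel_caratheodory with (r := (s / 4)%R); auto; lra. }
  assert (D : forall z, Cmod (z - z0) <= s / 16 -> Cmod (dg z) <= 256 * a).
  { intros z Hz. assert (Q : Cmod (dg z) * (s / 16) <= 16 * a * s).
    { apply deriv_circle_bound with (f := g); auto; [lra|]. intros w Hw.
      assert (T := Cmod_sub_triangle w z z0).
      assert (B1 := B w ltac:(lra)). assert (B2 := B z ltac:(lra)).
      replace (g w - g z) with ((g w - g z0) - (g z - g z0)) by ring.
      eapply Rle_trans; [apply Cmod_sub_le|]. lra. }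
    apply Rmult_le_reg_r with (s / 16)%R; lra. }
  intros z Hz.
  assert (S : Cmod (dg z - dg z0) * (s / 16) <= 512 * a * Cmod (z - z0)).
  { apply schwarz; auto; [eapply holo_deriv; exact Hg|lra|]. intros w Hw.
    eapply Rle_trans; [apply Cmod_sub_le|].
    assert (B1 := D w (Req_le _ _ Hw)). assert (B2 := D z0). rewrite Cmod_self_sub in B2.
    specialize (B2 ltac:(lra)). lra. }
  lra.
Qed.

(* A maximum of [|g'(w)| (1 - |w - zs|)^2] over the zeros of [Re g] in the unit disc around [zs]. *)
Lemma point_picking (g dg : C -> C) (zs : C) :
  entire_with g dg -> Re (g zs) = 0%R -> 0 < Cmod (dg zs) ->
  exists z0 s, Re (g z0) = 0%R /\ Cmod (z0 - zs) <= 1 /\ 0 < s <= 1 /\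
    Cmod (dg zs) <= Cmod (dg z0) * (s * s) /\
    forall w, Re (g w) = 0%R -> Cmod (w - z0) <= s / 2 -> Cmod (dg w) <= 4 * Cmod (dg z0).
Proof.
  intros Hg Z Pz.
  assert (Hc : forall z, ccont g z) by (intros x; eapply has_cderiv_ccont; apply Hg).
  assert (Hdc := holo_ccont dg (holo_deriv g dg Hg)).
  destruct (max_attained (fun w => Re (g w) = 0%R /\ Cmod (w - zs) <= 1)
    (fun w => (Cmod (dg w) * ((1 - Cmod (w - zs)%C) * (1 - Cmod (w - zs)%C)))%R) (Cmod zs + 1) zs)
    as [z0 [[Z0 D0] Hmax]].
  - split; auto. rewrite Cmod_self_sub. lra.
  - intros w [_ Hw]. apply disc_norm_bound; auto.
  - intros w Nw. destruct (Req_dec (Re (g w)) 0) as [E|N].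
    + assert (F : 1 < Cmod (w - zs)) by (apply Rnot_le_lt; intros F; apply Nw; auto).
      exists (Cmod (w - zs) - 1)%R. split; [lra|]. intros v Hv [_ F'].
      assert (T := Cmod_sub_triangle w v zs). rewrite (Cmod_sub_sym w v) in T. lra.
    + destruct (zero_set_open g w (Hc w) N) as [d [Pd Hd]]. exists d; split; auto.
      intros v Hv [F _]. apply (Hd v Hv F).
  - intros z [_ Dz] eps He.
    destruct (Hdc z (eps / 2)%R ltac:(lra)) as [d [Pd Hd]].
    set (M := Cmod (dg z)). assert (M0 : 0 <= M) by apply Cmod_ge_0.
    set (e := (eps / (4 * (M + 1)))%R).
    assert (Pe : 0 < e) by (apply Rdiv_lt_0_compat; lra).
    assert (Ee : (4 * (M + 1) * e = eps)%R) by (unfold e; field; lra). clearbody e.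
    exists (Rmin d e). split; [apply Rmin_pos; auto|].
    intros w [_ Dw] Hw.
    assert (w1 := Rlt_le_trans _ _ _ Hw (Rmin_l _ _)). assert (w2 := Rlt_le_trans _ _ _ Hw (Rmin_r _ _)).
    specialize (Hd w w1). assert (T := Cmod_sub_ge (dg w) (dg z)). fold M in T |- *.
    assert (T2 := Cmod_sub_triangle z w zs). rewrite (Cmod_sub_sym z w) in T2.
    assert (W0 := Cmod_ge_0 (w - zs)). assert (Z1 := Cmod_ge_0 (z - zs)).
    set (p := Cmod (w - zs)) in *. set (q := Cmod (z - zs)) in *. set (u := Cmod (dg w)) in *.
    assert (V : 0 <= (1 - p) * (1 - p) <= 1) by nra.
    assert (V2 : (1 - p) * (1 - p) <= (1 - q) * (1 - q) + 2 * e).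
    { assert (X : (1 - p) <= (1 - q) + e) by lra.
      destruct (Rle_dec (1 - p) (1 - q)); nra. }
    apply Rle_trans with ((M + eps / 2) * ((1 - p) * (1 - p)))%R; [apply Rmult_le_compat_r; lra|].
    assert (M * ((1 - p) * (1 - p)) <= M * ((1 - q) * (1 - q) + 2 * e)) by (apply Rmult_le_compat_l; auto).
    nra.
  - exists z0, (1 - Cmod (z0 - zs))%R.
    set (s := (1 - Cmod (z0 - zs))%R) in *.
    assert (M1 := Hmax zs). rewrite Cmod_self_sub in M1. specialize (M1 (conj Z Rle_0_1)).
    replace (Cmod (dg zs) * ((1 - 0) * (1 - 0)))%R with (Cmod (dg zs)) in M1 by ring.
    assert (G := Cmod_ge_0 (z0 - zs)). assert (A0 := Cmod_ge_0 (dg z0)).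
    assert (s0 : 0 <= s) by (unfold s; lra).
    assert (sp : 0 < s).
    { destruct s0 as [|E]; auto. rewrite <- E in M1. lra. }
    split; auto. split; auto. split; [split; [auto|unfold s; lra]|]. split; [exact M1|].
    intros w Zw Dw. assert (T := Cmod_sub_triangle w z0 zs).
    (* Within s/2 of [z0] the weight is still at least (s/2)^2, a quarter of its value at [z0]; this
       is the source of the factor 4. *)
    assert (Q : s / 2 <= 1 - Cmod (w - zs)) by (unfold s in *; lra).
    assert (Q1 : Cmod (w - zs) <= 1) by lra.
    specialize (Hmax w (conj Zw Q1)). cbv beta in Hmax. fold s in Hmax.
    set (v := (1 - Cmod (w - zs))%R) in *.
    assert (A1 := Cmod_ge_0 (dg w)).
    assert (S4 : s / 2 * (s / 2) <= v * v) by nra.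
    assert (X : Cmod (dg w) * (s / 2 * (s / 2)) <= Cmod (dg z0) * (s * s)).
    { eapply Rle_trans; [|exact Hmax]. apply Rmult_le_compat_l; auto. }
    apply Rmult_le_reg_r with (s / 2 * (s / 2))%R; [nra|]. lra.
Qed.

(** [gam] stands for b - a, and the last hypothesis is what remains of f' = b implying f = b. If the
    bound fails at [zs], the picked point satisfies |z0| = O(|A|^2) with A = g'(z0); since |e^(g
    z0)| = 1, the logarithm in [local_solution] is O(log |A|). The solution found there has |P'/P +
    g'| >= |A|/2, more than the hypothesis permits. *)
Lemma zero_set_deriv_bound (F g dg : C -> C) (l : list C) (K b gam : C) :
  holo F -> entire_with g dg -> K <> 0 -> b <> 0 ->
  (forall z, ~ In z l -> F z = K * root_prod l z * (log_deriv l z + dg z) * Cexp (g z)) ->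
  (forall z, ~ In z l -> F z = b -> gam * (log_deriv l z + dg z) = b) ->
  exists C0, 1 <= C0 /\ forall w m, Re (g w) = 0%R -> 1 <= m -> Cmod w <= m * m -> Cmod (dg w) <= C0 * m.
Proof.
  intros HF Hg HK Hb HFz Hsol.
  destruct (list_norm_bound l) as [rho [Rho Hl]].
  set (n := length l). assert (N0 := pos_INR n).
  assert (PK := proj1 (Cmod_gt_0 _) HK). assert (Pb := proj1 (Cmod_gt_0 _) Hb).
  set (kap := (Cmod K / Cmod b)%R).
  assert (Pkap : 0 < kap) by (apply Rdiv_lt_0_compat; auto).
  destruct (log_size_bound kap n Pkap) as [c [c1 Hlog]].
  (* The summand 4 pays for moving from [zs] to [z0] and on to the solution; 4000 n keeps the
     relative change of [root_prod] over a unit distance below 1/1000. *)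
  set (R0 := (3 * rho + 3 + 4 + 4000 * INR n)%R).
  assert (Hdc := holo_ccont dg (holo_deriv g dg Hg)).
  destruct (ccont_bounded dg R0 Hdc) as [B0 [PB0 HB0]].
  set (D := (8192000 * c * c)%R). assert (D1 : 1 <= D) by (unfold D; nra).
  set (E := (2 * Cmod b / Cmod gam)%R).
  assert (E0 : gam <> 0 -> 0 <= E).
  { intros Ng. apply Rmult_le_pos; [lra|]. left. apply Rinv_0_lt_compat, Cmod_gt_0; auto. }
  (* [B0] disposes of [zs] near the roots, [D ^ 4] forces y^2 >= D below, 2000 makes P'/P negligible
     against g', and [E] is the size that g' cannot exceed at a solution. The maximum with 0 guards
     the case [gam = 0], not yet excluded, where [E] is a division by zero. *)
  set (C0 := (B0 + D ^ 4 + 2000 + Rmax 0 E)%R).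
  assert (DD : 0 < D ^ 4) by (apply pow_lt; lra).
  assert (ME := Rmax_l 0 E). assert (ME' := Rmax_r 0 E).
  exists C0. split; [unfold C0; lra|].
  intros zs m Zs Hm Hzs. apply Rnot_lt_le. intros Big.
  assert (Cm : C0 <= C0 * m) by (assert (0 <= C0) by (unfold C0; lra); nra).
  assert (Far : R0 < Cmod zs).
  { apply Rnot_le_lt. intros Near. specialize (HB0 zs Near). unfold C0 in *. lra. }
  destruct (point_picking g dg zs Hg Zs) as [z0 [s [Z0 [Dz [[s0 s1] [As2 HZ]]]]]]; [unfold C0 in *; lra|].
  set (A := dg z0) in *. set (a := Cmod A) in *.
  assert (a0 : 0 <= a) by apply Cmod_ge_0.
  assert (ss : s * s <= 1) by nra.
  assert (aC : C0 * m <= a).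
  { assert (a * (s * s) <= a * 1) by (apply Rmult_le_compat_l; auto). lra. }
  assert (a1 : 2000 <= a) by (unfold C0 in *; lra).
  assert (am : m <= a).
  { assert (1 <= C0) by (unfold C0; lra). nra. }
  assert (NA : A <> 0) by (apply Cmod_gt_0; fold a; lra).
  destruct (eighth_root a ltac:(lra)) as [y [y1 Ey]].
  assert (Tz1 := Cmod_sub_ge zs z0). rewrite Cmod_sub_sym in Tz1.
  assert (Tz2 := Cmod_sub_ge z0 zs).
  assert (Fz0 : 3 * rho + 3 <= Cmod z0) by (unfold R0 in *; lra).
  assert (Pge := root_prod_far_ge_1 l rho z0 Rho Hl Fz0).
  assert (Ple := root_prod_far_le l rho z0 Rho Hl Fz0). fold n in Ple.
  set (P0 := Cmod (root_prod l z0)) in *.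
  assert (z0a : 2 * Cmod z0 <= 4 * y ^ 16).
  { replace (y ^ 16)%R with (a * a)%R by (rewrite <- Ey; ring).
    assert (m * m <= a * a) by (apply Rmult_le_compat; lra).
    assert (1 <= m * m) by nra. lra. }
  assert (X1 : 1 <= P0 * a) by nra.
  assert (X2 : P0 * a <= (4 * y ^ 16) ^ n * y ^ 8).
  { rewrite Ey. apply Rmult_le_compat_r; auto. eapply Rle_trans; [exact Ple|].
    apply pow_incr. split; auto. generalize (Cmod_ge_0 z0). lra. }
  assert (HL := Hlog y (P0 * a)%R y1 X1 X2).
  set (Lam := (Rabs (ln (kap * (P0 * a))) + 5)%R) in *.
  assert (Lam5 : 5 <= Lam) by (unfold Lam; generalize (Rabs_pos (ln (kap * (P0 * a)))); lra).
  (* From a s^2 >= 1 follows (a s)^2 >= a = y^8, hence a s >= y^4, whereas Lam^2 <= c^2 y^2 and y^2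
     >= D. The constant 8192000 = 8192 * 1000 turns the bound of [deriv_nearly_constant] into errors
     of 1/1000. *)
  assert (Key : 8192000 * Lam * Lam <= a * s).
  { assert (q1 : y ^ 4 <= a * s).
    { apply sqr_le_reg; [apply Rmult_le_pos; lra|].
      replace (y ^ 4 * y ^ 4)%R with (y ^ 8)%R by ring. rewrite Ey.
      assert (1 <= a * (s * s)) by (unfold C0 in *; lra).
      replace (a * s * (a * s))%R with (a * (a * (s * s)))%R by ring. nra. }
    assert (q2 : D <= y * y).
    { apply Rnot_lt_le. intros L.
      assert (Q : (y * y) ^ 4 < D ^ 4).
      { assert (0 < y * y) by nra.
        assert (u1 : (y * y) * (y * y) < D * D) by (apply Rmult_le_0_lt_compat; lra).
        replace ((y * y) ^ 4)%R with ((y * y) * (y * y) * ((y * y) * (y * y)))%R by ring.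
        replace (D ^ 4)%R with (D * D * (D * D))%R by ring.
        apply Rmult_le_0_lt_compat; try apply Rmult_le_pos; lra. }
      replace ((y * y) ^ 4)%R with (y ^ 8)%R in Q by ring. rewrite Ey in Q. unfold C0 in *. lra. }
    assert (q3 : Lam * Lam <= c * y * (c * y)) by (apply Rmult_le_compat; lra).
    assert (q4 : D * (y * y) <= y * y * (y * y)) by (apply Rmult_le_compat_r; nra).
    unfold D in q4. replace (y ^ 4)%R with (y * y * (y * y))%R in q1 by ring. nra. }
  assert (HLam : Rabs (ln (kap * (P0 * a))) + 5 <= Lam) by (unfold Lam; lra).
  clearbody Lam.
  set (sigma := (Lam / a)%R).
  assert (Sa : (sigma * a = Lam)%R) by (unfold sigma; field; lra).
  assert (S0 : 0 <= sigma) by (unfold sigma; apply Rlt_le, Rdiv_lt_0_compat; lra).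
  clearbody sigma.
  assert (S16 : sigma <= s / 16).
  { apply Rmult_le_reg_r with a; [lra|]. rewrite Sa. nra. }
  assert (Dlin : forall z, Cmod (z - z0) <= sigma -> Cmod (dg z - A) * s <= 8192 * Lam).
  { intros z Hz. eapply Rle_trans; [apply (deriv_nearly_constant g dg z0 a s); auto; lra|].
    rewrite <- Sa. rewrite Rmult_assoc. apply Rmult_le_compat_l; [lra|]. nra. }
  assert (Zf : forall z, Cmod (z - z0) <= sigma -> 3 * rho + 3 <= Cmod z /\ 4000 * INR n + 1 <= Cmod z).
  { intros z Hz. assert (T := Cmod_sub_ge z0 z). rewrite (Cmod_sub_sym z0 z) in T. unfold R0 in *. lra. }
  destruct (local_solution F g dg l K b A z0 sigma) as [z [Hz Ez]]; auto.
  - apply Cmod_gt_0. fold P0. lra.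
  - intros z Hz. apply HFz. apply (far_not_root l rho); auto. apply (Zf z Hz).
  - intros z Hz. apply Rmult_le_reg_r with s; auto.
    replace (g z - g z0 - A * (z - z0)) with ((g z - A * z) - (g z0 - A * z0)) by ring.
    apply Rle_trans with (8192 * Lam / s * sigma * s)%R.
    + apply Rmult_le_compat_r; [lra|].
      apply Rle_trans with (8192 * Lam / s * Cmod (z - z0))%R.
      * apply (mean_value_bound (fun z => g z - A * z) (fun z => dg z - A)); intros t Ht.
        -- assert (DD' : has_cderiv (fun z => g z - A * z) (z0 + t * (z - z0)) (dg (z0 + t * (z - z0)) - A * 1)).
           { apply has_cderiv_minus; [apply Hg|apply has_cderiv_scal, has_cderiv_id]. }
           replace (A * 1) with A in DD' by ring. exact DD'.
        -- apply Rmult_le_reg_r with s; auto.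
           replace (8192 * Lam / s * s)%R with (8192 * Lam)%R by (field; lra).
           apply Dlin. eapply Rle_trans; [apply Cmod_segment_dist; auto|exact Hz].
      * apply Rmult_le_compat_l; auto. apply Rmult_le_pos; [lra|]. left; apply Rinv_0_lt_compat; auto.
    + replace (8192 * Lam / s * sigma * s)%R with (8192 * Lam * sigma)%R by (field; lra).
      apply Rmult_le_reg_r with a; [lra|]. replace (8192 * Lam * sigma * a)%R with (8192 * Lam * Lam)%R by (rewrite <- Sa; ring).
      lra.
  - intros z Hz. apply Rmult_le_reg_r with s; auto. fold a. specialize (Dlin z Hz). nra.
  - intros z Hz. destruct (Zf z Hz) as [F1 F2].
    eapply Rle_trans; [apply (log_deriv_far l rho z Rho Hl F1)|]. fold n a.
    apply Rle_trans with 1%R; [|lra].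
    apply Rmult_le_reg_r with (Cmod z); [lra|]. unfold Rdiv. rewrite Rmult_assoc, Rinv_l by lra. lra.
  - intros z Hz. assert (Pz0 : 4000 * INR n + 1 <= Cmod z0) by (unfold R0 in *; lra).
    assert (Nx : 2 * INR (length l) * (2 / Cmod z0) <= / 1000).
    { fold n. apply Rmult_le_reg_r with (Cmod z0); [lra|].
      replace (2 * INR n * (2 / Cmod z0) * Cmod z0)%R with (4 * INR n)%R by (field; lra). lra. }
    eapply Rle_trans.
    + apply root_prod_near with (x := (2 / Cmod z0)%R); [| |lra].
      * apply Rlt_le, Rdiv_lt_0_compat; lra.
      * intros x Hx. destruct (far_root_dist l rho z0 Rho Hl Fz0 x Hx) as [Q _].
        apply Rle_trans with 1%R; [lra|].
        apply Rle_trans with (2 / Cmod z0 * (Cmod z0 / 2))%R; [right; field; lra|].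
        apply Rmult_le_compat_l; auto. apply Rlt_le, Rdiv_lt_0_compat; lra.
    + apply Rmult_le_compat_r; [apply Cmod_ge_0|exact Nx].
  - fold a. rewrite Sa.
    replace (Cmod (K * root_prod l z0 * A * Cexp (g z0) / b)) with (kap * (P0 * a))%R.
    2:{ rewrite Cmod_div by auto. rewrite !Cmod_mult, Cmod_Cexp, Z0, exp_0. fold P0 a. unfold kap. field. lra. }
    exact HLam.
  - assert (F1 := proj1 (Zf z Hz)). assert (F2 := proj2 (Zf z Hz)).
    assert (Nz := far_not_root l rho z Rho Hl F1).
    specialize (Hsol z Nz Ez).
    assert (L1 : Cmod (log_deriv l z) <= 1).
    { eapply Rle_trans; [apply (log_deriv_far l rho z Rho Hl F1)|]. fold n.
      apply Rmult_le_reg_r with (Cmod z); [lra|]. unfold Rdiv. rewrite Rmult_assoc, Rinv_l by lra. lra. }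
    assert (L2 : Cmod (dg z - A) <= / 1000 * a).
    { apply Rmult_le_reg_r with s; auto. specialize (Dlin z Hz). nra. }
    assert (T := Cmod_sub_ge A (- (log_deriv l z + (dg z - A)))). rewrite Cmod_opp in T. fold a in T.
    replace (A - - (log_deriv l z + (dg z - A))) with (log_deriv l z + dg z) in T by ring.
    assert (T2 := Cmod_triangle (log_deriv l z) (dg z - A)).
    assert (Ng : gam <> 0).
    { intros ->. apply Hb. rewrite <- Hsol. ring. }
    assert (Pg := proj1 (Cmod_gt_0 _) Ng).
    assert (Q : Cmod gam * (a / 2) <= Cmod b).
    { rewrite <- Hsol, Cmod_mult. apply Rmult_le_compat_l; lra. }
    assert (Ea : a <= E).
    { unfold E. apply Rmult_le_reg_l with (Cmod gam); auto.
      replace (Cmod gam * (2 * Cmod b / Cmod gam))%R with (2 * Cmod b)%R by (field; lra). lra. }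
    unfold C0 in *. nra.
Qed.

(** * Linear exponents *)

(** On the line where lam z is imaginary the exponential has modulus 1. From a point of that line
    with |z0| = y^8, only the polynomial factor and constants have to be compensated, at the cost of
    a distance O(y); the solution therefore stays beyond y^8 / 2. *)
Lemma linear_exponent_solutions (F : C -> C) (l : list C) (K b lam : C) (R1 : R) :
  holo F -> K <> 0 -> b <> 0 -> lam <> 0 ->
  (forall z, ~ In z l -> F z = K * root_prod l z * (log_deriv l z + lam) * Cexp (lam * z)) ->
  exists z, R1 <= Cmod z /\ F z = b.
Proof.
  intros HF HK Hb Hlam HFz.
  destruct (list_norm_bound l) as [rho [Rho Hl]].
  set (n := length l). assert (N0 := pos_INR n).
  assert (PK := proj1 (Cmod_gt_0 _) HK). assert (Pb := proj1 (Cmod_gt_0 _) Hb).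
  assert (Pl := proj1 (Cmod_gt_0 _) Hlam). set (L := Cmod lam) in *.
  set (kap := (Cmod K * L / Cmod b)%R).
  assert (Pkap : 0 < kap) by (apply Rdiv_lt_0_compat; auto; apply Rmult_lt_0_compat; auto).
  destruct (log_size_bound kap n Pkap) as [c [c1 Hlog]].
  (* Chosen so that y >= q gives 4000 (n + 1) sigma = q y <= y^8 = |z0| for the radius sigma = c y /
     L. *)
  set (q := (4000 * (INR n + 1) * c / L)%R).
  assert (Pq : 0 < q) by (unfold q; apply Rdiv_lt_0_compat; auto; nra).
  assert (Eq : (q * L = 4000 * (INR n + 1) * c)%R) by (unfold q; field; lra).
  clearbody q.
  set (y := (1 + q + 2 * Rabs R1 + 2 * (3 * rho + 3))%R).
  assert (R1p := Rabs_pos R1).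
  assert (y1 : 1 <= y) by (unfold y; lra). assert (yq : q <= y) by (unfold y; lra).
  assert (yR : 2 * R1 <= y) by (unfold y; generalize (Rle_abs R1); lra).
  assert (yr : 2 * (3 * rho + 3) <= y) by (unfold y; lra).
  clearbody y.
  assert (y8 : y * y <= y ^ 8).
  { replace (y ^ 8)%R with (y * y * y ^ 6)%R by ring.
    assert (1 <= y ^ 6) by (apply pow_R1_Rle; auto). nra. }
  assert (yy : y <= y * y) by nra.
  set (z0 := Ci * RtoC (L * y ^ 8) / lam).
  assert (Mz0 : Cmod z0 = (y ^ 8)%R).
  { unfold z0. rewrite Cmod_div, Cmod_mult, Cmod_Ci, Cmod_R, Rabs_pos_eq by (auto; nra).
    fold L. field. lra. }
  assert (Ez0 : Re (lam * z0) = 0%R).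
  { unfold z0. replace (lam * (Ci * RtoC (L * y ^ 8) / lam)) with (Ci * RtoC (L * y ^ 8)) by (field; auto).
    unfold Re, Ci; simpl. ring. }
  assert (Fz0 : 3 * rho + 3 <= Cmod z0) by (rewrite Mz0; lra).
  assert (Pge := root_prod_far_ge_1 l rho z0 Rho Hl Fz0).
  assert (Ple := root_prod_far_le l rho z0 Rho Hl Fz0). fold n in Ple. rewrite Mz0 in Ple.
  set (P0 := Cmod (root_prod l z0)) in *.
  assert (X2 : P0 <= (4 * y ^ 16) ^ n * y ^ 8).
  { assert (A1 : (2 * y ^ 8) ^ n <= (4 * y ^ 16) ^ n).
    { apply pow_incr. replace (y ^ 16)%R with (y ^ 8 * y ^ 8)%R by ring. nra. }
    assert (A2 : 0 <= (4 * y ^ 16) ^ n) by (apply pow_le; assert (0 <= y ^ 16) by (apply pow_le; lra); lra).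
    nra. }
  assert (HL := Hlog y P0 y1 Pge X2).
  set (sigma := (c * y / L)%R).
  assert (Sa : (sigma * L = c * y)%R) by (unfold sigma; field; lra).
  assert (S0 : 0 <= sigma) by (unfold sigma; apply Rlt_le, Rdiv_lt_0_compat; auto; nra).
  clearbody sigma.
  assert (Sq : 4000 * (INR n + 1) * sigma <= y ^ 8).
  { assert (E : (4000 * (INR n + 1) * sigma = q * y)%R).
    { apply Rmult_eq_reg_r with L; [|lra].
      replace (4000 * (INR n + 1) * sigma * L)%R with (4000 * (INR n + 1) * (sigma * L))%R by ring.
      rewrite Sa. replace (q * y * L)%R with (q * L * y)%R by ring. rewrite Eq. ring. }
    rewrite E. nra. }
  assert (Sn : 0 <= INR n * sigma) by (apply Rmult_le_pos; auto).
  assert (nL : 4000 * INR n <= y ^ 8 * L).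
  { assert (INR n * 1 <= INR n * c) by (apply Rmult_le_compat_l; lra).
    assert (q * L <= y ^ 8 * L) by (apply Rmult_le_compat_r; lra). lra. }
  assert (Zf : forall z, Cmod (z - z0) <= sigma -> y ^ 8 / 2 <= Cmod z).
  { intros z Hz. assert (T := Cmod_sub_ge z0 z). rewrite (Cmod_sub_sym z0 z), Mz0 in T. lra. }
  assert (P8 : 1 <= y ^ 8) by (apply pow_R1_Rle; auto).
  destruct (local_solution F (fun z => lam * z) (fun _ => lam) l K b lam z0 sigma) as [z [Hz Ez]]; auto.
  - apply Cmod_gt_0. fold P0. lra.
  - intros z Hz. apply HFz. apply (far_not_root l rho); auto. specialize (Zf z Hz). lra.
  - intros z _. replace (lam * z - lam * z0 - lam * (z - z0)) with (RtoC 0) by ring. rewrite Cmod_0. lra.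
  - intros z _. rewrite Cmod_self_sub. fold L. lra.
  - intros z Hz. specialize (Zf z Hz).
    eapply Rle_trans; [apply (log_deriv_far l rho z Rho Hl); lra|]. fold n L.
    apply Rmult_le_reg_r with (Cmod z); [lra|].
    unfold Rdiv. rewrite Rmult_assoc, Rinv_l by lra.
    assert (L * (y ^ 8 / 2) <= L * Cmod z) by (apply Rmult_le_compat_l; lra). lra.
  - intros z Hz.
    assert (Nx : 2 * INR (length l) * (2 * sigma / y ^ 8) <= / 1000).
    { fold n. apply Rmult_le_reg_r with (y ^ 8)%R; [lra|].
      replace (2 * INR n * (2 * sigma / y ^ 8) * y ^ 8)%R with (4 * (INR n * sigma))%R by (field; lra). lra. }
    assert (Xp : 0 <= 2 * sigma / y ^ 8).
    { apply Rmult_le_pos; [lra|]. apply Rlt_le, Rinv_0_lt_compat. lra. }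
    eapply Rle_trans.
    + apply root_prod_near with (x := (2 * sigma / y ^ 8)%R); [exact Xp| |lra].
      intros x Hx. destruct (far_root_dist l rho z0 Rho Hl Fz0 x Hx) as [Q _]. rewrite Mz0 in Q.
      apply Rle_trans with (2 * sigma / y ^ 8 * (y ^ 8 / 2))%R; [|apply Rmult_le_compat_l; auto].
      replace (2 * sigma / y ^ 8 * (y ^ 8 / 2))%R with sigma by (field; lra). exact Hz.
    + apply Rmult_le_compat_r; [apply Cmod_ge_0|exact Nx].
  - fold L. rewrite Sa.
    replace (Cmod (K * root_prod l z0 * lam * Cexp (lam * z0) / b)) with (kap * P0)%R.
    2:{ rewrite Cmod_div by auto. rewrite !Cmod_mult, Cmod_Cexp, Ez0, exp_0. fold P0 L. unfold kap. field. lra. }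
    exact HL.
  - exists z. split; auto. specialize (Zf z Hz). lra.
Qed.

(* [sum_n] over [C_Ring] hides the type [C] from [ring]. *)
Ltac C_ring := match goal with |- ?x = ?y => change (@eq C x y) end; ring.

(** * Products of linear factors as polynomial functions *)

Definition poly_upto (f : C -> C) (N : nat) (c : nat -> C) : Prop :=
  (forall k, (N < k)%nat -> c k = 0) /\
  forall z, f z = sum_n (G := C_Ring) (fun k => c k * z ^ k) N.

Lemma sum_n_C_S (u : nat -> C) (n : nat) :
  sum_n (G := C_Ring) u (S n) = sum_n (G := C_Ring) u n + u (S n).
Proof. apply (sum_Sn (G := C_Ring)). Qed.

Lemma sum_n_C_0 (u : nat -> C) : sum_n (G := C_Ring) u 0 = u O.
Proof. apply (sum_O (G := C_Ring)). Qed.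

Lemma sum_n_shift (c : nat -> C) (z : C) (N : nat) :
  sum_n (G := C_Ring) (fun k => match k with O => 0 | S j => c j end * z ^ k) (S N)
  = z * sum_n (G := C_Ring) (fun k => c k * z ^ k) N.
Proof.
  induction N as [|N IH].
  - rewrite sum_n_C_S, !sum_n_C_0. simpl. C_ring.
  - rewrite sum_n_C_S, IH, (sum_n_C_S _ N). simpl. C_ring.
Qed.

Lemma sum_n_C_lin (u v : nat -> C) (p q z : C) (N : nat) :
  sum_n (G := C_Ring) (fun k => (p * u k + q * v k) * z ^ k) N
  = p * sum_n (G := C_Ring) (fun k => u k * z ^ k) N + q * sum_n (G := C_Ring) (fun k => v k * z ^ k) N.
Proof.
  induction N as [|N IH].
  - rewrite !sum_n_C_0. C_ring.
  - rewrite !sum_n_C_S, IH. C_ring.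
Qed.

Lemma root_prod_poly (l : list C) : exists N c, poly_upto (root_prod l) N c.
Proof.
  induction l as [|x l [N [c [H1 H2]]]].
  - exists O, (fun k => match k with O => RtoC 1 | _ => 0 end). split.
    + intros [|k] Hk; [lia|reflexivity].
    + intros z. rewrite sum_n_C_0. unfold root_prod; simpl. C_ring.
  - exists (S N), (fun k => 1 * match k with O => 0 | S j => c j end + (- x) * c k). split.
    + intros [|k] Hk; [lia|]. rewrite (H1 k), (H1 (S k)) by lia. C_ring.
    (* Multiplication by z - x raises the degree, so the old sum is extended by the term of index
       [S N]; its coefficient is 0, which is why [poly_upto] records the vanishing beyond [N]. *)
    + intros z. rewrite sum_n_C_lin, sum_n_shift, sum_n_C_S, <- H2, (H1 (S N)) by lia.
      change (root_prod (x :: l) z) with ((z - x) * root_prod l z). C_ring.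
Qed.

Lemma polynomial_affine_root_prod (f : C -> C) (l : list C) (a K : C) :
  (forall z, f z = a + K * root_prod l z) -> polynomial_function f.
Proof.
  intros E. destruct (root_prod_poly l) as [N [c [_ H2]]].
  exists N, (fun k => a * match k with O => RtoC 1 | _ => 0 end + K * c k).
  intros z. rewrite sum_n_C_lin, <- H2, E.
  replace (sum_n (G := C_Ring) (fun k => match k with O => RtoC 1 | S _ => 0 end * z ^ k) N) with (RtoC 1).
  - C_ring.
  - clear. induction N as [|N IH].
    + rewrite sum_n_C_0. simpl. C_ring.
    + rewrite sum_n_C_S, <- IH. C_ring.
Qed.

(** * The factorised form of f and the conclusion *)

Lemma finitely_often_form (f df : C -> C) (a : C) (L : list C) :
  entire_with f df -> (exists z, f z <> a) -> (forall z, f z = a -> In z L) ->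
  exists (l : list C) (K : C) (g dg : C -> C), K <> 0 /\ entire_with g dg /\ g 0 = 0 /\
    (forall z, f z = a + K * root_prod l z * Cexp (g z)) /\
    (forall z, ~ In z l -> df z = K * root_prod l z * (log_deriv l z + dg z) * Cexp (g z)).
Proof.
  intros Hf [z1 N1] HL.
  destruct (finite_zeros_factor L (fun z => f z - a)) as [l [h [Hh [Nh E]]]].
  - exists (fun z => df z - 0). intros z. apply has_cderiv_minus; [apply Hf|apply has_cderiv_const].
  - exists z1. apply Csub_neq_0. auto.
  - intros z Hz. apply HL. replace (f z) with (f z - a + a) by ring. rewrite Hz. ring.
  - destruct (zero_free_log h Hh Nh) as [g [[dg Hg] [g0 Eh]]].
    assert (F : forall z, f z = a + h 0 * root_prod l z * Cexp (g z)).
    { intros z. replace (f z) with (a + (f z - a)) by ring. rewrite E, (Eh z). ring. }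
    exists l, (h 0), g, dg. repeat split; auto.
    intros z Nz. apply (has_cderiv_unique f z); [apply Hf|].
    apply has_cderiv_ext with (fun w => a + h 0 * (root_prod l w * Cexp (g w))).
    { intros w. rewrite F. ring. }
    replace (h 0 * root_prod l z * (log_deriv l z + dg z) * Cexp (g z)) with
      (0 + h 0 * (root_prod l z * log_deriv l z * Cexp (g z) + root_prod l z * (Cexp (g z) * dg z))) by ring.
    apply has_cderiv_plus; [apply has_cderiv_const|]. apply has_cderiv_scal.
    apply (has_cderiv_mult (root_prod l) (fun w => Cexp (g w))).
    + apply has_cderiv_root_prod; auto.
    + apply (has_cderiv_comp Cexp g); [apply has_cderiv_Cexp|apply Hg].
Qed.

Lemma exponent_linear (g dg : C -> C) (C0 : R) :
  entire_with g dg -> g 0 = 0 -> 1 <= C0 ->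
  (forall w m, Re (g w) = 0%R -> 1 <= m -> Cmod w <= m * m -> Cmod (dg w) <= C0 * m) ->
  exists lam, forall z, g z = lam * z.
Proof.
  intros Hg g0 HC H. apply subquadratic_re_linear with (K := (8 * C0)%R); auto; [exists dg; auto|lra|].
  intros m z Hm Hz.
  assert (mm : 0 < m * m) by nra. assert (mmm : 0 < m * m * m) by nra.
  destruct (Rle_lt_dec (Re (g z)) 0) as [N|P]; [nra|].
  assert (Z0 : Re (g 0) = 0%R) by (rewrite g0; reflexivity).
  destruct (re_growth g dg z 0 Hg Z0 P) as [w [Zw [Dw Gw]]].
  replace (Cmod (0 - z)) with (Cmod z) in Dw by (rewrite Cmod_sub_sym; f_equal; ring).
  assert (T := Cmod_triangle (w - z) z). replace (w - z + z) with w in T by ring.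
  (* [w] is no farther from [z] than 0 is, so |w| <= 2|z| <= (2m)^2. This yields Re (g z) <= 4 m^2 *
     2 C0 m. *)
  assert (B := H w (2 * m)%R Zw ltac:(lra) ltac:(nra)).
  eapply Rle_trans; [exact Gw|].
  apply Rle_trans with (4 * (m * m) * (C0 * (2 * m)))%R; [|lra].
  apply Rmult_le_compat; [generalize (Cmod_ge_0 (w - z)); lra|apply Cmod_ge_0|lra|lra].
Qed.

Theorem theorem1p2 (f : C -> C) (a b : C)
  (hf : transcendental_entire f)
  (hb : b <> 0)
  (hfb : forall z : C, C_derive f z = b -> f z = b)
  (ha : taken_finitely_often f a) :
  a <> b /\
  (exists c : C, c <> 0 /\
     forall z : C, f z = c * Cexp (b / (b - a) * z) + a) /\
  picard_exceptional f a /\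
  (forall z0 : C, b_point (C_derive f) b z0 ->
     simple_b_point (C_derive f) b z0) /\
  shared_value f (C_derive f) b /\
  (a = 0 -> forall z : C, f z = C_derive f z).
Proof.
  destruct hf as [he hnp]. destruct ha as [L HL].
  set (df := C_derive f) in *.
  assert (Hf : entire_with f df).
  { intros z. apply is_derive_has_cderiv, C_derive_correct; [exact z|apply he]. }
  assert (Hdf := holo_deriv f df Hf).
  assert (Nc : exists z, f z <> a).
  { apply NNPP. intros N. apply hnp. apply polynomial_affine_root_prod with (l := nil) (a := a) (K := RtoC 0).
    intros z. replace (f z) with a; [unfold root_prod; simpl; ring|].
    symmetry. apply NNPP. intros Nz. apply N. exists z. exact Nz. }
  destruct (finitely_often_form f df a L Hf Nc HL) as [l [K [g [dg [HK [Hg [g0 [Ff Fd]]]]]]]].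
  assert (Hsol : forall z, ~ In z l -> df z = b -> (b - a) * (log_deriv l z + dg z) = b).
  { intros z Nz Ez. assert (E := hfb z Ez). rewrite <- Ez at 2. rewrite Fd by auto.
    rewrite <- E. rewrite Ff. ring. }
  destruct (zero_set_deriv_bound df g dg l K b (b - a) Hdf Hg HK hb Fd Hsol) as [C0 [HC0 HB]].
  destruct (exponent_linear g dg C0 Hg g0 HC0 HB) as [lam Elam].
  assert (Edg : forall z, dg z = lam).
  { intros z. apply (has_cderiv_unique g z); [apply Hg|].
    apply has_cderiv_ext with (fun w => lam * w); [auto|].
    assert (D := has_cderiv_scal lam _ z _ (has_cderiv_id z)).
    rewrite Cmult_1_r in D. exact D. }
  assert (Nlam : lam <> 0).
  { intros E. apply hnp. apply polynomial_affine_root_prod with (l := l) (a := a) (K := K).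
    intros z. rewrite Ff, Elam, E. replace (0 * z) with (RtoC 0) by ring. rewrite Cexp_0. ring. }
  destruct (list_norm_bound l) as [rho [Rho Hl]].
  assert (Sol : forall R1, 3 * rho + 3 <= R1 -> exists z, R1 <= Cmod z /\ (b - a) * (log_deriv l z + lam) = b).
  { intros R1 HR. destruct (linear_exponent_solutions df l K b lam R1) as [z [Hz Ez]]; auto.
    - intros z Nz. rewrite Fd, Edg, Elam by auto. reflexivity.
    - exists z. split; auto. rewrite <- (Edg z). apply Hsol; auto.
      apply (far_not_root l rho); auto. lra. }
  (* That f' takes the value b far out is what excludes a = b: for a = b the equation at such a
     point would read 0 = b. *)
  assert (Nba : b - a <> 0).
  { destruct (Sol _ (Rle_refl _)) as [z [_ E]]. intros N. apply hb. rewrite <- E, N. ring. }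
  assert (E1 : (b - a) * lam = b).
  { assert (Z : (b - a) * lam - b = 0).
    { apply Cmod_eq_0, Rle_antisym; [|apply Cmod_ge_0].
      set (n := INR (length l)). assert (N0 : 0 <= n) by apply pos_INR.
      assert (G0 := Cmod_ge_0 (b - a)).
      apply le_limit with (K := (Cmod (b - a) * (2 * n))%R); [apply Rmult_le_pos; lra|].
      intros e Pe. rewrite Rplus_0_l.
      assert (Pie : 0 < / e) by (apply Rinv_0_lt_compat; auto).
      destruct (Sol (3 * rho + 3 + / e)%R ltac:(lra)) as [z [Hz E]].
      replace ((b - a) * lam - b) with (- ((b - a) * log_deriv l z)) 
        by (transitivity ((b - a) * lam - (b - a) * (log_deriv l z + lam)); [ring|rewrite E; reflexivity]).
      rewrite Cmod_opp, Cmod_mult, Rmult_assoc. apply Rmult_le_compat_l; auto.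
      eapply Rle_trans; [apply (log_deriv_far l rho); auto; lra|]. fold n.
      apply Rmult_le_compat_l; [lra|]. rewrite <- (Rinv_inv e). apply Rinv_le_contravar; lra. }
    replace ((b - a) * lam) with ((b - a) * lam - b + b) by ring. rewrite Z. ring. }
  assert (El : l = nil).
  { destruct (Sol _ (Rle_refl _)) as [z [Hz E]]. apply (log_deriv_far_neq_0 l rho z); auto.
    assert (Q : (b - a) * log_deriv l z = 0).
    { replace ((b - a) * log_deriv l z) with ((b - a) * (log_deriv l z + lam) - (b - a) * lam) by ring.
      rewrite E, E1. ring. }
    replace (log_deriv l z) with (((b - a) * log_deriv l z) / (b - a)) by (field; auto).
    rewrite Q. field. auto. }
  subst l.
  assert (Elam' : b / (b - a) = lam) by (rewrite <- E1 at 1; field; auto).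
  assert (Ff' : forall z, f z = K * Cexp (lam * z) + a).
  { intros z. rewrite Ff, Elam. unfold root_prod; simpl. ring. }
  assert (Fd' : forall z, df z = K * lam * Cexp (lam * z)).
  { intros z. rewrite Fd, Edg, Elam by (simpl; auto). unfold root_prod, log_deriv; simpl. ring. }
  split; [intros ->; apply Nba; ring|]. split; [|split; [|split; [|split]]].
  - exists K. split; auto. intros z. rewrite Elam'. apply Ff'.
  - intros z E. rewrite Ff' in E. apply (Cmult_neq_0 _ _ HK (Cexp_neq_0 (lam * z))).
    replace (K * Cexp (lam * z)) with (K * Cexp (lam * z) + a - a) by ring. rewrite E. ring.
  - intros z0 E. unfold b_point in E. split; [rewrite E; ring|].
    exists (K * lam * (Cexp (lam * z0) * (lam * 1)) - 0). split.
    + apply is_derive_has_cderiv. apply has_cderiv_minus; [|apply has_cderiv_const].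
      apply has_cderiv_ext with (fun w => K * lam * Cexp (lam * w)); [intros; rewrite Fd'; ring|].
      apply has_cderiv_scal. apply (has_cderiv_comp Cexp (fun w => lam * w)); [apply has_cderiv_Cexp|].
      apply has_cderiv_scal, has_cderiv_id.
    + replace (K * lam * (Cexp (lam * z0) * (lam * 1)) - 0) with (K * lam * (Cexp (lam * z0) * lam)) by ring.
      repeat apply Cmult_neq_0; auto. apply Cexp_neq_0.
  - intros z0. split; [|apply hfb]. intros E. fold df. rewrite Fd'.
    rewrite Ff' in E. rewrite <- E1. replace (b - a) with (K * Cexp (lam * z0)) by (rewrite <- E; ring). ring.
  - intros -> z. rewrite Ff', Fd'.
    replace lam with (RtoC 1); [ring|]. rewrite <- Elam'. field. auto.
Qed.
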